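(* Let $f(x,y)=(2x+y,\,x+y)\bmod 1$ be Thom's map, with invariant set $\Lambda=[0,1)^2\subset\mathbb{R}^2$ and invariant measure $\nu$ equal to Lebesgue measure on $\Lambda$. Let $\alpha>0$ and, for $p_M=(x_M,y_M)\in\mathbb{R}^2$, let $\phi_\alpha:\mathbb{R}^2\to\mathbb{R}$ be the observable $\phi_\alpha(p)=1-\operatorname{dist}(p,p_M)^\alpha$. Let $\xi$ be the tail index of the GEV limit distribution associated to the process $M_n=\max(X_1,\dots,X_n)$ with $X_n=\phi_\alpha\circ f^n$. Then for Lebesgue-almost every $p_M=(x_M,y_M)\in\mathbb{R}^2$ we have: \begin{itemize} \item $-\dfrac1\xi=\dfrac{2}{\alpha}$ if $p_M\in\Lambda$; \item $-\dfrac1\xi=\dfrac32$ if $p_M\notin\Lambda$, with either $y_M\in(0,1)$ or $x_M\in(0,1)$; \item $-\dfrac1\xi=2$ if $p_M\notin\Lambda$, with both $x_M\notin[0,1]$ and $y_M\notin[0,1]$. \end{itemize}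
   Context: The map $f$ is regarded as a map of $\mathbb{R}^2$ (reduction mod 1 takes values in $[0,1)^2$) having $\Lambda=[0,1)^2$ as invariant set; the process $X_n=\phi\circ f^n$ is considered on the probability space $(\Lambda,\nu)$, with $\nu$ Lebesgue measure. $\operatorname{dist}$ is Euclidean distance in $\mathbb{R}^2$. Generalised extreme value (GEV) distributions: for $\mu\in\mathbb{R}$, $\sigma>0$, $\xi\in\mathbb{R}$, $G(x)=\exp\left(-\left[1+\xi\frac{x-\mu}{\sigma}\right]^{-1/\xi}\right)$ on the set where $1+\xi\frac{x-\mu}{\sigma}>0$ (with the limit $\xi\to0$ taken when $\xi=0$). The GEV limit distribution associated to the process $M_n$ is the non-degenerate limit $G(x)=\lim_{n\to\infty}\nu\left(a_n(M_n-b_n)\le x\right)$ for suitable sequences $a_n>0$, $b_n\in\mathbb{R}$, and its parameter $\xi$ is called the tail index. For instance a limit of the form $\exp(-\tau(u))$ with $\tau(u)=c(-u)^{\beta}$ for $u<0$ ($c,\beta>0$) has tail index $\xi=-1/\beta$. *)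

(* Defs.v *)
From HB Require Import structures.
From mathcomp Require Import all_boot all_order all_algebra.
From mathcomp Require Import all_classical all_reals all_analysis.
Set Implicit Arguments.
Unset Strict Implicit.
Unset Printing Implicit Defensive.
Import Order.TTheory GRing.Theory Num.Theory.
Import numFieldNormedType.Exports.
Local Open Scope classical_set_scope.
Local Open Scope ring_scope.

Notation plane R := (measurableTypeR R * measurableTypeR R)%type.

Definition leb2 (R : realType) : {measure set (plane R) -> \bar R} :=
  (@lebesgue_measure R \x @lebesgue_measure R)%E.

Definition Lambda (R : realType) : set (plane R) := `[0, 1[ `*` `[0, 1[.

Lemma measurable_Lambda (R : realType) : measurable (@Lambda R).
Proof. by apply: measurableX; exact: measurable_itv. Qed.

Definition nu (R : realType) : set (plane R) -> \bar R :=
  mrestr (leb2 R) (@measurable_Lambda R).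

HB.instance Definition _ (R : realType) := Measure.on (@nu R).

Lemma nu_setT (R : realType) : nu [set: plane R] = 1%E.
Proof.
rewrite /nu /mrestr setTI.
apply: etrans; first by apply: product_measure1E; exact: measurable_itv.
rewrite /= !lebesgue_measure_itv /= lte_fin ltr01.
by rewrite -EFinB subr0 mule1.
Qed.

HB.instance Definition _ (R : realType) :=
  Measure_isProbability.Build _ _ _ (@nu R) (@nu_setT R).

Definition frac (R : realType) (x : R) : R := x - (Num.floor x)%:~R.

Definition thom (R : realType) (p : plane R) : plane R :=
  (frac (2 * p.1 + p.2), frac (p.1 + p.2)).

(* The norm on a product type is the max norm, so the Euclidean distance is
   written out. *)
Definition dist (R : realType) (p q : plane R) : R :=
  Num.sqrt ((p.1 - q.1) ^+ 2 + (p.2 - q.2) ^+ 2).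

Definition observable (R : realType) (alpha : R) (pM p : plane R) : R :=
  1 - dist p pM `^ alpha.

Definition process (R : realType) (phi : plane R -> R) (n : nat)
    (p : plane R) : R :=
  phi (iter n (@thom R) p).

(* max (X_1, ..., X_n) for n >= 1; the value X_1 at n = 0 is junk. *)
Definition partial_max (R : realType) (T : Type) (X : nat -> T -> R) (n : nat)
    (t : T) : R :=
  \big[Num.max/X 1 t]_(1 <= i < n.+1) X i t.

(* Cumulative distribution function of GEV (m, s, xi). Where
   1 + xi * (x - m) / s <= 0 the point x lies below the support if xi > 0 and
   above it if xi < 0. *)
Definition gev (R : realType) (m s xi x : R) : R :=
  let z := (x - m) / s in
  if xi == 0 then expR (- expR (- z))
  else if 0 < 1 + xi * z then expR (- ((1 + xi * z) `^ (- xi^-1)))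
  else if 0 < xi then 0 else 1.

(* Both the normalising sequences and the location and scale of the limit are
   existentially quantified: they are not unique, the tail index is. *)
Definition is_tail_index d (T : measurableType d) (R : realType)
    (P : probability T R) (X : nat -> T -> R) (xi : R) : Prop :=
  exists a b : nat -> R, exists m s : R,
    [/\ forall n, 0 < a n, 0 < s &
        forall x : R,
          (fun n => P [set t | a n * (partial_max X n t - b n) <= x])
            @ \oo --> (gev m s xi x)%:E].

(* Main.v *)
From mathcomp Require Import all_boot all_order all_algebra.
From mathcomp Require Import all_classical all_reals all_analysis.
From mathcomp Require Import measurable_realfun.
Require Import Defs.
Import Order.TTheory GRing.Theory Num.Theory.
Import numFieldNormedType.Exports.
From mathcomp Require Import ring lra zify.
Local Open Scope classical_set_scope.
Local Open Scope ring_scope.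

(** The maximum of the first n observations is at most [1 - rho `^ alpha]
    exactly when the orbit avoids, at the times 1 to n, the part of the unit
    square at distance less than [rho] from the centre [pM]. Let [D] be the
    distance from [pM] to the square. All cases reduce to a hitting law: for
    some exponent [b] and some [kappa > 0], the probability of avoiding the
    target of radius [D + delta n] up to time n tends to [expR (- (kappa * c))]
    whenever [n * delta n `^ b] tends to [c].

    Given the hitting law, the normalised maximum converges to a Weibull law.
    Its shape is [b / alpha] if [D = 0], where the observable drops by
    [delta `^ alpha] at distance [delta], and [b] if [D > 0], where it drops
    linearly in [delta]. Quantiles of a sequence of laws converge, so any other
    normalisation with a generalised extreme value limit has the same tail
    index ([tail_index_of_hitting_law]).

    The hitting law comes from hyperbolicity. A subset of the torus is a
    periodic subset of the plane, and [pr] is invariant under translations and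
    under the linear lift of Thom's map. Iterating a set forwards makes it
    almost invariant under unstable translations, and iterating another one
    backwards makes it almost invariant under stable ones. Since both
    directions together span the plane, averaging over all translations shows
    that the two are almost independent, with an error that decays
    exponentially ([mixing]); the only regularity needed is a Lipschitz bound
    on the measure that a translation moves out of a set ([modulus]). It follows
    that the probability of avoiding [A] is multiplied at each step by
    [1 - pr A], up to an error governed by the returns to [A] within a time
    logarithmic in n ([avoid_geometric]). If these short returns are negligible
    ([no_clusters]), the exponential law holds ([cvg_avoid]).

    Inside the square and in front of a side, short returns are negligible for
    almost every centre: integrating the probability of a return at a given
    time over all centres gains one power of the radius, and the Borel-Cantelli
    lemma along dyadic n concludes ([ae_return_sum_radius]). In front of a
    corner, the point of the square nearest to [pM] is the fixed point of the
    map, and visits do come in runs, so the target is replaced by the set of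
    points that leave it at the next step: every run ends with such an escape,
    unless it is still going on at time n ([cvg_avoid_exit]). An orbit moves monotonically
    near the fixed point, so it cannot come back without going around the torus
    ([return_through_corner]); this takes a time after which the two visits are
    nearly independent ([late_return]). No centre is exceptional there.

    It remains to measure the targets. Inside the square the target is a disc
    and [b = 2]. In front of a side it is a cap of depth [delta] and width of
    order [sqrt delta], hence [b = 3 / 2]. In front of a corner it is, to first
    order, a right triangle with sides of order [delta], hence [b = 2] again. *)
Set Implicit Arguments.
Unset Strict Implicit.
Unset Printing Implicit Defensive.

(** * Lebesgue measure and affine maps *)

Section lebesgue_affine.
Variable R : realType.
Notation leb := (@lebesgue_measure R).
Notation RR := (measurableTypeR R).

Lemma measurable_affine (a c : R) :
  measurable_fun setT (fun x : RR => (a * x + c : RR)).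
Proof.
exact: (@measurable_funD _ RR).
Qed.

Lemma lebesgue_affine_gt0 (a c : R) (A : set RR) : 0 < a -> measurable A ->
  (leb A = a%:E * leb ((fun x => (a * x + c)%R) @^-1` A))%E.
Proof.
move=> a0 mA.
pose f : RR -> RR := fun x => a * x + c.
have mf : measurable_fun setT f by exact: measurable_affine.
pose m : {measure set RR -> \bar R} :=
  mscale (NngNum (ltW a0)) (pushforward leb f).
rewrite (@lebesgue_measure_unique R (m mf))// => _ [[u v]] _ <-.
rewrite /m /mscale /pushforward/=.
have fE : f @^-1` `]u, v] = `](u - c) / a, (v - c) / a]%classic.
  apply/seteqP; split => x /=; rewrite !in_itv/= /f ltr_pdivrMr// ler_pdivlMr// ltrBlDr lerBrDr mulrC//.
change (leb `]u, v] = a%:E * leb (f @^-1` `]u, v]))%E.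
rewrite fE !lebesgue_measure_itv/= !lte_fin ltr_pM2r ?invr_gt0// ltrD2r.
case: ifP => _; last by rewrite mule0.
rewrite -!EFinD -EFinM; congr EFin; field.
by rewrite gt_eqF.
Qed.

Lemma lebesgue_translation (c : R) (A : set RR) : measurable A ->
  leb ((fun x => x + c) @^-1` A) = leb A.
Proof.
move=> mA; rewrite (lebesgue_affine_gt0 c ltr01 mA) mul1e.
by under [in RHS]eq_fun do rewrite mul1r.
Qed.
End lebesgue_affine.

(** * Slices of planar sets and periodic sets of the line *)

Section slices.
Variable R : realType.
Notation leb := (@lebesgue_measure R).
Notation RR := (measurableTypeR R).
Implicit Types E F : set (plane R).

Lemma xsection_slice E (x : RR) : xsection E x = [set y | E (x, y)].
Proof. by apply/seteqP; split => y; rewrite /xsection/= inE. Qed.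

Lemma ysection_slice E (y : RR) : ysection E y = [set x | E (x, y)].
Proof. by apply/seteqP; split => x; rewrite /ysection/= inE. Qed.

Lemma measurable_xslice E (x : RR) :
  measurable E -> measurable ([set y | E (x, y)] : set RR).
Proof. by move=> mE; rewrite -xsection_slice; exact: measurable_xsection. Qed.

Lemma measurable_yslice E (y : RR) :
  measurable E -> measurable ([set x | E (x, y)] : set RR).
Proof. by move=> mE; rewrite -ysection_slice; exact: measurable_ysection. Qed.

Lemma leb2_le_xslice E F (c : R) : measurable E -> measurable F -> 0 <= c ->
  (forall x, leb [set y | E (x, y)] <= c%:E * leb [set y | F (x, y)])%E ->
  (leb2 R E <= c%:E * leb2 R F)%E.
Proof.
move=> mE mF c0 EF; rewrite /leb2/= /product_measure1.
have mE' : measurable_fun setT (leb \o xsection E) by exact: measurable_fun_xsection.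
have mF' : measurable_fun setT (leb \o xsection F) by exact: measurable_fun_xsection.
rewrite -ge0_integralZl//.
apply: ge0_le_integral => //=; first by apply: measurable_funeM.
by move=> x _; rewrite !xsection_slice.
Qed.

Lemma leb2_ysection E : measurable E ->
  leb2 R E = (\int[leb]_y leb (ysection E y))%E.
Proof.
move=> mE; rewrite /leb2/=.
rewrite (@product_measure_unique _ _ _ _ _ leb leb (leb \x^ leb)%E)//.
by move=> A B mA mB; exact: product_measure2E.
Qed.

Lemma leb2_le_yslice E F (c : R) : measurable E -> measurable F -> 0 <= c ->
  (forall y, leb [set x | E (x, y)] <= c%:E * leb [set x | F (x, y)])%E ->
  (leb2 R E <= c%:E * leb2 R F)%E.
Proof.
move=> mE mF c0 EF; rewrite !leb2_ysection//.
have mE' : measurable_fun setT (leb \o ysection E) by exact: measurable_fun_ysection.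
have mF' : measurable_fun setT (leb \o ysection F) by exact: measurable_fun_ysection.
rewrite -ge0_integralZl//.
apply: ge0_le_integral => //=; first by apply: measurable_funeM.
by move=> x _; rewrite !ysection_slice.
Qed.

End slices.

Section periodic_line.
Variable R : realType.
Notation leb := (@lebesgue_measure R).
Notation RR := (measurableTypeR R).
Implicit Types A : set RR.

Definition periodic1 A := forall (x : R) (i : int), A (x + i%:~R) <-> A x.

Lemma frac_itv (x : R) : 0 <= frac x < 1.
Proof.
by have := floor_itv x; rewrite /frac intrD => /andP[? ?]; apply/andP; split; lra.
Qed.

Lemma periodic1_preim_affine A (k : nat) (v : R) :
  periodic1 A -> periodic1 [set x | A (k%:R * x + v)].
Proof.
move=> pA x i /=; rewrite mulrDr addrAC.
have -> : k%:R * i%:~R = (k%:Z * i)%:~R :> R by rewrite intrM.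
exact: pA.
Qed.

Lemma measurable_preim_affine A (k v : R) : measurable A ->
  measurable ([set x | A (k * x + v)] : set RR).
Proof. 
by move=> mA; rewrite -[X in measurable X]setTI; exact: measurable_affine.
Qed.

Lemma lebesgue_periodic_shift A (v : R) : measurable A -> periodic1 A ->
  leb ([set x | A (x + v)] `&` `[0, 1[) = leb (A `&` `[0, 1[).
Proof.
move=> mA pA.
wlog /andP[v0 v1] : v / 0 <= v < 1.
  move=> /(_ (v - (Num.floor v)%:~R)) <-.
    by congr (leb (_ `&` _)); apply/seteqP; split => x /=;
       rewrite addrA -mulrNz pA.
  exact: frac_itv.
have mB : measurable ([set x | A (x + v)] : set RR).
  by have := measurable_preim_affine 1 v mA; under eq_set do rewrite mul1r.
have spl (B : set RR) (w : R) : measurable B -> 0 <= w <= 1 ->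
  leb (B `&` `[0, 1[) = (leb (B `&` `[0%R, w[) + leb (B `&` `[w, 1%R[))%E.
  move=> mB' /andP[w0 w1]; rewrite -measureU//.
  - rewrite -setIUr; congr (leb (_ `&` _)).
    apply/seteqP; split => x /=; rewrite !in_itv/=.
      by move=> /andP[-> ->]; rewrite andbT; case: ltP => ?; [left|right].
    case=> /andP[a b]; apply/andP; split=> //.
      exact: lt_le_trans w1.
    exact: le_trans a.
  - by apply: measurableI => //; exact: measurable_itv.
  - by apply: measurableI => //; exact: measurable_itv.
  - apply/seteqP; split => x //= [[_ +] [_ +]].
    by rewrite !in_itv/= => /andP[_ a] /andP[b _]; move: (lt_le_trans a b); rewrite ltxx.
rewrite (spl [set x | A (x + v)] (1 - v))//; last by apply/andP; split; lra.
rewrite (spl A v)//; last by apply/andP; split; lra.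
rewrite addeC; congr (_ + _)%E.
- rewrite -(lebesgue_translation (v - 1) (A := A `&` _))//; last first.
    by apply: measurableI => //; exact: measurable_itv.
  congr (leb _); apply/seteqP; split => x /=; rewrite !in_itv/=.
    move=> [a /andP[b c]]; split; last by apply/andP; split; lra.
    by apply/(pA _ 1); rewrite mulr1z -addrA subrK.
  move=> [a /andP[b c]]; split; last by apply/andP; split; lra.
  by move/(pA _ 1) : a; rewrite mulr1z -addrA subrK.
- rewrite -(lebesgue_translation v (A := A `&` _))//; last first.
    by apply: measurableI => //; exact: measurable_itv.
  by congr (leb _); apply/seteqP; split => x /=; rewrite !in_itv/=;
     move=> [a /andP[b c]]; split => //; apply/andP; split; lra.
Qed.

Lemma lebesgue_periodic_nat A (k : nat) : measurable A -> periodic1 A ->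
  leb (A `&` `[0, k%:R[) = (k%:R%:E * leb (A `&` `[0%R, 1%R[))%E.
Proof.
move=> mA pA; elim: k => [|k IH].
  by rewrite mul0e set_itvco0 setI0 measure0.
have kk : k%:R <= k.+1%:R :> R by rewrite ler_nat.
rewrite (_ : `[0, k.+1%:R[%classic = `[0, k%:R[ `|` `[k%:R, k.+1%:R[); last first.
  apply/seteqP; split => x /=; rewrite !in_itv/=.
    by move=> /andP[-> ->]; rewrite andbT; case: ltP => ?; [left|right].
  case=> /andP[a b]; apply/andP; split=> //.
    exact: lt_le_trans kk.
  exact: le_trans a.
rewrite setIUr measureU//=; last first.
- apply/seteqP; split => x //= [[_ +] [_ +]].
  by rewrite !in_itv/= => /andP[_ a] /andP[b _]; move: (lt_le_trans a b); rewrite ltxx.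
- by apply: measurableI => //; exact: measurable_itv.
- by apply: measurableI => //; exact: measurable_itv.
rewrite IH -addn1 natrD EFinD ge0_muleDl// mul1e; congr (_ + _)%E.
rewrite -[LHS](lebesgue_translation (k%:R))//=; last first.
  by apply: measurableI => //; exact: measurable_itv.
congr (leb _); apply/seteqP; split => x /=; rewrite !in_itv/= (pA _ k%:Z).
  by move=> [a /andP[b c]]; split => //; apply/andP; split; lra.
by move=> [a /andP[b c]]; split => //; apply/andP; split; lra.
Qed.

(** The map x |-> k x + v wraps the circle k times around itself, and each turn
    carries the same mass. *)
Lemma lebesgue_periodic_affine A (k : nat) (v : R) : (0 < k)%N ->
  measurable A -> periodic1 A ->
  leb ([set x | A (k%:R * x + v)] `&` `[0, 1[) = leb (A `&` `[0, 1[).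
Proof.
move=> k0 mA pA.
have kp : 0 < k%:R :> R by rewrite ltr0n.
pose B : set RR := [set x | A (x + v)].
have mB : measurable B.
  by have := measurable_preim_affine 1 v mA; under eq_set do rewrite mul1r.
have pB : periodic1 B.
  by have := @periodic1_preim_affine A 1 v pA; under eq_set do rewrite mul1r.
rewrite -(lebesgue_periodic_shift v)//.
have := lebesgue_periodic_nat k mB pB.
rewrite (lebesgue_affine_gt0 0 kp); last first.
  by apply: measurableI => //; exact: measurable_itv.
move=> /(congr1 (mule (k%:R^-1)%:E)).
rewrite !muleA -!EFinM mulVf ?gt_eqF// !mul1e => <-.
congr (leb _); apply/seteqP; split => x /=; rewrite /B !in_itv/= addr0.
  move=> [a /andP[b c]]; split => //; apply/andP; split; first by rewrite mulr_ge0// ltW.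
  by rewrite -ltr_pdivlMl// mulVf// gt_eqF.
move=> [a /andP[b c]]; split => //; apply/andP; split; first by rewrite pmulr_rge0 in b.
by move: c; rewrite -ltr_pdivlMl// mulVf// gt_eqF.
Qed.

End periodic_line.

(** * The invariant probability *)

Section probability.
Variable R : realType.
Notation leb := (@lebesgue_measure R).
Notation RR := (measurableTypeR R).
Implicit Types E F : set (plane R).

(** The lock keeps unification from comparing two probabilities by unfolding
    the product measure. *)
Fact pr_key : unit. Proof. by []. Qed.
Definition pr E : R := locked_with pr_key (fine (nu E)).

Lemma prE E : pr E = fine (nu E).
Proof. by rewrite /pr unlock. Qed.

Lemma nu_fin E : measurable E -> nu E \is a fin_num.
Proof. by move=> mE; exact: (@fin_num_measure _ _ _ (@nu R)). Qed.

Lemma prK E : measurable E -> (pr E)%:E = nu E.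
Proof. by move=> mE; rewrite prE fineK// nu_fin. Qed.

Lemma pr_ge0 E : 0 <= pr E.
Proof. by rewrite prE fine_ge0//; exact: (@measure_ge0 _ _ _ (@nu R)). Qed.

Lemma pr_setT : pr setT = 1.
Proof. by rewrite prE (@probability_setT _ _ _ (@nu R)). Qed.

Lemma pr_set0 : pr set0 = 0.
Proof. by rewrite prE (@measure0 _ _ _ (@nu R)). Qed.

Lemma le_pr E F : measurable E -> measurable F -> E `<=` F -> pr E <= pr F.
Proof.
move=> mE mF EF; rewrite -lee_fin (prK mE) (prK mF).
by apply: (@le_measure _ _ _ (@nu R)); rewrite ?inE.
Qed.

Lemma pr_le1 E : measurable E -> pr E <= 1.
Proof. by move=> mE; rewrite -pr_setT; exact: le_pr. Qed.

Lemma pr_setU E F : measurable E -> measurable F -> pr (E `|` F) <= pr E + pr F.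
Proof.
move=> mE mF; rewrite -lee_fin EFinD (prK mE) (prK mF) (prK (measurableU _ _ mE mF)).
exact: (@measureU2 _ _ _ (@nu R)).
Qed.

Lemma pr_setDI E F : measurable E -> measurable F ->
  pr E = pr (E `\` F) + pr (E `&` F).
Proof.
move=> mE mF; apply: EFin_inj.
rewrite EFinD (prK mE) (prK (measurableD mE mF)) (prK (measurableI _ _ mE mF)).
exact: (@measureDI _ _ _ (@nu R)).
Qed.

Lemma pr_setC E : measurable E -> pr (~` E) = 1 - pr E.
Proof.
move=> mE; have := pr_setDI measurableT mE.
rewrite pr_setT setTI setTD => ->.
by rewrite addrK.
Qed.

Lemma measurable_ILambda E : measurable E -> measurable (E `&` @Lambda R).
Proof. by move=> mE; apply: measurableI => //; exact: measurable_Lambda. Qed.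

Lemma Lambda_xslice E (x : R) : 0 <= x < 1 ->
  [set y | (E `&` @Lambda R) (x, y)] = [set y | E (x, y)] `&` `[0, 1[.
Proof.
move=> x01; apply/seteqP; split => y /=; rewrite /Lambda/= !in_itv/=.
  by move=> [? [_ ?]].
by move=> [? ?].
Qed.

Lemma Lambda_yslice E (y : R) : 0 <= y < 1 ->
  [set x | (E `&` @Lambda R) (x, y)] = [set x | E (x, y)] `&` `[0, 1[.
Proof.
move=> y01; apply/seteqP; split => x /=; rewrite /Lambda/= !in_itv/=.
  by move=> [? [? _]].
by move=> [? ?].
Qed.

Lemma pr_le_xslice E F (c : R) : measurable E -> measurable F -> 0 <= c ->
  (forall x : R, 0 <= x < 1 ->
    (leb ([set y | E (x, y)] `&` `[0%R, 1%R[) <=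
     c%:E * leb ([set y | F (x, y)] `&` `[0%R, 1%R[))%E) ->
  pr E <= c * pr F.
Proof.
move=> mE mF c0 EF; rewrite -lee_fin EFinM (prK mE) (prK mF).
apply: leb2_le_xslice => //; [exact: measurable_ILambda|exact: measurable_ILambda|] => x.
have [x01|x01] := boolP (0 <= x < 1); first by rewrite !Lambda_xslice// EF.
rewrite (_ : [set y | _] = set0) ?measure0 ?mule_ge0//.
by apply/seteqP; split => y //=; rewrite /Lambda/= !in_itv/= (negbTE x01) => -[_ []].
Qed.

Lemma pr_le_yslice E F (c : R) : measurable E -> measurable F -> 0 <= c ->
  (forall y : R, 0 <= y < 1 ->
    (leb ([set x | E (x, y)] `&` `[0%R, 1%R[) <=
     c%:E * leb ([set x | F (x, y)] `&` `[0%R, 1%R[))%E) ->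
  pr E <= c * pr F.
Proof.
move=> mE mF c0 EF; rewrite -lee_fin EFinM (prK mE) (prK mF).
apply: leb2_le_yslice => //; [exact: measurable_ILambda|exact: measurable_ILambda|] => y.
have [y01|y01] := boolP (0 <= y < 1); first by rewrite !Lambda_yslice// EF.
rewrite (_ : [set x | _] = set0) ?measure0 ?mule_ge0//.
by apply/seteqP; split => x //=; rewrite /Lambda/= !in_itv/= (negbTE y01) => -[_ []].
Qed.

Lemma pr_eq_xslice E F : measurable E -> measurable F ->
  (forall x : R, 0 <= x < 1 -> leb ([set y | E (x, y)] `&` `[0, 1[) =
     leb ([set y | F (x, y)] `&` `[0, 1[)) ->
  pr E = pr F.
Proof.
move=> mE mF EF; apply/le_anti/andP; split.
  by rewrite -(mul1r (pr F)); apply: pr_le_xslice => // x /EF ->; rewrite mul1e.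
by rewrite -(mul1r (pr E)); apply: pr_le_xslice => // x /EF ->; rewrite mul1e.
Qed.

Lemma pr_eq_yslice E F : measurable E -> measurable F ->
  (forall y : R, 0 <= y < 1 -> leb ([set x | E (x, y)] `&` `[0, 1[) =
     leb ([set x | F (x, y)] `&` `[0, 1[)) ->
  pr E = pr F.
Proof.
move=> mE mF EF; apply/le_anti/andP; split.
  by rewrite -(mul1r (pr F)); apply: pr_le_yslice => // x /EF ->; rewrite mul1e.
by rewrite -(mul1r (pr E)); apply: pr_le_yslice => // x /EF ->; rewrite mul1e.
Qed.

Lemma pr_setXT (A : set RR) : measurable A ->
  (pr (A `*` setT))%:E = leb (A `&` `[0, 1[).
Proof.
move=> mA; rewrite prK; last exact: measurableX.
rewrite /nu /mrestr (_ : _ `&` _ = (A `&` `[0, 1[) `*` `[0, 1[); last first.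
  by apply/seteqP; split => -[x y] /=; rewrite /Lambda/=; tauto.
apply: etrans.
  by apply: product_measure1E; [apply: measurableI => //|]; exact: measurable_itv.
by rewrite [X in (_ * X)%E]lebesgue_measure_itv/= lte_fin ltr01 sube0 mule1.
Qed.

Lemma pr_setTX (A : set RR) : measurable A ->
  (pr (setT `*` A))%:E = leb (A `&` `[0, 1[).
Proof.
move=> mA; rewrite prK; last exact: measurableX.
rewrite /nu /mrestr (_ : _ `&` _ = `[0, 1[ `*` (A `&` `[0, 1[)); last first.
  by apply/seteqP; split => -[x y] /=; rewrite /Lambda/=; tauto.
apply: etrans.
  by apply: product_measure1E; [|apply: measurableI => //]; exact: measurable_itv.
by rewrite [X in (X * _)%E]lebesgue_measure_itv/= lte_fin ltr01 sube0 mul1e.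
Qed.

End probability.


(** * Subsets of the torus and the linear lift of the map *)

Section torus.
Variable R : realType.
Notation leb := (@lebesgue_measure R).
Notation RR := (measurableTypeR R).
Implicit Types (E F : set (plane R)) (p v : plane R).

Definition periodic E :=
  forall p (i j : int), E (p.1 + i%:~R, p.2 + j%:~R) <-> E p.

Definition toral E := measurable E /\ periodic E.

Definition trans v p : plane R := (p.1 + v.1, p.2 + v.2).
Definition catM p : plane R := (2 * p.1 + p.2, p.1 + p.2).
Definition catMi p : plane R := (p.1 - p.2, 2 * p.2 - p.1).
Definition tor p : plane R := (frac p.1, frac p.2).

Lemma toral_meas E : toral E -> measurable E. Proof. by case. Qed.

Lemma toralT : toral setT.
Proof. by split. Qed.

Lemma toralC E : toral E -> toral (~` E).
Proof. by move=> [mE pE]; split; [exact: measurableC|move=> p i j /=; rewrite pE]. Qed.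

Lemma toralI E F : toral E -> toral F -> toral (E `&` F).
Proof.
by move=> [mE pE] [mF pF]; split; [exact: measurableI|move=> p i j /=; rewrite pE pF].
Qed.

Lemma toralD E F : toral E -> toral F -> toral (E `\` F).
Proof. by move=> tE tF; rewrite setDE; apply: toralI => //; exact: toralC. Qed.

Lemma measurable_coord1 : measurable_fun setT (fun p : plane R => p.1 : R).
Proof. exact: measurable_fst. Qed.
Lemma measurable_coord2 : measurable_fun setT (fun p : plane R => p.2 : R).
Proof. exact: measurable_snd. Qed.

Lemma measurable_lin (a b c : R) :
  measurable_fun setT (fun p : plane R => a * p.1 + b * p.2 + c : R).
Proof.
apply: measurable_funD => //; apply: measurable_funD.
  by apply: measurable_funM => //; exact: measurable_coord1.
by apply: measurable_funM => //; exact: measurable_coord2.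
Qed.

Lemma measurable_linE (f : plane R -> R) (a b c : R) :
  (forall p, f p = a * p.1 + b * p.2 + c) -> measurable_fun setT f.
Proof. by move=> fE; rewrite (funext fE); exact: measurable_lin. Qed.

Lemma measurable_mkplane d (T : measurableType d) (f g : T -> R) :
  measurable_fun setT f -> measurable_fun setT g ->
  measurable_fun setT (fun t : T => (f t, g t) : plane R).
Proof. by move=> mf mg; apply: (@measurable_fun_pair _ _ _ T RR RR). Qed.

Lemma measurable_preim (f : plane R -> plane R) E :
  measurable_fun setT f -> measurable E -> measurable [set p | E (f p)].
Proof. by move=> mf mE; rewrite -[X in measurable X]setTI; exact: mf. Qed.

Lemma measurable_catM : measurable_fun setT catM.
Proof.
apply: measurable_mkplane.
  by apply: (@measurable_linE _ 2 1 0) => p /=; ring.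
by apply: (@measurable_linE _ 1 1 0) => p /=; ring.
Qed.

Lemma measurable_catMi : measurable_fun setT catMi.
Proof.
apply: measurable_mkplane.
  by apply: (@measurable_linE _ 1 (-1) 0) => p /=; ring.
by apply: (@measurable_linE _ (-1) 2 0) => p /=; ring.
Qed.

Lemma measurable_trans v : measurable_fun setT (trans v).
Proof.
apply: measurable_mkplane.
  by apply: (@measurable_linE _ 1 0 v.1) => p /=; ring.
by apply: (@measurable_linE _ 0 1 v.2) => p /=; ring.
Qed.

Lemma measurable_frac : measurable_fun setT (@frac R).
Proof.
apply: measurable_funB; first exact: measurable_id.
apply: nondecreasing_measurable => // x y xy.
by rewrite ler_int floor_ge_int (le_trans (ge_floor x)).
Qed.

Lemma measurable_tor : measurable_fun setT tor.
Proof.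
apply: measurable_mkplane; apply: measurableT_comp.
- exact: measurable_frac.
- exact: measurable_coord1.
- exact: measurable_frac.
- exact: measurable_coord2.
Qed.

Lemma toral_catM E : toral E -> toral (catM @^-1` E).
Proof.
move=> [mE pE]; split.
  by rewrite -[X in measurable X]setTI; exact: measurable_catM.
move=> p i j /=; rewrite -(pE (catM p) (2 * i + j) (i + j)) /catM/=.
by rewrite !intrD intrM mulrDr addrACA [X in (_, X)]addrACA.
Qed.

Lemma toral_catMi E : toral E -> toral (catMi @^-1` E).
Proof.
move=> [mE pE]; split.
  by rewrite -[X in measurable X]setTI; exact: measurable_catMi.
move=> p i j /=; rewrite -(pE (catMi p) (i - j) (2 * j - i)) /catMi/=.
rewrite !intrB intrM (_ : (_, _) = (p.1 - p.2 + (i%:~R - j%:~R), 2 * p.2 - p.1 + (2 * j%:~R - i%:~R)))//.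
by congr pair; ring.
Qed.

Lemma toral_trans v E : toral E -> toral (trans v @^-1` E).
Proof.
move=> [mE pE]; split.
  by rewrite -[X in measurable X]setTI; exact: measurable_trans.
move=> p i j /=; rewrite -(pE (trans v p) i j) /trans/=.
by rewrite addrAC [X in (_, X)]addrAC.
Qed.

Lemma toral_iter (f : plane R -> plane R) n E :
  (forall E, toral E -> toral (f @^-1` E)) -> toral E -> toral (iter n f @^-1` E).
Proof.
move=> tf tE; elim: n => [|n IH] //.
rewrite (_ : _ @^-1` E = f @^-1` (iter n f @^-1` E)); first exact: tf.
by apply/seteqP; split => p /=; rewrite -iterS iterSr.
Qed.

Lemma periodic_yslice E (y : R) : toral E ->
  measurable ([set x | E (x, y)] : set RR) /\ periodic1 [set x | E (x, y)].
Proof.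
move=> [mE pE]; split; first exact: measurable_yslice.
by move=> x i /=; rewrite -(pE (x, y) i 0)/= addr0.
Qed.

Lemma periodic_xslice E (x : R) : toral E ->
  measurable ([set y | E (x, y)] : set RR) /\ periodic1 [set y | E (x, y)].
Proof.
move=> [mE pE]; split; first exact: measurable_xslice.
by move=> y i /=; rewrite -(pE (x, y) 0 i)/= addr0.
Qed.

(** Slice by slice, a shear is a translation of the circle; translations and
    the linear lift are compositions of shears. *)
Lemma pr_xshear E (k v : R) : toral E ->
  pr [set p | E (p.1 + k * p.2 + v, p.2)] = pr E.
Proof.
move=> tE; apply: pr_eq_yslice; [|exact: toral_meas|].
  apply: (@measurable_preim (fun p => (p.1 + k * p.2 + v, p.2))).
    apply: measurable_mkplane; last exact: measurable_coord2.
    by apply: (@measurable_linE _ 1 k v) => p /=; ring.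
  exact: toral_meas.
move=> y _; have [mA pA] := periodic_yslice y tE.
rewrite -[RHS](lebesgue_periodic_shift (k * y + v) mA pA)/=.
by congr (leb (_ `&` _)); apply/seteqP; split => x /=; rewrite addrA.
Qed.

Lemma pr_yshear E (k v : R) : toral E ->
  pr [set p | E (p.1, p.2 + k * p.1 + v)] = pr E.
Proof.
move=> tE; apply: pr_eq_xslice; [|exact: toral_meas|].
  apply: (@measurable_preim (fun p => (p.1, p.2 + k * p.1 + v))).
    apply: measurable_mkplane; first exact: measurable_coord1.
    by apply: (@measurable_linE _ k 1 v) => p /=; ring.
  exact: toral_meas.
move=> x _; have [mA pA] := periodic_xslice x tE.
rewrite -[RHS](lebesgue_periodic_shift (k * x + v) mA pA)/=.
by congr (leb (_ `&` _)); apply/seteqP; split => y /=; rewrite addrA.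
Qed.

Lemma pr_trans v E : toral E -> pr (trans v @^-1` E) = pr E.
Proof.
move=> tE; rewrite -(pr_xshear 0 v.1 tE).
have tE' : toral (trans (v.1, 0) @^-1` E) by exact: toral_trans.
rewrite (_ : [set p | _] = trans (v.1, 0) @^-1` E); last first.
  by apply/seteqP; split => p /=; rewrite /trans/= mul0r !addr0.
rewrite -(pr_yshear 0 v.2 tE'); congr pr.
by apply/seteqP; split => p /=; rewrite /trans/= mul0r !addr0.
Qed.

Lemma pr_catM E : toral E -> pr (catM @^-1` E) = pr E.
Proof.
move=> tE; rewrite -(pr_xshear 1 0 tE).
have tE' : toral [set p | E (p.1 + p.2, p.2)].
  case: tE => mE pE; split.
    apply: (@measurable_preim (fun p => (p.1 + p.2, p.2))) => //.
    apply: measurable_mkplane; last exact: measurable_coord2.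
    by apply: (@measurable_linE _ 1 1 0) => p /=; ring.
  by move=> p i j /=; rewrite addrACA -intrD (pE (p.1 + p.2, p.2)).
rewrite (_ : [set p | _] = [set p | E (p.1 + p.2, p.2)]); last first.
  by apply/seteqP; split => p /=; rewrite mul1r !addr0.
rewrite -(pr_yshear 1 0 tE'); congr pr.
apply/seteqP; split => p /=; rewrite /catM/= mul1r !addr0 addrA.
  by rewrite [p.2 + _]addrC (_ : p.1 + p.2 + p.1 = 2 * p.1 + p.2)//; ring.
by rewrite [p.2 + _]addrC (_ : p.1 + p.2 + p.1 = 2 * p.1 + p.2)//; ring.
Qed.

Lemma catMK : cancel catM catMi.
Proof. by move=> [x y]; rewrite /catM /catMi/=; congr pair; ring. Qed.

Lemma catMiK : cancel catMi catM.
Proof. by move=> [x y]; rewrite /catM /catMi/=; congr pair; ring. Qed.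

Lemma iter_catMK n p : iter n catMi (iter n catM p) = p.
Proof. by elim: n => // n IH; rewrite iterSr iterS catMK. Qed.

Lemma iter_catMiK n p : iter n catM (iter n catMi p) = p.
Proof. by elim: n => // n IH; rewrite iterSr iterS catMiK. Qed.

Lemma pr_catMi E : toral E -> pr (catMi @^-1` E) = pr E.
Proof.
move=> tE; rewrite -[LHS]pr_catM; last exact: toral_catMi.
by congr pr; apply/seteqP; split => p /=; rewrite catMK.
Qed.

Lemma pr_iter (f : plane R -> plane R) n E :
  (forall E, toral E -> toral (f @^-1` E)) ->
  (forall E, toral E -> pr (f @^-1` E) = pr E) ->
  toral E -> pr (iter n f @^-1` E) = pr E.
Proof.
move=> tf pf tE; elim: n => [|n IH]; first by [].
rewrite (_ : _ @^-1` E = f @^-1` (iter n f @^-1` E)).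
  by rewrite (pf _ (toral_iter n tf tE)) IH.
by apply/seteqP; split => p /=; rewrite -iterS iterSr.
Qed.

End torus.

(** * Averaging over translations *)

Section averaging.
Variable R : realType.
Implicit Types (E F : set (plane R)) (p v : plane R).

Lemma tor_Lambda v : Lambda (tor v).
Proof.
split; rewrite /tor/= in_itv/=.
- by have /andP[-> ->] := frac_itv v.1.
- by have /andP[-> ->] := frac_itv v.2.
Qed.

Lemma toral_trans_tor E v p : toral E -> E (trans (tor v) p) <-> E (trans v p).
Proof.
move=> [_ pE]; rewrite -(pE (trans v p) (- Num.floor v.1) (- Num.floor v.2)).
by rewrite /trans /tor /frac !mulrNz/= !addrA.
Qed.

Lemma toral_negtrans E p : toral E -> pr [set v | E (trans v p)] = pr E.
Proof.
move=> tE; rewrite -(pr_trans p tE); congr pr; apply/seteqP; split=> v /=;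
  by rewrite /trans addrC [X in (_, X)]addrC.
Qed.

(** By Fubini, the average over v of the right-hand side is the integral over
    F of the probability that v + x falls in E, and this probability is pr E
    whatever x is. *)
Lemma average_translates E F (c : R) : toral E -> toral F ->
  (forall v, Lambda v -> c <= pr [set x | E (trans v x) /\ F x]) ->
  c <= pr E * pr F.
Proof.
move=> tE tF cEF.
have [mE mF] := (toral_meas tE, toral_meas tF).
have cEF' v : c <= pr [set x | E (trans v x) /\ F x].
  apply: (le_trans (cEF _ (tor_Lambda v))); rewrite le_eqVlt; apply/orP; left.
  by apply/eqP; congr pr; apply/seteqP; split=> x /=; rewrite toral_trans_tor.
have [c0|c0] := leP c 0; first by rewrite (le_trans c0)// mulr_ge0// pr_ge0.
pose G : set (plane R * plane R) := [set vx | E (trans vx.1 vx.2) /\ F vx.2].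
have mG : measurable G.
  pose f (vx : plane R * plane R) : plane R :=
    (vx.2.1 + vx.1.1, vx.2.2 + vx.1.2).
  rewrite (_ : G = (setT `&` f @^-1` E) `&` (setT `&` snd @^-1` F)); last first.
    by rewrite !setTI.
  apply: measurableI; last exact: measurable_snd.
  suff mf : measurable_fun setT f by exact: mf.
  apply: measurable_mkplane => //; apply: measurable_funD.
  - by apply: (measurableT_comp (@measurable_coord1 R)); exact: measurable_snd.
  - by apply: (measurableT_comp (@measurable_coord1 R)); exact: measurable_fst.
  - by apply: (measurableT_comp (@measurable_coord2 R)); exact: measurable_snd.
  - by apply: (measurableT_comp (@measurable_coord2 R)); exact: measurable_fst.
pose P : probability (plane R) R := @nu R.
have G2 : (P \x P)%E G = (\int[P]_x ((pr E)%:E * (\1_F x)%:E))%E.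
  rewrite (@product_measure_unique _ _ _ _ _ P P (P \x^ P)%E)//; last first.
    by move=> A B mA mB; exact: product_measure2E.
  apply: eq_integral => x _ /=; rewrite indicE.
  have [xF|xF] := boolP (x \in F); last first.
    rewrite mule0 (_ : ysection G x = set0) ?measure0//.
    by apply/seteqP; split => v //; rewrite /ysection/= inE /G/= => -[_ /mem_set]; rewrite (negbTE xF).
  rewrite mule1 -(toral_negtrans x tE) prK; last first.
    rewrite (_ : [set v | _] = trans x @^-1` E).
      exact: (@measurable_preim _ (trans x) _ (measurable_trans x) mE).
    by apply/seteqP; split => v /=; rewrite /trans addrC [X in (_, X)]addrC.
  congr (nu _); apply/seteqP; split => v; rewrite /ysection/= inE /G/=; first by case.
  by move=> ?; split=> //; rewrite inE in xF.
have GE : (P \x P)%E G = (pr E * pr F)%:E.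
  rewrite G2 ge0_integralZl//; last 2 first.
  - by apply/measurable_EFinP; exact: measurable_indic.
  - by rewrite lee_fin pr_ge0.
  rewrite integral_indic// setIT EFinM.
  by transitivity ((pr E)%:E * (pr F)%:E)%E => //; rewrite (prK mF).
rewrite -lee_fin -GE.
have <- : (\int[P]_x c%:E)%E = c%:E.
  by rewrite integral_cst// [X in (_ * X)%E](@nu_setT R) mule1.
rewrite [leRHS]/product_measure1.
apply: ge0_le_integral => //.
- by move=> v _; rewrite lee_fin ltW.
- exact: measurable_fun_xsection.
move=> v _ /=; apply: le_trans (cEF' v : (_%:E <= _%:E)%E) _.
rewrite prK; last first.
  apply: measurableI => //.
  exact: (@measurable_preim _ (trans v) _ (measurable_trans v) mE).
rewrite le_eqVlt; apply/orP; left; apply/eqP.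
by congr (nu _); apply/seteqP; split => x; rewrite /xsection/= inE.
Qed.

End averaging.

(** * Eigendirections and moduli of continuity *)

Section hyperbolicity.
Variable R : realType.
Implicit Types (E F G : set (plane R)) (p v w : plane R) (t : R).

(** The golden ratio phi gives the two eigendirections of the symmetric matrix
    of the map: unst and stab are the eigenforms, of eigenvalues lam and lam^-1,
    and eu and es the eigenvectors. *)
Definition phi : R := (1 + Num.sqrt 5) / 2.
Definition lam : R := phi + 1.
Definition unst p : R := phi * p.1 + p.2.
Definition stab p : R := p.1 - phi * p.2.
Definition eu t : plane R := (phi * t, t).
Definition es t : plane R := (t, - (phi * t)).

Lemma phi2 : phi ^+ 2 = phi + 1.
Proof.
have h : (Num.sqrt 5 : R) ^+ 2 = 5 by rewrite sqr_sqrtr.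
by rewrite /phi; lra.
Qed.

Lemma phi_gt1 : 1 < phi.
Proof.
have : 1 < Num.sqrt 5 :> R by rewrite -[X in X < _]sqrtr1 ltr_sqrt// ltr1n.
rewrite /phi; lra.
Qed.

Lemma phi_lt2 : phi < 2.
Proof. by have := phi2; have := phi_gt1 => h1 h2; nra. Qed.

Lemma lam_gt2 : 2 < lam.
Proof. by have := phi_gt1; rewrite /lam; lra. Qed.

Lemma lam_lt3 : lam < 3.
Proof. by have := phi_lt2; rewrite /lam; lra. Qed.

Lemma lam_gt0 : 0 < lam.
Proof. by have := lam_gt2; lra. Qed.

Lemma lamV : lam^-1 = 2 - phi.
Proof.
apply: (mulfI (lt0r_neq0 lam_gt0)); rewrite mulfV ?gt_eqF ?lam_gt0//.
by rewrite /lam; ring: phi2.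
Qed.

Lemma unst_catM p : unst (catM p) = lam * unst p.
Proof. by rewrite /unst /catM/= /lam; ring: phi2. Qed.

Lemma stab_catM p : stab (catM p) = lam^-1 * stab p.
Proof. by rewrite /stab /catM/= lamV; ring: phi2. Qed.

Lemma unst_iter n p : unst (iter n (@catM R) p) = lam ^+ n * unst p.
Proof. by elim: n => [|n IH]; rewrite ?mul1r// iterS unst_catM IH exprS mulrA. Qed.

Lemma stab_iter n p : stab (iter n (@catM R) p) = lam ^- n * stab p.
Proof.
elim: n => [|n IH]; first by rewrite invr1 mul1r.
by rewrite iterS stab_catM IH exprS invfM mulrA.
Qed.

Lemma catM_es t : catM (es t) = es (lam^-1 * t).
Proof.
by rewrite /catM /es lamV/=; congr pair; ring: phi2.
Qed.

Lemma catMi_eu t : catMi (eu t) = eu (lam^-1 * t).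
Proof.
by rewrite /catMi /eu lamV/=; congr pair; ring: phi2.
Qed.

Lemma iter_catM_es n t : iter n (@catM R) (es t) = es (lam ^- n * t).
Proof.
elim: n => [|n IH]; first by rewrite invr1 mul1r.
by rewrite iterS IH catM_es exprS invfM mulrA.
Qed.

Lemma iter_catMi_eu n t : iter n (@catMi R) (eu t) = eu (lam ^- n * t).
Proof.
elim: n => [|n IH]; first by rewrite invr1 mul1r.
by rewrite iterS IH catMi_eu exprS invfM mulrA.
Qed.

Lemma eigen_decomposition v : v = trans (eu (unst v / (phi ^+ 2 + 1)))
                                    (es (stab v / (phi ^+ 2 + 1))).
Proof.
have d : phi ^+ 2 + 1 != 0 by rewrite phi2; have := phi_gt1; lra.
rewrite /trans /eu /es /unst /stab/= [LHS]surjective_pairing.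
by congr pair; field.
Qed.

Lemma catM_trans v p : catM (trans v p) = trans (catM v) (catM p).
Proof. by rewrite /catM /trans/=; congr pair; ring. Qed.

Lemma catMi_trans v p : catMi (trans v p) = trans (catMi v) (catMi p).
Proof. by rewrite /catMi /trans/=; congr pair; ring. Qed.

Lemma iter_trans (f : plane R -> plane R) n v p :
  (forall v p, f (trans v p) = trans (f v) (f p)) ->
  iter n f (trans v p) = trans (iter n f v) (iter n f p).
Proof. by move=> H; elim: n => //= n ->; rewrite H. Qed.

Lemma le_pr_cover E F G : toral E -> toral F -> toral G -> E `<=` F `|` G ->
  pr E <= pr F + pr G.
Proof.
move=> [mE _] [mF _] [mG _] EFG; apply: (le_trans _ (pr_setU mF mG)).
by apply: le_pr => //; exact: measurableU.
Qed.

(** The measure of what the translation by v moves out of E, a modulus of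
    continuity of E in measure. *)
Definition modulus E v := pr (E `\` trans v @^-1` E).

Lemma modulus_ge0 E v : 0 <= modulus E v.
Proof. exact: pr_ge0. Qed.

Lemma transA v w p : trans v (trans w p) = trans (trans v w) p.
Proof. by rewrite /trans/= !addrA ![_ + _ + v.1]addrAC; congr pair; ring. Qed.

Lemma modulus_entry E v : toral E ->
  pr (trans v @^-1` E `\` E) = modulus E v.
Proof.
move=> tE; have tE' := toral_trans v tE.
have [mE mE'] := (toral_meas tE, toral_meas tE').
have := pr_setDI mE mE'; have := pr_setDI mE' mE.
rewrite (pr_trans v tE) (setIC (trans v @^-1` E)).
by move=> -> /addIr.
Qed.

Lemma modulusC E v : toral E -> modulus (~` E) v = modulus E v.
Proof.
move=> tE; rewrite -(modulus_entry v tE); congr pr.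
by apply/seteqP; split => p /=; rewrite notK; case.
Qed.

Lemma modulusD E v w : toral E ->
  modulus E (trans v w) <= modulus E v + modulus E w.
Proof.
move=> tE; have tw := toral_trans w tE; have tv := toral_trans v tE.
have tvw := toral_trans (trans v w) tE.
have -> : modulus E v = pr (trans w @^-1` (E `\` trans v @^-1` E)).
  by rewrite pr_trans//; exact: toralD.
rewrite addrC; apply: le_pr_cover; [exact: toralD|exact: toralD| |].
  by apply: toral_trans; exact: toralD.
move=> p [Ep]/= nE; have [Ew|Ew] := pselect (E (trans w p)); last by left.
by right; split=> //=; rewrite transA.
Qed.

Lemma modulus_iter (f : plane R -> plane R) n E v :
  (forall v p, f (trans v p) = trans (f v) (f p)) ->
  (forall E, toral E -> toral (f @^-1` E)) ->
  (forall E, toral E -> pr (f @^-1` E) = pr E) ->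
  toral E -> modulus (iter n f @^-1` E) v = modulus E (iter n f v).
Proof.
move=> ft ftor fpr tE; rewrite /modulus -[RHS](pr_iter n ftor fpr); last first.
  by apply: toralD => //; exact: toral_trans.
by congr pr; apply/seteqP; split => p /=; rewrite iter_trans.
Qed.

Lemma modulusI E F v : toral E -> toral F ->
  modulus (E `&` F) v <= modulus E v + modulus F v.
Proof.
move=> tE tF; have tvE := toral_trans v tE; have tvF := toral_trans v tF.
apply: le_pr_cover; [|exact: toralD|exact: toralD|].
  by apply: toralD; [|apply: toral_trans]; exact: toralI.
by move=> p [[Ep Fp] /=]/not_andP[?|?]; [left|right].
Qed.

End hyperbolicity.

(** * Exponential mixing *)

Section mixing.
Variable R : realType.
Implicit Types (E F : set (plane R)) (p v : plane R) (t : R).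
Local Notation lam := (lam R).
Local Notation phi := (phi R).

Lemma eigen_coord_le1 v : Lambda v ->
  `|unst v / (phi ^+ 2 + 1)| <= 1 /\ `|stab v / (phi ^+ 2 + 1)| <= 1.
Proof.
move=> [/=]; rewrite !in_itv/= => /andP[x0 x1] /andP[y0 y1].
have f1 := phi_gt1 R; have f2 := phi2 R.
have d : 0 < phi ^+ 2 + 1 by rewrite f2; lra.
rewrite !normrM !normfV (gtr0_norm d) !ler_pdivrMr// !mul1r f2 /unst /stab.
split; rewrite ler_norml; apply/andP; split; nra.
Qed.

(** Undo half of the iterates: E pulled back by the inverse is almost invariant
    under unstable translations, and F pulled back by the map is almost
    invariant under stable ones. Every v is a sum of two such translations, so
    for every v the intersection has, up to the error, at most the measure of
    the part of F' that v translates into E', and average_translates applies. *)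
Lemma mixing_upper E F (C : R) m : toral E -> toral F ->
  (forall t, modulus E (eu t) <= C * `|t|) ->
  (forall t, modulus F (es t) <= C * `|t|) ->
  pr (E `&` iter (m + m) (@catM R) @^-1` F) <= pr E * pr F + 2 * C * lam ^- m.
Proof.
move=> tE tF CE CF; rewrite -lerBlDr.
have tM := @toral_catM R; have tMi := @toral_catMi R.
have tE' := toral_iter m tMi tE; have tF' := toral_iter m tM tF.
pose E' := iter m (@catMi R) @^-1` E; pose F' := iter m (@catM R) @^-1` F.
have -> : pr (E `&` iter (m + m) (@catM R) @^-1` F) = pr (E' `&` F').
  rewrite -(pr_iter m tM (@pr_catM R) (toralI tE' tF')); congr pr.
  by apply/seteqP; split => p /=; rewrite /E' /F'/= iter_catMK iterD.
have -> : pr E = pr E' by rewrite (pr_iter m tMi (@pr_catMi R) tE).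
have -> : pr F = pr F' by rewrite (pr_iter m tM (@pr_catM R) tF).
apply: average_translates => // v Lv; rewrite lerBlDr.
have [a1 b1] := eigen_coord_le1 Lv.
set a := _ / _ in a1; set b := _ / _ in b1.
have vE : v = trans (eu a) (es b) by exact: eigen_decomposition.
have l0 : 0 < lam ^- m by rewrite invr_gt0 exprn_gt0// lam_gt0.
have C0 : 0 <= C by have := le_trans (modulus_ge0 _ _) (CE 1); rewrite normr1 mulr1.
have mE : modulus E' (eu a) <= C * lam ^- m.
  rewrite (modulus_iter _ _ (@catMi_trans R) tMi (@pr_catMi R) tE).
  rewrite iter_catMi_eu (le_trans (CE _))// ler_wpM2l// normrM (gtr0_norm l0).
  by rewrite ler_piMr// ltW.
have mF : modulus F' (es b) <= C * lam ^- m.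
  rewrite (modulus_iter _ _ (@catM_trans R) tM (@pr_catM R) tF).
  rewrite iter_catM_es (le_trans (CF _))// ler_wpM2l// normrM (gtr0_norm l0).
  by rewrite ler_piMr// ltW.
pose G := trans (eu a) @^-1` E' `&` F'.
have tG : toral G by apply: toralI => //; exact: toral_trans.
have le1 : pr (E' `&` F') <= pr G + modulus E' (eu a).
  apply: le_pr_cover => //; [exact: toralI|by apply: toralD => //; exact: toral_trans|].
  move=> p [Ep Fp]; have [?|?] := pselect (E' (trans (eu a) p)); first by left.
  by right.
have le2 : pr G <= pr [set x | E' (trans v x) /\ F' x] + modulus F' (es b).
  rewrite -(pr_trans (es b) tG) -(modulus_entry (es b) tF').
  apply: le_pr_cover; first exact: toral_trans.
  - by apply: toralI => //; exact: toral_trans.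
  - by apply: toralD => //; exact: toral_trans.
  move=> p [/= Ep Fp]; have [?|?] := pselect (F' p); last by right.
  by left; split => //; rewrite vE -transA.
rewrite -mulrA mulr_natl mulr2n addrA.
apply: (le_trans le1); apply: lerD => //.
by apply: (le_trans le2); exact: lerD.
Qed.

(** The lower bound is the upper bound for the complement of F. *)
Lemma mixing E F (C : R) m : toral E -> toral F ->
  (forall t, modulus E (eu t) <= C * `|t|) ->
  (forall t, modulus F (es t) <= C * `|t|) ->
  `|pr (E `&` iter (m + m) (@catM R) @^-1` F) - pr E * pr F| <= 2 * C * lam ^- m.
Proof.
move=> tE tF CE CF; rewrite ler_distl; apply/andP; split; last exact: mixing_upper.
have tM := @toral_catM R.
have := mixing_upper m tE (toralC tF) CE.
have tF' := toral_iter (m + m) tM tF.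
have -> : E `&` iter (m + m) (@catM R) @^-1` (~` F) =
  E `\` (iter (m + m) (@catM R) @^-1` F) by [].
have := pr_setDI (toral_meas tE) (toral_meas tF').
rewrite pr_setC; last exact: toral_meas.
move=> e /(_ _)/wrap[]; first by move=> t; rewrite modulusC.
set x := pr (E `&` _) in e *; set y := pr (E `\` _) in e *.
by move: (pr E) (pr F) e => a b e; lra.
Qed.

End mixing.

(** * The probability of avoiding a set *)

Section avoidance.
Variable R : realType.
Implicit Types (A : set (plane R)) (p : plane R).
Local Notation lam := (lam R).
Local Notation M := (@catM R).

Definition avoid A n : set (plane R) :=
  [set p | forall i, (i < n)%N -> ~ A (iter i M p)].

Lemma avoid0 A : avoid A 0 = setT.
Proof. by apply/seteqP; split => p. Qed.

Lemma avoidS A n : avoid A n.+1 = ~` A `&` M @^-1` avoid A n.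
Proof.
apply/seteqP; split => p.
  move=> H; split; first exact: (H 0%N).
  by move=> i ni; rewrite -iterSr; exact: H.
by move=> [H0 H] [|i] ni //; rewrite iterSr; exact: H.
Qed.

Lemma toral_avoid A n : toral A -> toral (avoid A n).
Proof.
move=> tA; elim: n => [|n IH]; first by rewrite avoid0; exact: toralT.
by rewrite avoidS; apply: toralI; [exact: toralC|exact: toral_catM].
Qed.

(** Avoiding A for n steps is the intersection of n preimages; the stable
    translation shrinks by a factor of at least 2 with each of them, and the
    contributions sum to a bound that does not depend on n. *)
Lemma modulus_avoid A n (K : R) : toral A ->
  (forall t, modulus A (es t) <= K * `|t|) ->
  forall t, modulus (avoid A n) (es t) <= 2 * K * `|t|.
Proof.
move=> tA KA.
have K0 : 0 <= K by have := le_trans (modulus_ge0 _ _) (KA 1); rewrite normr1 mulr1.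
elim: n => [|n IH] t.
  rewrite avoid0 /modulus (_ : _ `\` _ = set0) ?pr_set0 ?mulr_ge0//.
  by apply/seteqP; split => p // [_ /=]; exact.
have tn := toral_avoid n tA.
rewrite avoidS; apply: (le_trans (modulusI _ (toralC tA) (toral_catM tn))).
rewrite modulusC//.
rewrite (@modulus_iter _ M 1 _ _ (@catM_trans R) (@toral_catM R) (@pr_catM R) tn)/= catM_es.
have := IH (lam^-1 * t); have := KA t.
rewrite normrM gtr0_norm ?invr_gt0 ?lam_gt0// => h1 h2.
apply: (le_trans (lerD h1 h2)).
have lh : lam^-1 * (K * `|t|) <= 2^-1 * (K * `|t|).
  rewrite ler_wpM2r ?mulr_ge0// lef_pV2 ?posrE ?lam_gt0//.
  by rewrite ltW// lam_gt2.
by move: lam^-1 `|t| lh; clear => l x lh; lra.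
Qed.

Lemma pr_avoid_le A n : toral A -> 1 - n%:R * pr A <= pr (avoid A n).
Proof.
move=> tA; elim: n => [|n IH]; first by rewrite avoid0 pr_setT mul0r subr0.
have tn := toral_avoid n tA.
have tMn := toral_catM tn.
have h := pr_setDI (toral_meas tMn) (toral_meas tA).
rewrite (pr_catM tn) in h.
have h1 : pr (M @^-1` avoid A n `&` A) <= pr A.
  by apply: le_pr; [apply: toral_meas; exact: toralI|exact: toral_meas|move=> p []].
have -> : avoid A n.+1 = M @^-1` avoid A n `\` A by rewrite avoidS setDE setIC.
rewrite -natr1 mulrDl mul1r.
by move: IH h h1; do 4!move: (pr _); clear=> *; lra.
Qed.

Definition return_sum A n : R :=
  \sum_(1 <= j < n) pr (A `&` iter j M @^-1` A).

Lemma return_sum_ge0 A n : 0 <= return_sum A n.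
Proof. by apply: sumr_ge0 => j _; exact: pr_ge0. Qed.

(** Forgetting the visits at the times 1 to t - 1 costs at most the probability
    of a return at one of these times. *)
Lemma avoid_gap A m t : toral A -> (0 < t <= m.+1)%N ->
  pr (A `&` iter t M @^-1` avoid A (m.+1 - t)) <=
  pr (A `&` M @^-1` avoid A m) + return_sum A t.
Proof.
move=> tA /andP[t0 tm].
have tI j B : toral B -> toral (A `&` iter j M @^-1` B).
  by move=> tB; apply: toralI => //; apply: toral_iter => //; exact: toral_catM.
have key k : (0 < k <= t)%N ->
  pr (A `&` iter t M @^-1` avoid A (m.+1 - t)) <=
  pr (A `&` iter k M @^-1` avoid A (m.+1 - k)) + \sum_(k <= j < t) pr (A `&` iter j M @^-1` A).
  move=> /andP[k0 kt]; rewrite -(subKn kt).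
  have : (t - k < t)%N by lia.
  elim: (t - k)%N => [|d IH] dt.
    by rewrite subn0 big_geq// addr0.
  have {}IH := IH (ltnW dt).
  rewrite (big_ltn (m := t - d.+1)); last by lia.
  have jE : (t - d)%N = (t - d.+1).+1 by lia.
  rewrite jE in IH.
  apply: (le_trans IH); rewrite addrA lerD2r.
  apply: le_pr_cover; [exact/tI/toral_avoid|exact/tI/toral_avoid|exact: tI|].
  move=> p [Ap Wp]; have [Ad|Ad] := pselect (A (iter (t - d.+1) M p)); first by right.
  left; split => //= i ni; rewrite -iterD.
  case: i ni => [|i] ni; first by rewrite add0n.
  by rewrite addSnnS iterD; apply: Wp; lia.
have := key 1%N; rewrite t0/= subn1/= => /(_ isT); exact.
Qed.

(** The orbits that avoid A at the times 1 to m but not at time 0 are lost at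
    this step. Open a gap of length 2 h after time 0, which costs the short
    returns; then mixing makes the start and the rest independent; then close
    the gap, which costs at most 2 h visits. *)
Lemma avoid_step A (C : R) h m : toral A ->
  (forall t, modulus A (eu t) <= C * `|t|) ->
  (forall t, modulus A (es t) <= C * `|t|) -> (0 < h + h <= m.+1)%N ->
  `|pr (avoid A m.+1) - (1 - pr A) * pr (avoid A m)| <=
  return_sum A (h + h) + 4 * C * lam ^- h + (h + h)%:R * pr A ^+ 2.
Proof.
move=> tA Cu Cs hm; set t := (h + h)%N; set k := (m.+1 - t)%N.
have C0 : 0 <= C by have := le_trans (modulus_ge0 _ _) (Cu 1); rewrite normr1 mulr1.
have tM := @toral_catM R.
have tW n := toral_avoid n tA.
have e1 : pr (avoid A m.+1) = pr (avoid A m) - pr (A `&` M @^-1` avoid A m).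
  have := pr_setDI (toral_meas (tM _ (tW m))) (toral_meas tA).
  rewrite (pr_catM (tW m)) avoidS (setIC (~` A)) -setDE (setIC _ A) => ->.
  by rewrite addrK.
have le1 := avoid_gap tA hm.
have le2 : pr (A `&` M @^-1` avoid A m) <= pr (A `&` iter t M @^-1` avoid A k).
  apply: le_pr; [|
    exact: (toral_meas (toralI tA (toral_iter t tM (tW _))))|].
    exact: (toral_meas (toralI tA (tM _ (tW _)))).
  move=> p [Ap Wp]; split=> // i ik /=; rewrite -iterD.
  have tE : t = t.-1.+1 by move: hm; rewrite /t; lia.
  rewrite tE addnS iterSr; apply: Wp.
  by move: hm ik; rewrite /k /t; lia.
have mix : `|pr (A `&` iter t M @^-1` avoid A k) - pr A * pr (avoid A k)| <=
    4 * C * lam ^- h.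
  have -> : 4 * C = 2 * (2 * C) by rewrite mulrA -natrM.
  apply: mixing => // s; last exact: modulus_avoid.
  by apply: (le_trans (Cu s)); rewrite ler_wpM2r// ler_peMl// ler1n.
have le3 : pr (avoid A m) <= pr (avoid A k).
  apply: le_pr; [exact: toral_meas|exact: toral_meas|].
  by move=> p Wp i ik; apply: Wp; move: ik hm; rewrite /k/t; lia.
have le4 : pr (avoid A k) <= pr (avoid A m) + t%:R * pr A.
  have mE : m = (k + t.-1)%N by move: hm; rewrite /k /t; lia.
  have : pr (avoid A k) <= pr (avoid A m) + pr (iter k M @^-1` (~` avoid A t.-1)).
    apply: le_pr_cover => //; first by apply: toral_iter => //; exact: toralC.
    move=> p Wp; have [Wm|Wm] := pselect (avoid A m p); [by left|right => /= W].
    apply: Wm => i im; have [ik|ik] := ltnP i k; first exact: Wp.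
    rewrite -(subnK ik) iterD; apply: W; move: im; rewrite {1}mE; lia.
  rewrite (pr_iter k tM (@pr_catM R) (toralC (tW _))) pr_setC; last exact: toral_meas.
  move=> h1; apply: (le_trans h1); rewrite lerD2l.
  have := pr_avoid_le t.-1 tA.
  have : t.-1%:R * pr A <= t%:R * pr A by rewrite ler_wpM2r ?pr_ge0// ler_nat leq_pred.
  by move: (t%:R * pr A) (t.-1%:R * _) (pr (avoid _ _)); clear => *; lra.
have a0 := pr_ge0 A.
have : pr A * pr (avoid A k) <= pr A * (pr (avoid A m) + t%:R * pr A) by exact: (ler_wpM2l a0 le4).
have : pr A * pr (avoid A m) <= pr A * pr (avoid A k) by exact: (ler_wpM2l a0 le3).
have := return_sum_ge0 A t.
have : 0 <= t%:R * pr A ^+ 2 by rewrite mulr_ge0// sqr_ge0.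
move: mix; rewrite e1 !ler_distl => /andP[].
move: le1 le2; rewrite -/t -/k.
move: (pr (A `&` M @^-1` _)) (pr (A `&` iter _ _ @^-1` _)) => x y.
move: (pr (avoid A k)) (pr (avoid A m)) (return_sum _ _) (4 * C * _) (t%:R) (pr A).
by clear => wk wm s c T a *; apply/andP; split; lra.
Qed.

(** The errors of the n steps add up, since the factor 1 - pr A is at most 1.
    The first 2 h steps are too few for the gap and each costs at most pr A. *)
Lemma avoid_geometric A (C : R) h n : toral A ->
  (forall t, modulus A (eu t) <= C * `|t|) ->
  (forall t, modulus A (es t) <= C * `|t|) -> (0 < h)%N ->
  `|pr (avoid A n) - (1 - pr A) ^+ n| <= (h + h)%:R * pr A +
  n%:R * (return_sum A (h + h) + 4 * C * lam ^- h + (h + h)%:R * pr A ^+ 2).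
Proof.
move=> tA Cu Cs h0; set t := (h + h)%N.
set e := (X in _ + n%:R * X).
have C0 : 0 <= C by have := le_trans (modulus_ge0 _ _) (Cu 1); rewrite normr1 mulr1.
have a0 := pr_ge0 A; have a1 := pr_le1 (toral_meas tA).
have e0 : 0 <= e.
  rewrite addr_ge0// ?addr_ge0 ?return_sum_ge0// mulr_ge0// ?sqr_ge0//.
    by rewrite mulr_ge0.
  by rewrite invr_ge0 exprn_ge0// ltW// lam_gt0.
suff : `|pr (avoid A n) - (1 - pr A) ^+ n| <= (minn n t)%:R * pr A + n%:R * e.
  move/le_trans; apply; rewrite lerD2r ler_wpM2r// ler_nat; exact: geq_minr.
elim: n => [|m IH].
  by rewrite avoid0 pr_setT expr0 subrr normr0 min0n !mul0r addr0.
have -> : pr (avoid A m.+1) - (1 - pr A) ^+ m.+1 =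
  (pr (avoid A m.+1) - (1 - pr A) * pr (avoid A m)) +
  (1 - pr A) * (pr (avoid A m) - (1 - pr A) ^+ m).
  by rewrite exprS; move: (pr _) (pr _) (pr _) => x y z; ring.
apply: (le_trans (ler_normD _ _)).
have step2 : `|(1 - pr A) * (pr (avoid A m) - (1 - pr A) ^+ m)| <=
    (minn m t)%:R * pr A + m%:R * e.
  apply: le_trans IH; rewrite normrM ler_piMl// ger0_norm ?subr_ge0//.
  by rewrite gerBl.
have [tm|mt] := leqP t m.+1.
  have hm : (0 < h + h <= m.+1)%N by rewrite tm andbT addn_gt0 h0.
  have st := avoid_step tA Cu Cs hm.
  apply: (le_trans (lerD st step2)); rewrite -/t -/e.
  have : (minn m t)%:R * pr A <= t%:R * pr A.
    by rewrite ler_wpM2r// ler_nat geq_minr.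
  rewrite -(natr1 m).
  by clear IH step2 st e0; move: (_ * pr A) (_ * pr A) (m%:R) e; clear=> *; lra.
have st : `|pr (avoid A m.+1) - (1 - pr A) * pr (avoid A m)| <= pr A.
  have tM := @toral_catM R; have tW := toral_avoid m tA.
  have := pr_setDI (toral_meas (tM _ tW)) (toral_meas tA).
  rewrite (pr_catM tW) avoidS (setIC (~` A)) -setDE => e1.
  have x0 := pr_ge0 (M @^-1` avoid A m `&` A).
  have xa : pr (M @^-1` avoid A m `&` A) <= pr A.
    by apply: le_pr; [apply: toral_meas; apply: toralI => //; exact: tM|exact: toral_meas|move=> p []].
  have w1 := pr_le1 (toral_meas tW); have w0 := pr_ge0 (avoid A m).
  have := mulr_ge0 a0 w0.
  have := ler_piMr a0 w1.
  move: e1 x0 xa; rewrite ler_distl.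
  move: (pr (_ `\` _)) (pr (_ `&` _)) (pr (avoid A m)) (pr A).
  by clear => u x w a *; apply/andP; split; lra.
apply: (le_trans (lerD st step2)).
rewrite (minn_idPl (ltnW (ltnW mt))).
rewrite -(natr1 m) !mulrDl !mul1r. 
clear IH step2 st; clearbody e.
by move: (m%:R * e); move: (m%:R * pr A); move: (pr A) e0; clear => *; lra.
Qed.

End avoidance.

(** * The exponential law *)

Section limit_law.
Variable R : realType.
Implicit Types (a : R^nat) (tau : R).
Local Notation lam := (lam R).
Local Notation M := (@catM R).

Lemma cvg_invn : (n%:R^-1 : R) @[n --> \oo] --> (0 : R).
Proof. by rewrite -cvg_shiftS; exact: cvg_harmonic. Qed.

Lemma cvg_near_eq (f g : R^nat) (l : R) : (\forall n \near \oo, f n = g n) ->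
  f n @[n --> \oo] --> l -> g n @[n --> \oo] --> l.
Proof. by move=> fg fl; apply: (cvg_trans _ fl); exact: near_eq_cvg. Qed.

Lemma cvg_expR (u : R^nat) (l : R) : u n @[n --> \oo] --> l ->
  expR (u n) @[n --> \oo] --> expR l.
Proof. exact: (continuous_cvg _ (@continuous_expR R l)). Qed.

Lemma cvg_sqrt (u : R^nat) (l : R) : u n @[n --> \oo] --> l ->
  Num.sqrt (u n) @[n --> \oo] --> Num.sqrt l.
Proof. exact: (continuous_cvg _ (@sqrt_continuous R l)). Qed.

Lemma cvg0_of_mulrn a tau : n%:R * a n @[n --> \oo] --> tau ->
  a n @[n --> \oo] --> (0 : R).
Proof.
move=> na; rewrite -(mulr0 tau).
apply: (cvg_near_eq _ (cvgM na cvg_invn)).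
near=> n; have n0 : (0 < n)%N by near: n; exact: nbhs_infty_gt.
by rewrite /= mulrAC mulfV ?mul1r// pnatr_eq0 -lt0n.
Unshelve. all: by end_near. Qed.

Lemma cvg_one_sub_pow a tau : (forall n, 0 <= a n <= 1) ->
  n%:R * a n @[n --> \oo] --> tau ->
  (1 - a n) ^+ n @[n --> \oo] --> expR (- tau).
Proof.
move=> a01 na; have a0 := cvg0_of_mulrn na.
have up n : (1 - a n) ^+ n <= expR (- (n%:R * a n)).
  have /andP[? ?] := a01 n.
  rewrite -mulrN expRM_natl lerXn2r ?nnegrE ?expR_ge0//; first by lra.
  exact: expR_ge1Dx.
have lo n : a n < 1 -> expR (- (n%:R * a n / (1 - a n))) <= (1 - a n) ^+ n.
  move=> a1; have d : 0 < 1 - a n by rewrite subr_gt0.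
  rewrite -mulrA -mulrN expRM_natl lerXn2r ?nnegrE ?expR_ge0//; first exact: ltW.
  rewrite expRN -[leRHS]invrK lef_pV2 ?posrE ?expR_gt0 ?invr_gt0//.
  apply: le_trans (expR_ge1Dx _).
  rewrite (_ : 1 + a n / (1 - a n) = (1 - a n)^-1)//.
  by field; exact: lt0r_neq0.
have c1 : expR (- (n%:R * a n / (1 - a n))) @[n --> \oo] --> expR (- tau).
  apply: cvg_expR; apply: cvgN; rewrite -[tau]divr1 -[X in _ / X](subr0 1).
  apply: cvgM; first exact: na.
  apply: cvgV; first by rewrite subr0 oner_eq0.
  by apply: cvgB => //; exact: cvg_cst.
have c2 : expR (- (n%:R * a n)) @[n --> \oo] --> expR (- tau).
  by apply: cvg_expR; exact: cvgN.
apply: (squeeze_cvgr _ c1 c2).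
near=> n; apply/andP; split; last exact: up.
by apply: lo; near: n; exact: (cvgr_lt _ a0 1 ltr01).
Unshelve. all: by end_near. Qed.

(** At least twice the binary logarithm of n, so that lam ^- gap n is at most
    n ^- 2 and mixing errors stay negligible when summed over n steps. *)
Definition gap n := (2 * (trunc_log 2 n).+1)%N.

Lemma pow2_gap n : (n%:R : R) ^+ 2 <= lam ^+ gap n.
Proof.
have l2 := lam_gt2 R.
have l0 := ltW (lam_gt0 R).
rewrite /gap mulnC exprM ler_pXn2r ?nnegrE ?exprn_ge0//.
apply: (@le_trans _ _ ((2 ^ (trunc_log 2 n).+1)%:R)).
  by rewrite ler_nat ltnW// trunc_log_ltn.
by rewrite natrX ler_pXn2r ?nnegrE// ltW.
Qed.

Lemma gap_sqrt n : (0 < n)%N -> (gap n + gap n)%:R <= 8 * Num.sqrt n%:R :> R.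
Proof.
move=> n0; set l := trunc_log 2 n.
have l4 : (l.+1 ^ 2 <= 4 * 2 ^ l)%N.
  elim: l => // k IH; case: k IH => // -[_ //|k IH].
  rewrite expnS mulnCA; apply: leq_trans (leq_mul (leqnn 2) IH).
  by rewrite -!mulnn; nia.
have ln : (l.+1 ^ 2 <= 4 * n)%N.
  by apply: (leq_trans l4); rewrite leq_mul2l/= trunc_logP.
have : l.+1%:R <= 2 * Num.sqrt n%:R :> R.
  rewrite -(ler_pXn2r (n := 2)) ?nnegrE ?mulr_ge0 ?sqrtr_ge0//.
  by rewrite exprMn sqr_sqrtr// -!natrX -natrM ler_nat.
rewrite /gap -/l addnn -mul2n mulnA natrM => h.
by move: (l.+1%:R) (Num.sqrt _) h; clear => x y h; lra.
Qed.

Lemma gap_gt0 n : (0 < gap n)%N.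
Proof. by rewrite /gap muln_gt0. Qed.

Lemma cvg_gap_pr a tau : (forall n, 0 <= a n) ->
  n%:R * a n @[n --> \oo] --> tau ->
  (gap n + gap n)%:R * a n @[n --> \oo] --> (0 : R).
Proof.
move=> a0 na.
have h : 8 * (n%:R * a n) * Num.sqrt (n%:R^-1) @[n --> \oo] --> (8 * tau * Num.sqrt 0 : R).
  apply: cvgM; first by apply: cvgMr.
  by apply: cvg_sqrt; exact: cvg_invn.
rewrite sqrtr0 mulr0 in h.
apply: (squeeze_cvgr _ (cvg_cst 0) h).
near=> n; have n0 : (0 < n)%N by near: n; exact: nbhs_infty_gt.
rewrite mulr_ge0//=; apply: (le_trans (ler_wpM2r (a0 n) (gap_sqrt n0))).
have nn : (0 : R) < n%:R by rewrite ltr0n.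
rewrite sqrtrV// ?ler0n//.
rewrite (_ : n%:R * a n = Num.sqrt n%:R * Num.sqrt n%:R * a n); last first.
  by rewrite -expr2 sqr_sqrtr.
have s0 : Num.sqrt (n%:R : R) != 0 by rewrite gt_eqF// sqrtr_gt0.
by rewrite le_eqVlt; apply/orP; left; apply/eqP; field.
Unshelve. all: by end_near. Qed.

Variable A : nat -> set (plane R).
Hypothesis tA : forall n, toral (A n).
Variable C : R.
Hypothesis CA : forall n v, modulus (A n) v <= C * (`|v.1| + `|v.2|).

Lemma modulus_eu n t : modulus (A n) (eu t) <= 3 * C * `|t|.
Proof.
apply: (le_trans (CA _ _)); rewrite /eu/= normrM.
have f1 := phi_gt1 R; have f2 := phi_lt2 R.
have C0 : 0 <= C.
  by have := le_trans (modulus_ge0 _ _) (CA 0 (1, 0)); rewrite normr1 normr0 addr0 mulr1.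
rewrite (gtr0_norm (lt_trans ltr01 f1)) [3 * C]mulrC -(mulrA C) ler_wpM2l//.
have := normr_ge0 t; move: `|t| => x x0; nra.
Qed.

Lemma modulus_es n t : modulus (A n) (es t) <= 3 * C * `|t|.
Proof.
apply: (le_trans (CA _ _)); rewrite /es/= normrN normrM.
have f1 := phi_gt1 R; have f2 := phi_lt2 R.
have C0 : 0 <= C.
  by have := le_trans (modulus_ge0 _ _) (CA 0 (1, 0)); rewrite normr1 normr0 addr0 mulr1.
rewrite (gtr0_norm (lt_trans ltr01 f1)) [3 * C]mulrC -(mulrA C) ler_wpM2l//.
have := normr_ge0 t; move: `|t| => x x0; nra.
Qed.

Variable tau : R.
Hypothesis pA : n%:R * pr (A n) @[n --> \oo] --> tau.
Hypothesis rA : n%:R * return_sum (A n) (gap n + gap n) @[n --> \oo] --> (0 : R).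

(** The avoidance probability is a geometric sequence up to errors that vanish
    when the gap is logarithmic. *)
Lemma cvg_avoid : pr (avoid (A n) n) @[n --> \oo] --> expR (- tau).
Proof.
have C0 : 0 <= C.
  by have := le_trans (modulus_ge0 _ _) (CA 0 (1, 0)); rewrite normr1 normr0 addr0 mulr1.
have a0 n := pr_ge0 (A n).
have ga := cvg_gap_pr a0 pA.
have pow : (1 - pr (A n)) ^+ n @[n --> \oo] --> expR (- tau).
  by apply: cvg_one_sub_pow => // n; rewrite a0 pr_le1//; exact: toral_meas.
have lg : n%:R * (4 * (3 * C) * lam ^- gap n) @[n --> \oo] --> (0 : R).
  have h : 4 * (3 * C) * n%:R^-1 @[n --> \oo] --> (4 * (3 * C) * 0 : R).
    by apply: cvgMr; exact: cvg_invn.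
  rewrite mulr0 in h; apply: (squeeze_cvgr _ (cvg_cst 0) h).
  near=> n; have n0 : (0 < n)%N by near: n; exact: nbhs_infty_gt.
  have nn : (0 : R) < n%:R by rewrite ltr0n.
  have lg0 : 0 < lam ^+ gap n by rewrite exprn_gt0// lam_gt0.
  rewrite mulr_ge0 ?mulr_ge0 ?invr_ge0 ?(ltW lg0)//=.
  rewrite mulrCA ler_wpM2l ?mulr_ge0//.
  rewrite ler_pdivrMr// mulrC -ler_pdivrMr ?invr_gt0// invrK -expr2.
  exact: pow2_gap.
have err : (gap n + gap n)%:R * pr (A n) +
   n%:R * (return_sum (A n) (gap n + gap n) + 4 * (3 * C) * lam ^- gap n +
           (gap n + gap n)%:R * pr (A n) ^+ 2) @[n --> \oo] --> (0 : R).
  have h : (gap n + gap n)%:R * pr (A n) +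
     (n%:R * return_sum (A n) (gap n + gap n) +
      n%:R * (4 * (3 * C) * lam ^- gap n) +
      n%:R * pr (A n) * ((gap n + gap n)%:R * pr (A n)))
      @[n --> \oo] --> (0 + (0 + 0 + tau * 0) : R).
    apply: cvgD; first exact: ga.
    apply: cvgD; last exact: (cvgM pA ga).
    by apply: cvgD; [exact: rA|exact: lg].
  rewrite mulr0 !addr0 in h; apply: (cvg_near_eq _ h); apply: nearW => n /=.
  move: (pr _) (return_sum _ _) (4 * (3 * C) * _) => x y z.
  by ring.
have d0 : pr (avoid (A n) n) - (1 - pr (A n)) ^+ n @[n --> \oo] --> (0 : R).
  apply/norm_cvg0P; apply: (squeeze_cvgr _ (cvg_cst 0) err).
  apply: nearW => n; rewrite normr_ge0/=.
  by apply: avoid_geometric; [|exact: modulus_eu|exact: modulus_es|exact: gap_gt0].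
have h : (1 - pr (A n)) ^+ n + (pr (avoid (A n) n) - (1 - pr (A n)) ^+ n)
    @[n --> \oo] --> (expR (- tau) + 0 : R) by apply: cvgD; [exact: pow|exact: d0].
rewrite addr0 in h; apply: (cvg_near_eq _ h); apply: nearW => n /=.
by rewrite addrC subrK.
Unshelve. all: by end_near. Qed.

(** An orbit that meets U but never leaves it before time n is in U at time n. *)
Lemma cvg_avoid_exit (U : nat -> set (plane R)) :
  (forall n, toral (U n)) -> (forall n, A n `<=` U n) ->
  (forall n, U n `\` M @^-1` U n `<=` A n) ->
  pr (U n) @[n --> \oo] --> (0 : R) ->
  pr (avoid (U n) n) @[n --> \oo] --> expR (- tau).
Proof.
move=> tU AU UA pU.
have h1 : pr (avoid (A n) n) - pr (U n) @[n --> \oo] --> expR (- tau).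
  rewrite -[expR _]subr0; apply: cvgB; [exact: cvg_avoid|exact: pU].
apply: (squeeze_cvgr _ h1 cvg_avoid); apply: nearW => n.
have tAn := toral_avoid n (tA n); have tUn := toral_avoid n (tU n).
apply/andP; split; last first.
  apply: le_pr; [exact: toral_meas|exact: toral_meas|].
  by move=> p Hp i ni /AU; exact: Hp.
rewrite lerBlDr -(pr_iter n (@toral_catM R) (@pr_catM R) (tU n)).
apply: le_pr_cover => //; first by apply: toral_iter => //; exact: toral_catM.
move=> p Ap; have [Up|/existsNP[i]] := pselect (avoid (U n) n p); first by left.
move=> /not_implyP[ni /contrapT Ui]; right => /=.
have stay d : (i + d <= n)%N -> U n (iter (i + d) M p).
  elim: d => [|d IH] dn; first by rewrite addn0.
  rewrite addnS in dn *; have Ud := IH (ltnW dn).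
  by apply: contrapT => nU; apply: (Ap _ dn); apply: UA; split.
by have := stay (n - i)%N; rewrite subnKC ?(ltnW ni)//; apply.
Qed.

End limit_law.

(** * Targets *)

Section targets.
Variable R : realType.
Notation leb := (@lebesgue_measure R).
Notation RR := (measurableTypeR R).
Implicit Types (U : set (plane R)) (p q v : plane R).

Lemma frac_periodic (x : R) (i : int) : frac (x + i%:~R) = frac x.
Proof. by rewrite /frac floorDrz ?intr_int// intrKfloor intrD; ring. Qed.

Lemma frac_id (x : R) : 0 <= x < 1 -> frac x = x.
Proof.
by move=> x01; rewrite /frac (_ : Num.floor x = 0) ?subr0//; apply/eqP; rewrite floor_eq.
Qed.

Lemma tor_id p : Lambda p -> tor p = p.
Proof.
move=> [/=]; rewrite !in_itv/= => p1 p2.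
by rewrite /tor !frac_id//; case: p {p1 p2}.
Qed.

Lemma toral_lift U : measurable U -> toral (@tor R @^-1` U).
Proof.
move=> mU; split.
  by have := @measurable_preim _ (@tor R) _ (@measurable_tor R) mU.
by move=> p i j /=; rewrite /tor/= !frac_periodic.
Qed.

Lemma pr_lift U : U `<=` @Lambda R -> pr (@tor R @^-1` U) = fine (leb2 R U).
Proof.
move=> UL; rewrite prE /nu /mrestr (_ : _ `&` _ = U)//.
apply/seteqP; split => p /=; first by move=> [Up /tor_id pE]; rewrite pE in Up.
by move=> Up; split; [rewrite tor_id//; exact: UL|exact: UL].
Qed.

(** The points that leave an interval when moved by a lie within |a| of one
    another, next to one end. *)
Lemma leb_interval_exit (I : set RR) (a : R) : measurable I -> is_interval I ->
  (leb [set x | I x /\ ~ I (x + a)%R] <= (2 * `|a|)%:E)%E.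
Proof.
move=> mI itI; set D := [set x | _].
have mD : measurable D.
  apply: measurableI => //; apply: measurableC.
  by have := measurable_preim_affine 1 a mI; under eq_set do rewrite mul1r.
have [->|/set0P[x0 [Ix0 nIx0]]] := eqVneq D set0; first by rewrite measure0 lee_fin mulr_ge0.
have sub : D `<=` `[x0 - `|a|, x0 + `|a|].
  move=> x [Ix nIx]; rewrite /= in_itv/=.
  have [a0|a0] := leP 0 a.
    rewrite ger0_norm//; apply/andP; split; rewrite leNgt; apply/negP => h.
      by apply: nIx; apply: (itI _ _ Ix Ix0); apply/andP; split; lra.
    by apply: nIx0; apply: (itI _ _ Ix0 Ix); apply/andP; split; lra.
  rewrite ltr0_norm//; apply/andP; split; rewrite leNgt; apply/negP => h.
    by apply: nIx0; apply: (itI _ _ Ix Ix0); apply/andP; split; lra.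
  by apply: nIx; apply: (itI _ _ Ix0 Ix); apply/andP; split; lra.
apply: (@le_trans _ _ (leb `[x0 - `|a|, x0 + `|a|])).
  by apply: le_measure => //; rewrite inE//; exact: measurable_itv.
rewrite lebesgue_measure_itv/= lte_fin; case: ifP => _; last by rewrite lee_fin mulr_ge0.
by rewrite -EFinB lee_fin; lra.
Qed.

Lemma leb01 : leb (setT `&` `[0, 1[) = 1%E.
Proof. by rewrite setTI lebesgue_measure_itv/= lte_fin ltr01 sube0. Qed.

Section slices_intervals.
Variable U : set (plane R).
Hypotheses (mU : measurable U) (UL : U `<=` @Lambda R).
Hypothesis Ux : forall y, is_interval [set x | U (x, y)].
Hypothesis Uy : forall x, is_interval [set y | U (x, y)].
Let E := @tor R @^-1` U.

Let tE : toral E. Proof. exact: toral_lift. Qed.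

Let mEv v : measurable (E `\` trans v @^-1` E).
Proof. by apply: toral_meas; apply: toralD => //; exact: toral_trans. Qed.

Lemma modulus_lift v : modulus E v <= 2 * (`|v.1| + `|v.2|).
Proof.
have vE : v = trans (v.1, 0) (0, v.2) by rewrite /trans/= add0r addr0; case: (v).
rewrite {1}vE; apply: (le_trans (modulusD _ _ tE)); rewrite mulrDr; apply: lerD.
- rewrite /modulus -[leRHS]mulr1 -[X in _ <= _ * X](pr_setT R).
  apply: pr_le_yslice; [exact: mEv|exact: measurableT|by rewrite mulr_ge0|move=> y y01].
  rewrite [X in (_ * leb X)%E](_ : _ = setT `&` `[0, 1[); last first.
    by apply/seteqP; split.
  rewrite leb01 mule1.
  apply: le_trans (leb_interval_exit v.1 (measurable_yslice y mU) (@Ux y)).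
  apply: le_measure; rewrite ?inE.
  + by apply: measurableI; [exact: measurable_yslice|exact: measurable_itv].
  + apply: measurableI; first exact: measurable_yslice.
    apply: measurableC.
    by have := measurable_preim_affine 1 v.1 (measurable_yslice y mU); under eq_set do rewrite mul1r.
  move=> x [] /= [Ex nEx]; rewrite in_itv/= => x01.
  have Exy : U (x, y).
    by move: Ex; rewrite /E/= tor_id//; split; rewrite /= in_itv.
  split => // Uxv; apply: nEx; rewrite /E/= /trans/= addr0 tor_id//; exact: UL.
- rewrite /modulus -[leRHS]mulr1 -[X in _ <= _ * X](pr_setT R).
  apply: pr_le_xslice; [exact: mEv|exact: measurableT|by rewrite mulr_ge0|move=> x x01].
  rewrite [X in (_ * leb X)%E](_ : _ = setT `&` `[0, 1[); last first.
    by apply/seteqP; split.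
  rewrite leb01 mule1.
  apply: le_trans (leb_interval_exit v.2 (measurable_xslice x mU) (@Uy x)).
  apply: le_measure; rewrite ?inE.
  + by apply: measurableI; [exact: measurable_xslice|exact: measurable_itv].
  + apply: measurableI; first exact: measurable_xslice.
    apply: measurableC.
    by have := measurable_preim_affine 1 v.2 (measurable_xslice x mU); under eq_set do rewrite mul1r.
  move=> y [] /= [Ex nEx]; rewrite in_itv/= => y01.
  have Exy : U (x, y).
    by move: Ex; rewrite /E/= tor_id//; split; rewrite /= in_itv.
  split => // Uxv; apply: nEx; rewrite /E/= /trans/= addr0 tor_id//; exact: UL.
Qed.

(** The constant 8 is 2 for E plus 2 * 3 for its preimage, since catM enlarges
    the norm |v.1| + |v.2| by a factor of at most 3. *)
Lemma modulus_escape v :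
  modulus (E `\` @catM R @^-1` E) v <= 8 * (`|v.1| + `|v.2|).
Proof.
have tM := toral_catM tE.
rewrite setDE; apply: (le_trans (modulusI _ tE (toralC tM))); rewrite modulusC//.
rewrite (@modulus_iter _ (@catM R) 1 _ _ (@catM_trans R) (@toral_catM R) (@pr_catM R) tE)/=.
have := modulus_lift v; have := modulus_lift (catM v); rewrite /catM/=.
have := ler_normD (2 * v.1) v.2; rewrite normrM (@ger0_norm _ 2)//.
have := ler_normD v.1 v.2.
have := normr_ge0 v.1; have := normr_ge0 v.2.
move: (modulus _ _) (modulus _ _) `|v.1| `|v.2| `|_| `|_|.
by clear => *; lra.
Qed.

End slices_intervals.

Definition target q (r : R) : set (plane R) :=
  [set p | Lambda p /\ (p.1 - q.1) ^+ 2 + (p.2 - q.2) ^+ 2 < r].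

Lemma measurable_target q r : measurable (target q r).
Proof.
apply: measurableI; first exact: measurable_Lambda.
rewrite -[X in measurable X]setTI.
apply: measurable_fun_ltr => //; apply: measurable_funD; apply: measurable_funX.
  by apply: (@measurable_linE _ _ 1 0 (- q.1)) => p; ring.
by apply: (@measurable_linE _ _ 0 1 (- q.2)) => p; ring.
Qed.

Lemma target_Lambda q r : target q r `<=` @Lambda R.
Proof. by move=> p []. Qed.

Lemma sqr_between (x y z a r : R) : x <= z <= y ->
  (x - a) ^+ 2 < r -> (y - a) ^+ 2 < r -> (z - a) ^+ 2 < r.
Proof.
move=> /andP[xz zy] hx hy; have [za|az] := leP a z.
  apply: le_lt_trans hy; rewrite ler_pXn2r ?nnegrE//; lra.
apply: le_lt_trans hx; rewrite -sqrrN -[leRHS]sqrrN ler_pXn2r ?nnegrE//; lra.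
Qed.

Lemma target_xitv q r y : is_interval [set x | target q r (x, y)].
Proof.
move=> x x' [[/=]]; rewrite !in_itv/= => x0 y0 h [[/=]]; rewrite !in_itv/= => x1 _ h' z xzx.
split; first by split; rewrite /= in_itv/= ?y0//; apply/andP; split; lra.
by move: h h'; rewrite /= -!ltrBrDr; exact: sqr_between.
Qed.

Lemma target_yitv q r x : is_interval [set y | target q r (x, y)].
Proof.
move=> y y' [[/=]]; rewrite !in_itv/= => x0 y0 h [[/=]]; rewrite !in_itv/= => _ y1 h' z yzy.
split; first by split; rewrite /= in_itv/= ?x0//; apply/andP; split; lra.
by move: h h'; rewrite /= -!ltrBrDl; exact: sqr_between.
Qed.

End targets.

(** * A Borel-Cantelli lemma for families of sets *)

Section borel_cantelli.
Context d (T : measurableType d) (R : realType).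
Local Open Scope ereal_scope.

(** The sum of the series has a finite integral, so it is finite almost
    everywhere and its terms tend to 0. *)
Lemma ae_cvg0_of_summable_integrals (mu : {measure set T -> \bar R})
    (f : nat -> T -> R) (B : R) :
  (forall k, measurable_fun setT (f k)) -> (forall k x, (0 <= f k x)%R) ->
  (forall n, \sum_(0 <= k < n) \int[mu]_x (f k x)%:E <= B%:E) ->
  {ae mu, forall x, f k x @[k --> \oo] --> (0 : R)%R}.
Proof.
move=> mf f0 sB.
have mF k : measurable_fun setT (fun x => (f k x)%:E) by exact/measurable_EFinP.
have F0 k x : setT x -> 0 <= (f k x)%:E by rewrite lee_fin.
pose F x := \sum_(0 <= k <oo) (f k x)%:E.
have intF : \int[mu]_x F x <= B%:E.
  rewrite /F (integral_nneseries _ measurableT mF F0).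
  apply: lime_le; last by apply: nearW => n; exact: sB.
  by apply: is_cvg_nneseries => k _ _; apply: integral_ge0 => x; exact: F0.
have F_ge0 x : 0 <= F x by apply: nneseries_ge0 => k _ _; exact: F0.
have iF : mu.-integrable setT F.
  apply/integrableP; split; first by apply: (ge0_emeasurable_sum (P := xpredT)) => k *; [exact: F0|exact: mF].
  under eq_integral do rewrite gee0_abs//.
  by rewrite (le_lt_trans intF) ?ltry.
apply: filterS (integrable_ae measurableT iF) => x /(_ I) Ffin.
apply: cvg_series_cvg_0; apply: nondecreasing_is_cvgn.
  by apply: nondecreasing_series => k _ _; exact: f0.
exists (fine (F x)) => _ [n _ <-].
rewrite -lee_fin fineK// /series/= -sumEFin.
by apply: nneseries_lim_ge => k _ _; rewrite lee_fin.
Qed.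

End borel_cantelli.

Section parametrised_sections.
Context d (T : measurableType d) (R : realType).
Variable mu : {sigma_finite_measure set T -> \bar R}.
Variable G : set (T * plane R).
Hypothesis mG : measurable G.

Lemma measurable_pr_xsection : measurable_fun setT (fun s => pr [set x | G (s, x)]).
Proof.
apply/measurable_EFinP.
rewrite (_ : _ \o _ = @nu R \o xsection G).
  exact: (@measurable_fun_xsection _ _ _ _ _ (@nu R)).
apply/funext => s /=; rewrite prK; last first.
  have := measurable_xsection s mG; rewrite (_ : xsection G s = [set x | G (s, x)])//.
  by apply/seteqP; split => x; rewrite /xsection/= inE.
by congr (nu _); apply/seteqP; split => x; rewrite /xsection/= inE.
Qed.

(** Fubini: the average over the parameter s of the probability of a section is
    computed by first fixing x; only the x in B contribute, each at most c. *)
Lemma integral_pr_xsection_le (B : set (plane R)) (c : R) : measurable B ->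
  (0 <= c)%R ->
  (forall x, (mu [set s | G (s, x)] <= c%:E * (\1_B x)%:E)%E) ->
  (\int[mu]_s (pr [set x | G (s, x)])%:E <= (c * pr B)%:E)%E.
Proof.
move=> mB c0 GB.
have -> : (\int[mu]_s (pr [set x | G (s, x)])%:E = (mu \x (@nu R)) G)%E.
  apply: eq_integral => s _ /=; rewrite prK; last first.
    have := measurable_xsection s mG; rewrite (_ : xsection G s = [set x | G (s, x)])//.
    by apply/seteqP; split => x; rewrite /xsection/= inE.
  by congr (nu _); apply/seteqP; split => x; rewrite /xsection/= inE.
pose P : probability (plane R) R := @nu R.
rewrite (@product_measure_unique _ _ _ _ _ mu P (mu \x^ P)%E)//; last first.
  by move=> A A' mA mA'; exact: product_measure2E.
apply: (@le_trans _ _ (\int[P]_x (c%:E * (\1_B x)%:E))%E).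
  apply: ge0_le_integral => //.
  - by apply: measurable_fun_ysection => //; rewrite inE.
  - by apply: measurable_funeM; apply/measurable_EFinP; exact: measurable_indic.
  move=> x _ /=; apply: le_trans (GB x).
  rewrite le_eqVlt; apply/orP; left; apply/eqP; congr (mu _).
  by apply/seteqP; split => s; rewrite /ysection/= inE.
rewrite ge0_integralZl//; last by apply/measurable_EFinP; exact: measurable_indic.
rewrite integral_indic// setIT EFinM le_eqVlt; apply/orP; left.
by rewrite (prK mB).
Qed.

End parametrised_sections.

(** * Short returns along dyadic times *)

Section short_returns.
Variable R : realType.
Local Notation M := (@catM R).

Lemma le_return_sum (A B : set (plane R)) n : toral A -> toral B -> A `<=` B ->
  return_sum A n <= return_sum B n.
Proof.
move=> tA tB AB; apply: ler_sum => j _.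
have tI D : toral D -> measurable (D `&` iter j M @^-1` D).
  by move=> tD; exact: toral_meas (toralI tD (toral_iter j (@toral_catM R) tD)).
by apply: le_pr; [exact: tI|exact: tI|move=> p [? ?]; split; exact: AB].
Qed.

Lemma cvg_trunc_log : trunc_log 2 n @[n --> \oo] --> \oo.
Proof.
apply/cvgnyPge => A; near=> n; apply: trunc_log_max => //.
by near: n; exact: (nbhs_infty_ge (2 ^ A)%N).
Unshelve. all: by end_near. Qed.

(** Between two powers of 2 the target can be replaced by the larger one of the
    lower power, at the price of a factor of at most 2. *)
Lemma cvg_return_sum_dyadic (U E : nat -> set (plane R)) :
  (forall n, toral (U n)) -> (forall k, toral (E k)) ->
  (\forall n \near \oo, U n `<=` E (trunc_log 2 n)) ->
  2 ^+ k.+1 * return_sum (E k) (4 * k.+1) @[k --> \oo] --> (0 : R) ->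
  n%:R * return_sum (U n) (gap n + gap n) @[n --> \oo] --> (0 : R).
Proof.
move=> tU tE UE E0.
have h : 2 ^+ (trunc_log 2 n).+1 * return_sum (E (trunc_log 2 n))
    (4 * (trunc_log 2 n).+1) @[n --> \oo] --> (0 : R).
  exact: (cvg_comp _ _ cvg_trunc_log E0).
apply: (squeeze_cvgr _ (cvg_cst 0) h); near=> n.
rewrite mulr_ge0 ?return_sum_ge0//=.
have -> : (gap n + gap n = 4 * (trunc_log 2 n).+1)%N by rewrite /gap; lia.
apply: ler_pM; [by []|exact: return_sum_ge0| |].
  by rewrite -natrX ler_nat ltnW// trunc_log_ltn.
by apply: le_return_sum => //; near: n.
Unshelve. all: by end_near. Qed.

Context d (T : measurableType d).
Variable mu : {sigma_finite_measure set T -> \bar R}.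
Variables (a : nat) (rho C : R).
Hypotheses (rho0 : 0 < rho) (rho1 : rho < 1) (rhoa : rho ^+ a = 2^-1).
Variable E : nat -> T -> set (plane R).
Hypothesis mE : forall k j,
  measurable_fun setT (fun s => pr (E k s `&` iter j M @^-1` E k s)).
Hypothesis intE : forall k j, (0 < j)%N ->
  (\int[mu]_s (pr (E k s `&` iter j M @^-1` E k s))%:E <=
     (C * rho ^+ (k * a.+1))%:E)%E.

Lemma arithmetico_geometric_sum n :
  (1 - rho) ^+ 2 * \sum_(0 <= k < n) k.+1%:R * rho ^+ k =
  1 - n.+1%:R * rho ^+ n + n%:R * rho ^+ n.+1.
Proof.
elim: n => [|n IH]; first by rewrite big_geq// mulr0 expr0 mulr1 mul0r subrr addr0.
rewrite big_nat_recr//= mulrDr IH !exprS -(natr1 n.+1) -(natr1 n).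
by move: (rho ^+ n) (n%:R) => x y; ring.
Qed.

(** With radii of order rho ^+ k, where rho ^+ a = 1 / 2, about 2 ^+ k starting
    points and 4 (k + 1) return times, the expected number of short returns has
    an integral of order (k + 1) rho ^+ k, which is summable. *)
Lemma ae_cvg_return_sum :
  {ae mu, forall s, 2 ^+ k.+1 * return_sum (E k s) (4 * k.+1) @[k --> \oo] --> (0 : R)}.
Proof.
have C0 : 0 <= C.
  have := intE 0 (ltn0Sn 0); rewrite mul0n expr0 mulr1 => h.
  rewrite -lee_fin; apply: le_trans h.
  by apply: integral_ge0 => s _; rewrite lee_fin pr_ge0.
have mR k : measurable_fun setT (fun s => return_sum (E k s) (4 * k.+1)).
  exact: measurable_sum.
apply: (@ae_cvg0_of_summable_integrals _ _ _ mu _ (8 * C / (1 - rho) ^+ 2)).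
- by move=> k; apply: measurable_funM.
- by move=> k s; rewrite mulr_ge0 ?return_sum_ge0// exprn_ge0.
move=> n.
have term k : (\int[mu]_s (2 ^+ k.+1 * return_sum (E k s) (4 * k.+1))%:E <=
    (8 * C * (k.+1%:R * rho ^+ k))%:E)%E.
  under eq_integral do rewrite EFinM.
  rewrite ge0_integralZl//; last 2 first.
  - by apply/measurable_EFinP.
  - by move=> s _; rewrite lee_fin return_sum_ge0.
  under eq_integral do rewrite /return_sum -sumEFin.
  rewrite ge0_integral_sum//; last 2 first.
  - by move=> j; apply/measurable_EFinP.
  - by move=> j s _; rewrite lee_fin pr_ge0.
  have -> : 8 * C * (k.+1%:R * rho ^+ k) =
     2 ^+ k.+1 * ((4 * k.+1)%:R * (C * rho ^+ (k * a.+1))).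
    rewrite exprS natrM mulnC mulSn exprD exprM rhoa exprVn.
    have : (2 ^+ k : R) != 0 by rewrite expf_neq0.
    by move: (2 ^+ k) (rho ^+ k) (k.+1%:R) => x y z x0; field.
  rewrite EFinM; apply: lee_wpmul2l; first by rewrite lee_fin exprn_ge0.
  have x0 : 0 <= C * rho ^+ (k * a.+1) by rewrite mulr_ge0// exprn_ge0// ltW.
  apply: (@le_trans _ _ (\sum_(1 <= j < 4 * k.+1) (C * rho ^+ (k * a.+1))%:E)%E).
    by rewrite big_nat [leRHS]big_nat; apply: lee_sum => j /andP[j0 _]; exact: intE.
  rewrite sumEFin lee_fin sumr_const_nat -[leLHS]mulr_natl ler_wpM2r// ler_nat.
  exact: leq_subr.
apply: (@le_trans _ _ (\sum_(0 <= k < n) (8 * C * (k.+1%:R * rho ^+ k))%:E)%E).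
  by apply: lee_sum.
have r2 : 0 < (1 - rho) ^+ 2 by rewrite exprn_gt0// subr_gt0.
rewrite sumEFin lee_fin -mulr_sumr ler_wpM2l ?mulr_ge0//.
rewrite -[leRHS]mul1r ler_pdivlMr// mulrC arithmetico_geometric_sum.
rewrite exprS -(natr1 n).
have := exprn_ge0 n (ltW rho0); have := ler0n R n.
move: (rho ^+ n) (n%:R) => x y y0 x0.
have : y * (rho * x) <= y * x by rewrite ler_wpM2l// ler_piMl// ltW.
by rewrite mulrDl mul1r; move: (y * (rho * x)) (y * x) => u v; lra.
Qed.

End short_returns.

(** * Short returns for radii of a given order *)

Section radius_sequences.
Variable R : realType.
Local Notation M := (@catM R).

Lemma ex_root_half (a : nat) : (0 < a)%N ->
  exists rho : R, [/\ 0 < rho, rho < 1 & rho ^+ a = 2^-1].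
Proof.
move=> a0; exists ((2^-1) `^ (a%:R^-1)).
have a0' : (0 : R) < a%:R by rewrite ltr0n.
have h0 : (0 : R) < 2^-1 by rewrite invr_gt0.
have ra : ((2^-1) `^ (a%:R^-1)) ^+ a = 2^-1 :> R.
  by rewrite -powR_mulrn ?powR_ge0// -powRrM mulVf ?gt_eqF// powRr1// ltW.
split => //.
rewrite ltNge; apply/negP => h.
have := exprn_ege1 a h; rewrite ra; lra.
Qed.

(** The condition on r says that r n is at most of the order of the a-th root of
    1 / n, which is rho ^+ trunc_log 2 n up to a constant. *)
Lemma radius_dyadic (a : nat) (rho c : R) (r : R^nat) : (0 < a)%N ->
  0 < rho -> rho ^+ a = 2^-1 -> (forall n, 0 <= r n) ->
  n%:R * r n ^+ a @[n --> \oo] --> c ->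
  exists L : nat, \forall n \near \oo, r n <= L%:R * rho ^+ trunc_log 2 n.
Proof.
move=> a0 rho0 rhoa r0 rc.
pose L := (Num.truncn (`|c| + 1)).+1; exists L.
have Lc : c + 1 <= L%:R.
  apply: (@le_trans _ _ (`|c| + 1)); first by rewrite lerD2r ler_norm.
  by rewrite ltW// truncnS_gt.
near=> n; have n0 : (0 < n)%N by near: n; exact: nbhs_infty_gt.
rewrite -(@ler_pXn2r _ a)// ?nnegrE//; last by rewrite mulr_ge0// exprn_ge0// ltW.
rewrite exprMn -exprM mulnC exprM rhoa.
have nr : n%:R * r n ^+ a <= c + 1.
  by near: n; apply: (cvgr_le _ rc); rewrite ltrDl.
(* L absorbs the constant c + 1 because L <= L ^+ a. *)
have La : L%:R <= L%:R ^+ a :> R.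
  by rewrite -natrX ler_nat -[leqLHS]expn1 leq_pexp2l.
rewrite exprVn ler_pdivlMr ?exprn_gt0//.
apply: le_trans (le_trans Lc La); apply: le_trans nr.
rewrite mulrC ler_wpM2r ?exprn_ge0// -natrX ler_nat.
exact: trunc_logP.
Unshelve. all: by end_near. Qed.

Context d (T : measurableType d).
Variable mu : {sigma_finite_measure set T -> \bar R}.
Variables (a : nat) (E : R -> T -> set (plane R)).
Hypothesis a0 : (0 < a)%N.
Hypothesis tE : forall r s, toral (E r s).
Hypothesis E_mono : forall r r' s, 0 <= r -> r <= r' -> E r s `<=` E r' s.
Hypothesis mE : forall r j,
  measurable_fun setT (fun s => pr (E r s `&` iter j M @^-1` E r s)).
Variable C : R.
Hypothesis intE : forall r j, 0 <= r -> (0 < j)%N ->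
  (\int[mu]_s (pr (E r s `&` iter j M @^-1` E r s))%:E <=
     (C * r ^+ a.+1 * Num.max 1 r)%:E)%E.

(** It suffices to treat the countably many radii L * rho ^+ k, which dominate
    all sequences r of the given order; the exceptional set is the union over
    the integers L. *)
Lemma ae_return_sum_radius :
  {ae mu, forall s, forall (r : R^nat) (U : nat -> set (plane R)) (c : R),
    (forall n, toral (U n)) -> (forall n, 0 <= r n) ->
    n%:R * r n ^+ a @[n --> \oo] --> c ->
    (\forall n \near \oo, U n `<=` E (r n) s) ->
    n%:R * return_sum (U n) (gap n + gap n) @[n --> \oo] --> (0 : R)}.
Proof.
have [rho [rho0 rho1 rhoa]] := ex_root_half a0.
have C0 : 0 <= C.
  have := intE ler01 (ltn0Sn 0); rewrite expr1n maxxx !mulr1 => h.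
  rewrite -lee_fin; apply: le_trans h.
  by apply: integral_ge0 => s _; rewrite lee_fin pr_ge0.
have H (L : nat) : {ae mu, forall s, 2 ^+ k.+1 *
    return_sum (E (L%:R * rho ^+ k) s) (4 * k.+1) @[k --> \oo] --> (0 : R)}.
  apply: (@ae_cvg_return_sum _ _ _ _ a rho (C * L%:R ^+ a.+1 * Num.max 1 L%:R)) => //.
  move=> k j j0; apply: (le_trans (intE _ j0)); first by rewrite mulr_ge0// exprn_ge0// ltW.
  rewrite lee_fin exprMn -exprM mulrA mulrAC ler_wpM2r ?exprn_ge0 ?(ltW rho0)//.
  rewrite ler_wpM2l ?mulr_ge0 ?exprn_ge0//.
  by rewrite ge_max !le_max lexx/= ler_piMr ?orbT// exprn_ile1// ltW.
apply: filterS (ae_foralln H) => s Hs r U c tU r0 rc UE.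
have [L Lr] := radius_dyadic a0 rho0 rhoa r0 rc.
apply: (cvg_return_sum_dyadic tU (fun k => tE _ _) _ (Hs L)).
near=> n; apply: (@subset_trans _ (E (r n) s)); first by near: n.
by apply: E_mono => //; near: n.
Unshelve. all: by end_near. Qed.

End radius_sequences.

(** * Returns to boxes *)

Section boxes.
Variable R : realType.
Notation leb := (@lebesgue_measure R).
Notation RR := (measurableTypeR R).
Local Notation M := (@catM R).

(** Through a positive integer coefficient an iterate winds a slice of the torus
    around the circle, so its coordinates are equidistributed on every slice. *)
Lemma catM_entries j : exists a b c d : nat,
  [/\ (0 < a)%N, (0 < d)%N, (0 < j)%N -> (0 < b)%N /\ (0 < c)%N &
    forall p : plane R, iter j M p =
      (a%:R * p.1 + b%:R * p.2, c%:R * p.1 + d%:R * p.2)].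
Proof.
elim: j => [|j [a [b [c [d [a0 d0 bc H]]]]]].
  by exists 1%N, 0%N, 0%N, 1%N; split => // -[x y] /=; congr pair; ring.
exists (2 * a + c)%N, (2 * b + d)%N, (a + c)%N, (b + d)%N; split; [lia|lia|lia|].
move=> p; rewrite iterS H /catM/=; congr pair; rewrite !natrD ?natrM; ring.
Qed.

(** The h-neighbourhood of the integers. *)
Definition near0 (h : R) : set RR := [set z | frac z <= h \/ 1 - h <= frac z].

Lemma periodic1_near0 h : periodic1 (near0 h).
Proof. by move=> x i; rewrite /near0/= frac_periodic. Qed.

Lemma measurable_frac_le (h : R) : measurable ([set z : RR | frac z <= h] : set RR).
Proof.
rewrite -[X in measurable X]setTI; apply: (@measurable_fun_ler _ RR) => //.
exact: measurable_frac.
Qed.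

Lemma measurable_frac_ge (h : R) : measurable ([set z : RR | h <= frac z] : set RR).
Proof.
rewrite -[X in measurable X]setTI; apply: (@measurable_fun_ler _ RR) => //.
exact: measurable_frac.
Qed.

Lemma measurable_near0 h : measurable (near0 h).
Proof. by apply: measurableU; [exact: measurable_frac_le|exact: measurable_frac_ge]. Qed.

Lemma measurable_near0_fun d (T : measurableType d) (f : T -> R) h :
  measurable_fun setT f -> measurable [set t | near0 h (f t)].
Proof.
move=> mf; have mf' : measurable_fun setT (f : T -> RR) by exact: mf.
by rewrite -[X in measurable X]setTI; exact: (mf' measurableT _ (measurable_near0 h)).
Qed.

Lemma le_near0 h h' : h <= h' -> near0 h `<=` near0 h'.
Proof. by move=> hh z [?|?]; [left|right]; lra. Qed.

Lemma leb_near0 h : 0 <= h ->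
  (leb (near0 h `&` `[0%R, 1%R[) <= (2 * h)%:E)%E.
Proof.
move=> h0.
have sub : near0 h `&` `[0, 1[ `<=` `[0, h] `|` `[1 - h, 1].
  move=> z [zh]; rewrite /= !in_itv/= => z01; have z01' := z01.
  by case: zh; rewrite frac_id// => ?; [left|right]; case/andP: z01' => *; apply/andP; split; lra.
apply: (@le_trans _ _ (leb (`[0, h] `|` `[1 - h, 1]))).
  apply: le_measure => //; rewrite inE.
    by apply: measurableI; [exact: measurable_near0|exact: measurable_itv].
  by apply: measurableU; exact: measurable_itv.
apply: (@le_trans _ _ (leb `[0%R, h] + leb `[(1 - h)%R, 1%R])%E).
  by apply: measureU2; exact: measurable_itv.
rewrite !lebesgue_measure_itv/= !lte_fin.
have -> : (2 * h)%:E = (h%:E + h%:E)%E by rewrite -EFinD; congr EFin; ring.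
apply: leeD.
  by case: ifP => _; [rewrite sube0|rewrite lee_fin].
by case: ifP => _; [rewrite -EFinB lee_fin; lra|rewrite lee_fin].
Qed.

Lemma near0_sub (x y r : R) : `|frac x - frac y| <= r -> near0 r (x - y).
Proof.
move=> h.
have e : frac (x - y) = frac (frac x - frac y).
  rewrite -(frac_periodic (frac x - frac y) (Num.floor x - Num.floor y)).
  by congr frac; rewrite /frac intrB; ring.
rewrite /near0/= e.
have /andP[x0 x1] := frac_itv x; have /andP[y0 y1] := frac_itv y.
move: h; rewrite ler_norml => /andP[h1 h2].
have [d0|d0] := leP 0 (frac x - frac y).
  by left; rewrite frac_id//; apply/andP; split; lra.
right; rewrite -(frac_periodic _ 1) mulr1z frac_id; first by lra.
by apply/andP; split; lra.
Qed.

Lemma leb_near0_affine h (k : nat) (v : R) : 0 <= h -> (0 < k)%N ->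
  (leb ([set x | near0 h (k%:R * x + v)%R] `&` `[0%R, 1%R[) <= (2 * h)%:E)%E.
Proof.
move=> h0 k0; rewrite lebesgue_periodic_affine//; first exact: leb_near0.
- exact: measurable_near0.
- exact: periodic1_near0.
Qed.

Lemma leb_frac_window (x h : R) : 0 <= h ->
  leb [set y | `|x - y| <= h] = (2 * h)%:E.
Proof.
move=> h0; rewrite (_ : [set y | _] = `[x - h, x + h]%classic).
  rewrite lebesgue_measure_itv/= lte_fin; case: ltP => hh.
    by rewrite -EFinB; congr EFin; ring.
  by congr EFin; lra.
apply/seteqP; split => y /=; rewrite in_itv/= ler_norml => /andP[? ?];
  by apply/andP; split; lra.
Qed.

Definition box (r : R) (p : plane R) : set (plane R) :=
  [set x | `|frac x.1 - p.1| <= r /\ `|frac x.2 - p.2| <= r].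

Lemma measurable_dist_le d (T : measurableType d) (f g : T -> R) r :
  measurable_fun setT f -> measurable_fun setT g ->
  measurable [set t | `|f t - g t| <= r].
Proof.
move=> mf mg; rewrite -[X in measurable X]setTI.
apply: measurable_fun_ler => //.
by apply: measurableT_comp => //; exact: measurable_funB.
Qed.

Lemma measurable_frac1 : measurable_fun setT (fun x : plane R => frac x.1 : R).
Proof.
by apply: measurableT_comp; [exact: measurable_frac|exact: measurable_coord1].
Qed.

Lemma measurable_frac2 : measurable_fun setT (fun x : plane R => frac x.2 : R).
Proof.
by apply: measurableT_comp; [exact: measurable_frac|exact: measurable_coord2].
Qed.

Lemma measurable_iter_catM j : measurable_fun setT (iter j M).
Proof.
elim: j => [|j IH]; first exact: measurable_id.
by rewrite (_ : iter j.+1 M = M \o iter j M)//; exact: (measurableT_comp (@measurable_catM R) IH).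
Qed.

Lemma toral_box r p : toral (box r p).
Proof.
split; last by move=> x i j; rewrite /box/= !frac_periodic.
apply: measurableI; apply: measurable_dist_le => //.
- exact: measurable_frac1.
- exact: measurable_frac2.
Qed.

Lemma measurable_returns d (T : measurableType d) (E : T -> set (plane R)) j :
  measurable [set z : T * plane R | E z.1 z.2] ->
  measurable [set z : T * plane R | (E z.1 `&` iter j M @^-1` E z.1) z.2].
Proof.
move=> mE; pose f (z : T * plane R) := (z.1, iter j M z.2).
rewrite (_ : [set z | _] = [set z : T * plane R | E z.1 z.2] `&`
  (setT `&` f @^-1` [set z : T * plane R | E z.1 z.2])); last by rewrite setTI.
suff mf : measurable_fun setT f by apply: measurableI => //; exact: mf.
apply: measurable_fun_pair; first exact: measurable_fst.
by apply: (measurableT_comp (@measurable_iter_catM j)); exact: measurable_snd.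
Qed.

Lemma measurable_box r : measurable [set z : plane R * plane R | box r z.1 z.2].
Proof.
apply: measurableI; apply: measurable_dist_le.
- by apply: (measurableT_comp measurable_frac1); exact: measurable_snd.
- by apply: (measurableT_comp (@measurable_coord1 R)); exact: measurable_fst.
- by apply: (measurableT_comp measurable_frac2); exact: measurable_snd.
- by apply: (measurableT_comp (@measurable_coord2 R)); exact: measurable_fst.
Qed.

Lemma nu_le_leb2 (S W : set (plane R)) : measurable S -> measurable W ->
  S `<=` W -> (@nu R S <= leb2 R W)%E.
Proof.
move=> mS mW SW; rewrite /nu /mrestr.
apply: le_measure; rewrite ?inE//; last by move=> p [/SW].
exact: measurable_ILambda.
Qed.

(** If x and its image lie in the box around p then they are close to each
    other, which confines x to a strip of measure 4 r whatever p is; given such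
    an x, the centre p lies in a square of area 4 r ^+ 2. The diagonal entry d
    may be 1, and the strip is nontrivial thanks to the entry c. *)
Lemma integral_box_returns r j : 0 <= r -> (0 < j)%N ->
  (\int[@nu R]_p (pr (box r p `&` iter j M @^-1` box r p))%:E <=
   (16 * r ^+ 3)%:E)%E.
Proof.
move=> r0 j0.
have mG := measurable_returns j (measurable_box r).
have [a [b [c [d [a0 d0 /(_ j0)[b0 c0] jE]]]]] := catM_entries j.
pose B : set (plane R) := [set x | near0 (2 * r) (c%:R * x.1 + (d%:R - 1) * x.2)].
have mB : measurable B.
  apply: measurable_near0_fun.
  by apply: (@measurable_linE _ _ c%:R (d%:R - 1) 0) => p; rewrite addr0.
have prB : pr B <= 4 * r.
  rewrite -[leRHS]mulr1 -[X in _ <= _ * X](pr_setT R).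
  apply: pr_le_yslice => //; first by rewrite mulr_ge0.
  move=> y _; rewrite [X in (_ * leb X)%E](_ : _ = setT `&` `[0, 1[); last first.
    by apply/seteqP; split.
  rewrite leb01 mule1 (_ : 4 * r = 2 * (2 * r)); last by ring.
  by have := @leb_near0_affine (2 * r) c ((d%:R - 1) * y) (mulr_ge0 (ler0n R 2) r0) c0.
apply: (@le_trans _ _ (4 * r ^+ 2 * pr B)%:E); last first.
  rewrite lee_fin (_ : 16 * r ^+ 3 = 4 * r ^+ 2 * (4 * r)); last by ring.
  by rewrite ler_wpM2l// mulr_ge0// sqr_ge0.
apply: (integral_pr_xsection_le (mu := @nu R) mG) => //.
  by rewrite mulr_ge0// sqr_ge0.
move=> x; rewrite indicE.
have mW (f : R) : measurable ([set y | `|f - y| <= r] : set RR).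
  by apply: (@measurable_dist_le _ RR (cst f) id) => //; exact: measurable_id.
have [xB|xB] := boolP (x \in B); last first.
  rewrite mule0 (_ : [set s | _] = set0) ?measure0//.
  apply/seteqP; split => // p [[_ h1] [_ h2]]; move/negP: xB; apply; rewrite inE /B/=.
  have -> : c%:R * x.1 + (d%:R - 1) * x.2 = (iter j M x).2 - x.2.
    by rewrite jE/=; ring.
  apply: near0_sub; rewrite (_ : _ - frac x.2 =
    (frac (iter j M x).2 - p.2) + - (frac x.2 - p.2)); last by ring.
  apply: (le_trans (ler_normD _ _)); rewrite normrN.
  by apply: (le_trans (lerD h2 h1)); lra.
rewrite mule1.
apply: (@le_trans _ _ (leb2 R ([set y | `|frac x.1 - y| <= r] `*`
  [set y | `|frac x.2 - y| <= r]))).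
  apply: nu_le_leb2; last by move=> p [[h1 h2] _].
    rewrite (_ : [set s | _] = ysection [set z : plane R * plane R |
       (box r z.1 `&` iter j M @^-1` box r z.1) z.2] x).
      exact: measurable_ysection.
    by apply/seteqP; split => s; rewrite /ysection/= inE.
  by apply: measurableX.
apply: (@le_trans _ _ ((2 * r)%:E * (2 * r)%:E)%E).
  rewrite le_eqVlt; apply/orP; left; apply/eqP; apply: etrans.
    exact: product_measure1E.
  by congr (_ * _)%E; exact: leb_frac_window.
by rewrite -EFinM lee_fin; lra.
Qed.

End boxes.

(** * Returns to thin boxes along a side *)

Section strips.
Variable R : realType.
Notation leb := (@lebesgue_measure R).
Notation RR := (measurableTypeR R).
Local Notation M := (@catM R).

Section one_side.
Variables f g : plane R -> R.
Hypotheses (mf : measurable_fun setT f) (mg : measurable_fun setT g).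
Hypothesis pf : forall (p : plane R) (i j : int),
  frac (f (p.1 + i%:~R, p.2 + j%:~R)) = frac (f p).
Hypothesis pg : forall (p : plane R) (i j : int),
  frac (g (p.1 + i%:~R, p.2 + j%:~R)) = frac (g p).

(** The shape is that of a cap cut off by a circle: its depth is the square of
    its width. *)
Definition side_box (h y : R) : set (plane R) :=
  [set x | near0 (h ^+ 2) (f x) /\ `|frac (g x) - y| <= h].

Let mfrac (k : plane R -> R) : measurable_fun setT k ->
  measurable_fun setT (fun x => frac (k x)).
Proof. by move=> mk; apply: measurableT_comp => //; exact: measurable_frac. Qed.

Lemma toral_side_box h y : toral (side_box h y).
Proof.
split; last first.
  by move=> x i j; rewrite /side_box/near0/= (pf x i j) (pg x i j).
apply: measurableI; last by apply: measurable_dist_le => //; exact: mfrac.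
exact: measurable_near0_fun.
Qed.

Lemma measurable_side_box h : measurable [set z : RR * plane R | side_box h z.1 z.2].
Proof.
apply: measurableI.
  apply: measurable_near0_fun.
  by apply: (measurableT_comp mf); exact: measurable_snd.
apply: measurable_dist_le.
  by apply: (measurableT_comp (mfrac mg)); exact: measurable_snd.
exact: (@measurable_fst _ _ RR (plane R)).
Qed.

Hypothesis indep : forall j (h : R), (0 < j)%N -> 0 <= h ->
  pr [set x | near0 h (f x) /\ near0 h (f (iter j M x))] <= 4 * h ^+ 2.

(** A return forces the coordinate f to be close to 0 twice, an event of
    probability of order h ^+ 4 by independence, and the coordinate g of the
    centre is then in an interval of length 2 h. *)
Lemma integral_side_returns h j : 0 <= h -> (0 < j)%N ->
  (\int[leb]_y (pr (side_box h y `&` iter j M @^-1` side_box h y))%:E <=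
   (8 * h ^+ 4 * Num.max 1 h)%:E)%E.
Proof.
move=> h0 j0.
have mG := measurable_returns j (measurable_side_box h).
have h2 : 0 <= h ^+ 2 by rewrite sqr_ge0.
pose B : set (plane R) :=
  [set x | near0 (h ^+ 2) (f x) /\ near0 (h ^+ 2) (f (iter j M x))].
have mB : measurable B.
  apply: measurableI; apply: measurable_near0_fun; first exact: mf.
  by apply: (measurableT_comp mf); exact: measurable_iter_catM.
apply: (@le_trans _ _ (2 * h * pr B)%:E); last first.
  rewrite lee_fin; apply: (@le_trans _ _ (8 * h ^+ 4 * h)); last first.
    by rewrite ler_wpM2l ?mulr_ge0 ?exprn_ge0// le_max lexx orbT.
  rewrite (_ : 8 * h ^+ 4 * h = 2 * h * (4 * (h ^+ 2) ^+ 2)); last by ring.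
  by rewrite ler_wpM2l ?mulr_ge0//; exact: indep.
apply: (integral_pr_xsection_le (mu := leb) mG) => //; first by rewrite mulr_ge0.
move=> x; rewrite indicE.
have [xB|xB] := boolP (x \in B); last first.
  rewrite mule0 (_ : [set s | _] = set0) ?measure0//.
  apply/seteqP; split => // y [[h1 _] [h3 _]]; move/negP: xB; apply.
  by rewrite inE.
rewrite mule1 -(leb_frac_window (frac (g x)) h0).
apply: le_measure; rewrite ?inE.
- rewrite (_ : [set s | _] = ysection [set z : RR * plane R |
     (side_box h z.1 `&` iter j M @^-1` side_box h z.1) z.2] x).
    exact: measurable_ysection.
  by apply/seteqP; split => s; rewrite /ysection/= inE.
- by apply: (@measurable_dist_le _ _ RR (cst (frac (g x))) id) => //; exact: measurable_id.
- by move=> y [[_ ?] _].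
Qed.

Lemma le_side_box h h' y : 0 <= h -> h <= h' -> side_box h y `<=` side_box h' y.
Proof.
move=> h0 hh x [n1 n2]; split; last exact: le_trans hh.
by apply: le_near0 n1; rewrite ler_pXn2r ?nnegrE// (le_trans h0).
Qed.

End one_side.

(** A bound on every vertical slice of S bounds the part of S in a vertical strip
    as if the two were independent. *)
Lemma pr_vertical_strip (h : R) (S : set (plane R)) : 0 <= h -> measurable S ->
  (forall x : R, leb ([set y | S (x, y)] `&` `[0%R, 1%R[) <= (2 * h)%:E)%E ->
  pr [set p | near0 h p.1 /\ S p] <= 4 * h ^+ 2.
Proof.
move=> h0 mS Sh; have mN := measurable_near0 h.
have mX : measurable (near0 h `*` [set: RR]) by apply: measurableX.
apply: (@le_trans _ _ (2 * h * pr (near0 h `*` [set: RR]))); last first.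
  rewrite (_ : 4 * h ^+ 2 = 2 * h * (2 * h)); last by ring.
  rewrite ler_wpM2l ?mulr_ge0// -lee_fin pr_setXT//; exact: leb_near0.
apply: pr_le_xslice; [|exact: mX|by rewrite mulr_ge0|].
  by apply: measurableI => //; apply: measurable_near0_fun; exact: measurable_coord1.
move=> x _; have [nx|nx] := pselect (near0 h x); last first.
  rewrite (_ : _ `&` _ = set0) ?measure0 ?mule_ge0//.
    by rewrite lee_fin mulr_ge0.
  by apply/seteqP; split => y //= [[]].
rewrite [X in (_ * leb X)%E](_ : _ = setT `&` `[0, 1[); last first.
  by apply/seteqP; split => y /=; tauto.
rewrite leb01 mule1 (_ : _ `&` _ = [set y | S (x, y)] `&` `[0, 1[); first exact: Sh.
by apply/seteqP; split => y /=; tauto.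
Qed.

Lemma pr_horizontal_strip (h : R) (S : set (plane R)) : 0 <= h -> measurable S ->
  (forall y : R, leb ([set x | S (x, y)] `&` `[0%R, 1%R[) <= (2 * h)%:E)%E ->
  pr [set p | near0 h p.2 /\ S p] <= 4 * h ^+ 2.
Proof.
move=> h0 mS Sh; have mN := measurable_near0 h.
have mX : measurable ([set: RR] `*` near0 h) by apply: measurableX.
apply: (@le_trans _ _ (2 * h * pr ([set: RR] `*` near0 h))); last first.
  rewrite (_ : 4 * h ^+ 2 = 2 * h * (2 * h)); last by ring.
  rewrite ler_wpM2l ?mulr_ge0// -lee_fin pr_setTX//; exact: leb_near0.
apply: pr_le_yslice; [|exact: mX|by rewrite mulr_ge0|].
  by apply: measurableI => //; apply: measurable_near0_fun; exact: measurable_coord2.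
move=> y _; have [ny|ny] := pselect (near0 h y); last first.
  rewrite (_ : _ `&` _ = set0) ?measure0 ?mule_ge0//.
    by rewrite lee_fin mulr_ge0.
  by apply/seteqP; split => x //= [[]].
rewrite [X in (_ * leb X)%E](_ : _ = setT `&` `[0, 1[); last first.
  by apply/seteqP; split => x /=; tauto.
rewrite leb01 mule1 (_ : _ `&` _ = [set x | S (x, y)] `&` `[0, 1[); first exact: Sh.
by apply/seteqP; split => x /=; tauto.
Qed.

Lemma vertical_strip_indep j (h : R) : (0 < j)%N -> 0 <= h ->
  pr [set x | near0 h x.1 /\ near0 h (iter j M x).1] <= 4 * h ^+ 2.
Proof.
move=> j0 h0; have [a [b [c [d [_ _ /(_ j0)[b0 _] jE]]]]] := catM_entries R j.
apply: (@pr_vertical_strip _ [set x | near0 h (iter j M x).1] h0) => [|x].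
  apply: measurable_near0_fun; apply: (measurableT_comp (@measurable_coord1 R)).
  exact: measurable_iter_catM.
have H := @leb_near0_affine R h b (a%:R * x) h0 b0.
by under eq_set do rewrite /= jE/= addrC.
Qed.

Lemma horizontal_strip_indep j (h : R) : (0 < j)%N -> 0 <= h ->
  pr [set x | near0 h x.2 /\ near0 h (iter j M x).2] <= 4 * h ^+ 2.
Proof.
move=> j0 h0; have [a [b [c [d [_ _ /(_ j0)[_ c0] jE]]]]] := catM_entries R j.
apply: (@pr_horizontal_strip _ [set x | near0 h (iter j M x).2] h0) => [|y].
  apply: measurable_near0_fun; apply: (measurableT_comp (@measurable_coord2 R)).
  exact: measurable_iter_catM.
have H := @leb_near0_affine R h c (d%:R * y) h0 c0.
by under eq_set do rewrite /= jE/=.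
Qed.

(** Only a negligible number of visits to U n is expected, up to time n, to be
    followed by another one within the gap. *)
Definition no_clusters (U : nat -> set (plane R)) :=
  n%:R * return_sum (U n) (gap n + gap n) @[n --> \oo] --> (0 : R).

(** The exponent a is such that the sets U n have measure of order 1 / n. *)
Definition no_clusters_in (a : nat) (E : R -> set (plane R)) :=
  forall (r : R^nat) (U : nat -> set (plane R)) (c : R),
    (forall n, toral (U n)) -> (forall n, 0 <= r n) ->
    n%:R * r n ^+ a @[n --> \oo] --> c ->
    (\forall n \near \oo, U n `<=` E (r n)) -> no_clusters U.

Lemma ae_no_clusters_box :
  {ae @nu R, forall p, no_clusters_in 2 (box (R := R) ^~ p)}.
Proof.
apply: (@ae_return_sum_radius _ _ _ (@nu R) 2 (@box R) _ _ _ _ 16).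
- by [].
- exact: toral_box.
- by move=> r r' p _ rr x [h1 h2]; split; exact: le_trans rr.
- by move=> r j; exact: measurable_pr_xsection (measurable_returns j (measurable_box r)).
- move=> r j r0 j0; apply: (le_trans (integral_box_returns r0 j0)).
  by rewrite lee_fin ler_peMr ?mulr_ge0 ?exprn_ge0// le_max lexx.
Qed.

Lemma ae_no_clusters_side (f g : plane R -> R) :
  measurable_fun setT f -> measurable_fun setT g ->
  (forall (p : plane R) (i j : int),
    frac (f (p.1 + i%:~R, p.2 + j%:~R)) = frac (f p)) ->
  (forall (p : plane R) (i j : int),
    frac (g (p.1 + i%:~R, p.2 + j%:~R)) = frac (g p)) ->
  (forall j (h : R), (0 < j)%N -> 0 <= h ->
    pr [set x | near0 h (f x) /\ near0 h (f (iter j M x))] <= 4 * h ^+ 2) ->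
  {ae leb, forall y, no_clusters_in 3 (side_box f g ^~ y)}.
Proof.
move=> mf mg pf pg indep.
apply: (@ae_return_sum_radius _ _ _ leb 3 (side_box f g) _ _ _ _ 8).
- by [].
- exact: toral_side_box.
- by move=> h h' y; exact: le_side_box.
- move=> h j.
  exact: measurable_pr_xsection (measurable_returns j (measurable_side_box mf mg h)).
- by move=> h j h0 j0; exact: integral_side_returns.
Qed.

Lemma ae_no_clusters_vertical :
  {ae leb, forall y, no_clusters_in 3 (side_box (@fst R R) (@snd R R) ^~ y)}.
Proof.
apply: ae_no_clusters_side.
- exact: measurable_coord1.
- exact: measurable_coord2.
- by move=> p i j; exact: frac_periodic.
- by move=> p i j; exact: frac_periodic.
- exact: vertical_strip_indep.
Qed.

Lemma ae_no_clusters_horizontal :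
  {ae leb, forall y, no_clusters_in 3 (side_box (@snd R R) (@fst R R) ^~ y)}.
Proof.
apply: ae_no_clusters_side.
- exact: measurable_coord2.
- exact: measurable_coord1.
- by move=> p i j; exact: frac_periodic.
- by move=> p i j; exact: frac_periodic.
- exact: horizontal_strip_indep.
Qed.

End strips.

(** * The maximum as a hitting time *)

Section powers.
Variable R : realType.

Lemma cvg_powR (u : R^nat) (l b : R) : 0 < l -> u n @[n --> \oo] --> l ->
  u n `^ b @[n --> \oo] --> l `^ b.
Proof.
move=> l0; have [d _] := @is_derive1_powR R b l l0.
have c : {for l, continuous (fun x : R => x `^ b)}.
  exact/differentiable_continuous/derivable1_diffP.
exact: (continuous_cvg _ c).
Qed.

Lemma powRK (x a : R) : 0 <= x -> a != 0 -> (x `^ a) `^ a^-1 = x.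
Proof. by move=> x0 a0; rewrite -powRrM mulfV// powRr1. Qed.

Lemma powRVK (x a : R) : 0 <= x -> a != 0 -> (x `^ a^-1) `^ a = x.
Proof. by move=> x0 a0; rewrite -powRrM mulVf// powRr1. Qed.

Lemma cvg_quotient_powR (y p : R) (s : R^nat) : 0 < y -> (forall n, 0 < s n) ->
  s n @[n --> \oo] --> (0 : R) ->
  ((y + s n) `^ p - y `^ p) / s n @[n --> \oo] --> p * y `^ (p - 1).
Proof.
move=> y0 s0 sc.
have [d dE] := @is_derive1_powR R p y y0.
have h : h^-1 *: ((((powR (R:=R))^~ p) \o shift y) (h *: (1 : R)) - y `^ p) @[h --> 0^'] -->
   p * y `^ (p - 1).
  by rewrite -dE; exact: d.
have sc' : s n @[n --> \oo] --> 0^'.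
  move=> A A0; have H : \forall n \near \oo, s n != 0 -> A (s n) := sc _ A0.
  change (\forall n \near \oo, A (s n)).
  by apply: filterS H => n; apply; exact: lt0r_neq0.
have H : (s n)^-1 *: ((((powR (R:=R))^~ p) \o shift y) (s n *: (1 : R)) - y `^ p)
    @[n --> \oo] --> p * y `^ (p - 1) by exact: (cvg_comp _ _ sc' h).
apply: (cvg_near_eq _ H); apply: nearW => n /=.
by rewrite [RHS]mulrC [_ *: 1]mulr1 [s n + y]addrC.
Qed.

End powers.

Section limit_distribution.
Variable R : realType.
Implicit Types (pM : plane R) (x : R).

(** Up to location and scale, this is the generalised extreme value law of tail
    index - beta^-1. *)
Definition weibull (beta x : R) : R :=
  if x < 0 then expR (- ((- x) `^ beta)) else 1.

Lemma gev_weibull (beta x : R) : 0 < beta ->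
  gev (-1) beta^-1 (- beta^-1) x = weibull beta x.
Proof.
move=> b0; have bi : 0 < beta^-1 by rewrite invr_gt0.
rewrite /gev oppr_eq0 gt_eqF//.
have -> : 1 + - beta^-1 * ((x - -1) / beta^-1) = - x.
  by field; rewrite gt_eqF.
rewrite oppr_gt0 /weibull invrN opprK invrK; case: ltP => // _.
by rewrite oppr_gt0 ifF//; apply/negbTE; rewrite -leNgt ltW.
Qed.

Definition hits pM (rho : R) : set (plane R) := @tor R @^-1` target pM (rho ^+ 2).

Lemma toral_hits pM rho : toral (hits pM rho).
Proof. by apply: toral_lift; exact: measurable_target. Qed.

Lemma iter_thom i (p : plane R) : iter i.+1 (@thom R) p = tor (iter i.+1 (@catM R) p).
Proof.
elim: i => [|i IH]; first by [].
rewrite iterS IH [in RHS]iterS; set q := iter i.+1 _ p.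
rewrite /thom /tor /catM/=.
have e1 : 2 * frac q.1 + frac q.2 = 2 * q.1 + q.2 + (- (2 * Num.floor q.1 + Num.floor q.2))%:~R.
  by rewrite /frac mulrNz intrD intrM; ring.
have e2 : frac q.1 + frac q.2 = q.1 + q.2 + (- (Num.floor q.1 + Num.floor q.2))%:~R.
  by rewrite /frac mulrNz intrD; ring.
by rewrite e1 e2 !frac_periodic.
Qed.

Lemma dist_lt (p q : plane R) (rho : R) : 0 <= rho ->
  (dist p q < rho) = ((p.1 - q.1) ^+ 2 + (p.2 - q.2) ^+ 2 < rho ^+ 2).
Proof.
move=> r0; rewrite /dist; set S := _ + _.
have S0 : 0 <= S by rewrite addr_ge0// sqr_ge0.
have [->|rn0] := eqVneq rho 0.
  by rewrite expr0n/= !ltNge S0 sqrtr_ge0.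
have rp : 0 < rho by rewrite lt_def rn0.
by rewrite -[in RHS](@ltr_sqrt _ S) ?exprn_gt0// sqrtr_sqr ger0_norm.
Qed.

Lemma partial_max_le (T : Type) (X : nat -> T -> R) n (t : T) (u : R) : (0 < n)%N ->
  (partial_max X n t <= u) <-> (forall i, (i < n)%N -> X i.+1 t <= u).
Proof.
move=> n0; rewrite /partial_max; split.
  move=> H i ni; apply: le_trans H; rewrite (bigD1_seq i.+1) ?iota_uniq//=.
    by rewrite le_max lexx.
  by rewrite mem_index_iota.
move=> H; rewrite big_nat; elim/big_ind : _.
- exact: H.
- by move=> a b a0 b0; rewrite ge_max a0.
- by case=> // i /andP[_ ni]; exact: H.
Qed.

Lemma observable_le (alpha rho : R) pM p : 0 < alpha -> 0 <= rho ->
  (observable alpha pM (tor p) <= 1 - rho `^ alpha) <-> ~ hits pM rho p.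
Proof.
move=> a0 r0; have d0 : 0 <= dist (tor p) pM by exact: sqrtr_ge0.
have hE : hits pM rho p <-> dist (tor p) pM < rho.
  by rewrite (dist_lt _ _ r0); split=> [[]//|h]; split => //; exact: tor_Lambda.
rewrite /observable lerD2l lerN2 hE.
have -> : (rho `^ alpha <= dist (tor p) pM `^ alpha) = (rho <= dist (tor p) pM).
  rewrite leNgt [in RHS]leNgt; congr (~~ _); apply/idP/idP => h.
    by rewrite ltNge; apply/negP => h'; move: h; rewrite ltNge ge0_ler_powR// ltW.
  by apply: gt0_ltr_powR.
by rewrite leNgt; split => /negP.
Qed.

(** The preimage by catM accounts for the maximum starting at time 1. *)
Lemma partial_max_avoid (alpha rho : R) pM n : 0 < alpha -> 0 <= rho -> (0 < n)%N ->
  [set t | partial_max (process (observable alpha pM)) n t <= 1 - rho `^ alpha] =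
  @catM R @^-1` avoid (hits pM rho) n.
Proof.
move=> a0 r0 n0; apply/seteqP; split => p /=.
  move=> /(partial_max_le _ _ _ n0) H i /H; rewrite /process iter_thom.
  by move/(observable_le _ _ a0 r0); rewrite -iterSr.
move=> H; apply/(partial_max_le _ _ _ n0) => i /H nH; rewrite /process iter_thom.
by apply/(observable_le _ _ a0 r0); rewrite iterSr.
Qed.

Lemma nu_partial_max (alpha rho : R) pM n : 0 < alpha -> 0 <= rho -> (0 < n)%N ->
  nu [set t | partial_max (process (observable alpha pM)) n t <= 1 - rho `^ alpha] =
  (pr (avoid (hits pM rho) n))%:E.
Proof.
move=> a0 r0 n0; have tA := toral_avoid n (toral_hits pM rho).
rewrite -(pr_catM tA) prK; last exact: toral_meas (toral_catM tA).
by rewrite partial_max_avoid.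
Qed.

Lemma measurable_partial_max_le (alpha u : R) pM n : 0 < alpha -> (0 < n)%N ->
  measurable [set t | partial_max (process (observable alpha pM)) n t <= u].
Proof.
move=> a0 n0; have [u1|u1] := leP u 1.
  have -> : u = 1 - ((1 - u) `^ alpha^-1) `^ alpha.
    by rewrite powRVK ?subr_ge0// ?gt_eqF// subKr.
  rewrite partial_max_avoid ?powR_ge0//.
  by apply: toral_meas; apply: toral_catM; apply: toral_avoid; exact: toral_hits.
rewrite (_ : [set t | _] = setT)//; apply/seteqP; split => // t _ /=.
apply/(partial_max_le _ _ _ n0) => i _; apply: le_trans (ltW u1).
by rewrite /process /observable gerBl powR_ge0.
Qed.

End limit_distribution.

(** * From hitting laws to the law of the maximum *)

Section from_hitting_to_maxima.
Variable R : realType.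
Implicit Types (pM : plane R) (x : R).

(** The number D is the distance from pM to the square, b the exponent of the
    area of the target and kappa its density, reduced by the extremal index when
    visits come in runs. *)
Definition hitting_law pM (D b kappa : R) :=
  [/\ 0 < b, 0 < kappa, 0 <= D, (forall p, ~ hits pM D p) &
    forall (delta : R^nat) (c : R), (forall n, 0 < delta n) -> 0 < c ->
      n%:R * delta n `^ b @[n --> \oo] --> c ->
      pr (avoid (hits pM (D + delta n)) n) @[n --> \oo] --> expR (- (kappa * c))].

Lemma cvg_n_over_succ : n%:R / n.+1%:R @[n --> \oo] --> (1 : R).
Proof.
have h : (1 : R) - harmonic n @[n --> \oo] --> (1 - 0 : R).
  by apply: cvgB; [exact: cvg_cst|exact: cvg_harmonic].
rewrite subr0 in h; apply: (cvg_near_eq _ h); apply: nearW => n.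
by rewrite /harmonic/= -(natr1 n); field; rewrite natr1 pnatr_eq0.
Qed.

Lemma cvge_near_eq (f g : nat -> \bar R) (l : \bar R) :
  (\forall n \near \oo, f n = g n) ->
  f n @[n --> \oo] --> l -> g n @[n --> \oo] --> l.
Proof. by move=> fg fl; apply: (cvg_trans _ fl); exact: near_eq_cvg. Qed.

Lemma powRV (x r : R) : 0 <= x -> x^-1 `^ r = (x `^ r)^-1.
Proof. by move=> x0; rewrite -powR_inv1// -powRrM mulN1r powRN. Qed.

Lemma cvg0_of_mulrn_powR (b c : R) (r : R^nat) : 0 < b -> (forall n, 0 <= r n) ->
  n%:R * r n `^ b @[n --> \oo] --> c -> r n @[n --> \oo] --> (0 : R).
Proof.
move=> b0 r0 rc; have rb := cvg0_of_mulrn rc.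
apply/cvgr0Pnorm_lt => e e0.
have eb : 0 < e `^ b by exact: powR_gt0.
near=> n; rewrite ger0_norm// ltNge; apply/negP => er.
have : r n `^ b < e `^ b by near: n; exact: (cvgr_lt _ rb).
by rewrite ltNge ge0_ler_powR ?nnegrE// ltW.
Unshelve. all: by end_near. Qed.

Variables (alpha : R) (pM : plane R) (D b kappa : R).
Hypothesis alpha0 : 0 < alpha.
Hypothesis law : hitting_law pM D b kappa.

(** At distance D + delta the observable is 1 - (D + delta) `^ alpha: the excess
    over the distance D is of order delta `^ alpha if D = 0 and of order delta
    otherwise. *)
Definition shape : R := if D == 0 then b / alpha else b.

Lemma shape_gt0 : 0 < shape.
Proof. by have [b0 _ _ _ _] := law; rewrite /shape; case: ifP => // _; exact: divr_gt0. Qed.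

(** The derivative of s |-> (D `^ alpha + s) `^ alpha^-1 at 0 if D > 0. *)
Definition speed : R := if D == 0 then 1 else alpha^-1 * (D `^ alpha) `^ (alpha^-1 - 1).

Lemma speed_gt0 : 0 < speed.
Proof.
have [_ _ D0 _ _] := law; rewrite /speed; case: eqVneq => // Dn0.
by rewrite mulr_gt0 ?invr_gt0// powR_gt0// powR_gt0// lt_def Dn0.
Qed.

Definition scaling (n : nat) : R := speed * (kappa * n.+1%:R) `^ shape^-1.

Lemma scaling_gt0 n : 0 < scaling n.
Proof.
have [_ k0 _ _ _] := law.
by rewrite mulr_gt0 ?speed_gt0// powR_gt0// mulr_gt0.
Qed.

(** The increase of the distance from D that lowers the observable by s. *)
Definition excess (s : R) : R := (D `^ alpha + s) `^ alpha^-1 - D.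

Lemma excess_gt0 s : 0 < s -> 0 < excess s.
Proof.
move=> s0; have [_ _ D0 _ _] := law.
rewrite /excess subr_gt0 -[X in X < _](@powRK _ _ alpha D0) ?gt_eqF//.
by apply: gt0_ltr_powR; rewrite ?invr_gt0// ?nnegrE ?addr_ge0 ?powR_ge0 ?(ltW s0)// ltrDl.
Qed.

Lemma excessE s : 0 < s -> (D + excess s) `^ alpha = D `^ alpha + s.
Proof.
move=> s0; rewrite /excess addrC subrK powRVK ?gt_eqF//.
by rewrite addr_ge0 ?powR_ge0// ltW.
Qed.

Lemma cvg_scaling (t : R) : 0 < t ->
  n%:R * excess (t / scaling n) `^ b @[n --> \oo] --> t `^ shape / kappa.
Proof.
move=> t0; have [b0 k0 D0 _ _] := law; have sh0 := shape_gt0; have sp0 := speed_gt0.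
have s0 n : 0 < t / scaling n by rewrite divr_gt0// scaling_gt0.
have powE n : n%:R * (t / scaling n) `^ shape =
    (t `^ shape / kappa / speed `^ shape) * (n%:R / n.+1%:R).
  have k1 : 0 <= kappa * n.+1%:R by rewrite mulr_ge0// ltW.
  have sc : scaling n `^ shape = speed `^ shape * (kappa * n.+1%:R).
    by rewrite powRM ?powR_ge0 ?(ltW sp0)// powRVK ?gt_eqF.
  rewrite powRM ?(ltW t0) ?invr_ge0 ?(ltW (scaling_gt0 n))// powRV ?(ltW (scaling_gt0 n))// sc.
  have x0 : speed `^ shape != 0 by rewrite gt_eqF// powR_gt0.
  have y0 : (n.+1%:R : R) != 0 by rewrite pnatr_eq0.
  have z0 : kappa != 0 by rewrite gt_eqF.
  by move: (speed `^ _) (n.+1%:R) x0 y0 => x y x0 y0; field; rewrite x0 y0 z0.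
have cs : n%:R * (t / scaling n) `^ shape @[n --> \oo] -->
    t `^ shape / kappa / speed `^ shape.
  rewrite -[X in _ --> X]mulr1.
  have h : (t `^ shape / kappa / speed `^ shape) * (n%:R / n.+1%:R) @[n --> \oo] -->
    (t `^ shape / kappa / speed `^ shape) * 1.
    by apply: cvgMr; exact: cvg_n_over_succ.
  by apply: (cvg_near_eq _ h); apply: nearW => n; rewrite powE.
have [Dz|Dn0] := eqVneq D 0.
  have shE : shape = alpha^-1 * b by rewrite /shape Dz eqxx mulrC.
  have spE : speed = 1 by rewrite /speed Dz eqxx.
  rewrite spE powR1 divr1 in cs.
  apply: (cvg_near_eq _ cs); apply: nearW => n; congr (_ * _).
  by rewrite /excess Dz powR0 ?gt_eqF// add0r subr0 {1}shE powRrM.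
have shE : shape = b by rewrite /shape (negbTE Dn0).
have spE : speed = alpha^-1 * (D `^ alpha) `^ (alpha^-1 - 1).
  by rewrite /speed (negbTE Dn0).
have Dp : 0 < D by rewrite lt_def Dn0.
have s_to0 : t / scaling n @[n --> \oo] --> (0 : R).
  rewrite shE in cs; exact: cvg0_of_mulrn_powR b0 (fun n => ltW (s0 n)) cs.
have q := @cvg_quotient_powR R _ alpha^-1 _ (powR_gt0 alpha Dp) s0 s_to0.
rewrite -spE powRK ?gt_eqF// in q.
have qb : (excess (t / scaling n) / (t / scaling n)) `^ b @[n --> \oo] --> speed `^ b.
  exact: cvg_powR.
rewrite shE in cs *.
have h : (excess (t / scaling n) / (t / scaling n)) `^ b *
    (n%:R * (t / scaling n) `^ b) @[n --> \oo] -->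
    speed `^ b * (t `^ b / kappa / speed `^ b) by exact: cvgM.
rewrite (_ : t `^ b / kappa = speed `^ b * (t `^ b / kappa / speed `^ b)); last first.
  by rewrite [RHS]mulrC divfK// gt_eqF// powR_gt0.
apply: (cvg_near_eq _ h); apply: nearW => n /=.
rewrite mulrCA; congr (_ * _); rewrite -powRM ?divfK ?gt_eqF ?(ltW (s0 n))//.
by rewrite divr_ge0 ?ltW// excess_gt0.
Qed.

Lemma cvg_scaled_max (x : R) :
  nu [set t | scaling n * (partial_max (process (observable alpha pM)) n t -
    (1 - D `^ alpha)) <= x] @[n --> \oo] --> (weibull shape x)%:E.
Proof.
have [b0 k0 D0 HD lim] := law; have sh0 := shape_gt0.
have setE n : [set t | scaling n * (partial_max (process (observable alpha pM)) n t -
    (1 - D `^ alpha)) <= x] =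
  [set t | partial_max (process (observable alpha pM)) n t <=
     1 - (D `^ alpha - x / scaling n)].
  have eqv (y : R) : (scaling n * (y - (1 - D `^ alpha)) <= x) =
      (y <= 1 - (D `^ alpha - x / scaling n)).
    rewrite mulrC -ler_pdivlMr ?scaling_gt0//.
    by move: (x / _) (D `^ _) => u v; apply/idP/idP => ?; lra.
  by apply/seteqP; split => t /=; rewrite eqv.
under eq_fun do rewrite setE.
have mono n (u v : R) : (0 < n)%N -> u <= v ->
  [set t | partial_max (process (observable alpha pM)) n t <= u] `<=`
  [set t | partial_max (process (observable alpha pM)) n t <= v].
  by move=> n0 uv t /le_trans; apply.
rewrite /weibull; case: ltP => x0; last first.
  apply: (cvge_near_eq _ (cvg_cst 1%E)).
  near=> n; have n0 : (0 < n)%N by near: n; exact: nbhs_infty_gt.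
  rewrite (_ : [set t | _] = setT) ?nu_setT//.
  apply/seteqP; split => // t _; apply: (mono n (1 - D `^ alpha)) => //.
    by rewrite lerD2l lerN2 gerBl divr_ge0// ltW// scaling_gt0.
  apply/(partial_max_le _ _ _ n0) => i _; rewrite /process iter_thom.
  by apply/(observable_le _ _ alpha0 D0); exact: HD.
have t0 : 0 < - x by rewrite oppr_gt0.
have s0 n : 0 < - x / scaling n by rewrite divr_gt0// scaling_gt0.
have c0 : 0 < (- x) `^ shape / kappa by rewrite divr_gt0// powR_gt0.
have := lim _ _ (fun n => excess_gt0 (s0 n)) c0 (cvg_scaling t0).
rewrite mulrC divfK ?gt_eqF// => h.
have h' : (pr (avoid (hits pM (D + excess (- x / scaling n))) n))%:E
    @[n --> \oo] --> (expR (- ((- x) `^ shape)))%:E.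
  by apply/cvg_EFin => //; apply: nearW.
apply: (cvge_near_eq _ h').
near=> n; have n0 : (0 < n)%N by near: n; exact: nbhs_infty_gt.
have r0 : 0 <= D + excess (- x / scaling n).
  by rewrite (addr_ge0 D0)// ltW// excess_gt0.
by rewrite -(nu_partial_max pM alpha0 r0 n0) (excessE (s0 n)) mulNr.
Unshelve. all: by end_near. Qed.

End from_hitting_to_maxima.

(** * Convergence of types *)

Section convergence_of_types.
Variable R : realType.

Lemma weibull_lt (beta z z' : R) : 0 < beta -> z < 0 -> z < z' ->
  weibull beta z < weibull beta z'.
Proof.
move=> b0 z0 zz; rewrite /weibull z0.
have p0 : 0 < (- z) `^ beta by rewrite powR_gt0// oppr_gt0.
have [z'0|z'0] := ltP z' 0; last by rewrite expR_lt1 oppr_lt0.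
by rewrite ltr_expR ltrN2; apply: gt0_ltr_powR;
  rewrite // ?nnegrE ?oppr_ge0 ?ltrN2// ltW.
Qed.

Lemma weibullN (beta t : R) : 0 < t -> weibull beta (- t) = expR (- (t `^ beta)).
Proof. by move=> t0; rewrite /weibull oppr_lt0 t0 opprK. Qed.

(** The Weibull law is strictly increasing around z, so F n takes a value close
    to weibull beta z only at points close to z in the scale of the
    normalisation. *)
Lemma cvg_quantile (beta z : R) (F : nat -> R -> R) (a b v : R^nat) :
  0 < beta -> z < 0 -> (forall n, {homo F n : x y / x <= y}) ->
  (forall n, 0 < a n) ->
  (forall y, F n (b n + y / a n) @[n --> \oo] --> weibull beta y) ->
  F n (v n) @[n --> \oo] --> weibull beta z ->
  (v n - b n) * a n @[n --> \oo] --> z.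
Proof.
move=> b0 z0 monoF a0 Fw Fv; apply/cvgrPdist_lt => e e0.
have l1 : weibull beta (z - e) < weibull beta z.
  by apply: weibull_lt => //; [rewrite subr_lt0 (lt_trans z0)|rewrite gtrBl].
have l2 : weibull beta z < weibull beta (z + e).
  by apply: weibull_lt => //; rewrite ltrDl.
pose m1 := (weibull beta (z - e) + weibull beta z) / 2.
pose m2 := (weibull beta z + weibull beta (z + e)) / 2.
have a1 : weibull beta (z - e) < m1 by exact: (midf_lt l1).1.
have a2 : m1 < weibull beta z by exact: (midf_lt l1).2.
have a3 : weibull beta z < m2 by exact: (midf_lt l2).1.
have a4 : m2 < weibull beta (z + e) by exact: (midf_lt l2).2.
clearbody m1 m2.
near=> n.
have h1 : F n (b n + (z - e) / a n) < m1.
  by near: n; exact: (cvgr_lt _ (Fw (z - e)) _ a1).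
have h2 : m1 < F n (v n) by near: n; exact: (cvgr_gt _ Fv _ a2).
have h3 : F n (v n) < m2 by near: n; exact: (cvgr_lt _ Fv _ a3).
have h4 : m2 < F n (b n + (z + e) / a n).
  by near: n; exact: (cvgr_gt _ (Fw (z + e)) _ a4).
have k1 : b n + (z - e) / a n < v n.
  rewrite ltNge; apply/negP => /(monoF n) h.
  by have := le_lt_trans h (lt_trans h1 h2); rewrite ltxx.
have k2 : v n < b n + (z + e) / a n.
  rewrite ltNge; apply/negP => /(monoF n) h.
  by have := le_lt_trans h (lt_trans h3 h4); rewrite ltxx.
rewrite distrC ltr_distl; apply/andP; split.
  by rewrite -ltr_pdivrMr// ltrBrDl.
by rewrite -ltr_pdivlMr// ltrBlDl.
Unshelve. all: by end_near. Qed.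

(** The quantiles of both normalisations are affine functions of one another.
    Comparing three points of the generalised extreme value law with the points
    where the Weibull law takes the same values determines the tail index. *)
Lemma tail_index_unique (beta m s xi : R) (F : nat -> R -> R) (a b a' b' : R^nat) :
  0 < beta -> 0 < s -> (forall n, {homo F n : x y / x <= y}) ->
  (forall n, 0 < a n) -> (forall n, 0 < a' n) ->
  (forall y, F n (b n + y / a n) @[n --> \oo] --> weibull beta y) ->
  (forall y, F n (b' n + y / a' n) @[n --> \oo] --> gev m s xi y) ->
  - xi^-1 = beta.
Proof.
move=> b0 s0 monoF a0 a'0 Fw Fg.
(* The ratio in which y1 divides y0 and y2 is inherited by z0, z1 and z2. *)
have affine (y0 y1 y2 z0 z1 z2 : R) : y2 - y1 = 2 * (y1 - y0) ->
    z0 < 0 -> z1 < 0 -> z2 < 0 ->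
    gev m s xi y0 = weibull beta z0 -> gev m s xi y1 = weibull beta z1 ->
    gev m s xi y2 = weibull beta z2 -> z2 - z1 = 2 * (z1 - z0).
  move=> yE n0 n1 n2 e0 e1 e2.
  have q (y z : R) : z < 0 -> gev m s xi y = weibull beta z ->
     (b' n + y / a' n - b n) * a n @[n --> \oo] --> z.
    by move=> z0' e; apply: (cvg_quantile b0 z0' monoF a0 Fw); rewrite -e; exact: Fg.
  have c21 : (b' n + y2 / a' n - b n) * a n - (b' n + y1 / a' n - b n) * a n
     @[n --> \oo] --> z2 - z1 by apply: cvgB; exact: q.
  have c10 : 2 * ((b' n + y1 / a' n - b n) * a n - (b' n + y0 / a' n - b n) * a n)
     @[n --> \oo] --> 2 * (z1 - z0) by apply: cvgMr; apply: cvgB; exact: q.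
  have c21' : (b' n + y2 / a' n - b n) * a n - (b' n + y1 / a' n - b n) * a n
     @[n --> \oo] --> 2 * (z1 - z0).
    apply: (cvg_near_eq _ c10); apply: nearW => n.
    have -> : y2 = 3 * y1 - 2 * y0 by move: yE; clear; lra.
    by ring.
  exact: (cvg_unique _ c21 c21').
have [xi0|xi0] := eqVneq xi 0.
  (* With q = expR (- 1 / beta), the points m, m + s, m + 3 s give
     (1 - q) ^+ 2 * (q + 2) = 0, so the Gumbel law is excluded. *)
  have gE (k : R) : gev m s xi (m + k * s) = weibull beta (- expR (- k / beta)).
    rewrite (weibullN _ (expR_gt0 _)) -expRM (divfK (lt0r_neq0 b0)) /gev xi0 eqxx.
    by rewrite (_ : (m + k * s - m) / s = k)//; field; rewrite gt_eqF.
  have neg (k : R) : - expR (- k / beta) < 0 by rewrite oppr_lt0 expR_gt0.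
  have y3 : m + 3 * s - (m + 1 * s) = 2 * ((m + 1 * s) - (m + 0 * s)) by ring.
  have := affine _ _ _ _ _ _ y3 (neg 0) (neg 1) (neg 3) (gE 0) (gE 1) (gE 3).
  rewrite (_ : - 3 / beta = 3%:R * (- 1 / beta)); last by ring.
  rewrite expRM_natl oppr0 mul0r expR0.
  have q1 : expR (- 1 / beta) < 1.
    by rewrite expR_lt1 mulN1r oppr_lt0 invr_gt0.
  have := expR_gt0 (- 1 / beta); move: (expR _) q1 => q q1 q0 h.
  have : (1 - q) ^+ 2 * (q + 2) = 0 by move: h; rewrite !exprS expr0 => h; lra.
  have : 0 < (1 - q) ^+ 2 * (q + 2) by rewrite mulr_gt0 ?exprn_gt0//; lra.
  by move=> /[swap] ->; rewrite ltxx.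
have wE (w : R) : 0 < w -> gev m s xi (m + (w - 1) / xi * s) =
   weibull beta (- (w `^ (- xi^-1 / beta))).
  move=> w0; rewrite /gev (negbTE xi0).
  have -> : 1 + xi * ((m + (w - 1) / xi * s - m) / s) = w.
    by field; rewrite xi0 gt_eqF.
  by rewrite w0 (weibullN _ (powR_gt0 _ w0)) -powRrM (divfK (lt0r_neq0 b0)).
pose ga := - xi^-1 / beta.
have neg (w : R) : 0 < w -> - (w `^ ga) < 0 by move=> w0; rewrite oppr_lt0 powR_gt0.
(* The points where 1 + xi (y - m) / s is 1, 2 and 4 leave only two values for
   2 `^ ga, namely 2 and the excluded value 1. *)
have [p2 p4] : (0 < 2 :> R) /\ (0 < 4 :> R) by [].
have y3 : m + (4 - 1) / xi * s - (m + (2 - 1) / xi * s) =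
   2 * (m + (2 - 1) / xi * s - (m + (1 - 1) / xi * s)) by ring.
have := affine _ _ _ _ _ _ y3 (neg 1 ltr01) (neg 2 p2) (neg 4 p4)
  (wE 1 ltr01) (wE 2 p2) (wE 4 p4).
rewrite powR1 (_ : 4 = 2 * 2); last by ring.
rewrite powRM// => h.
have {h} /eqP : (2 `^ ga - 1) * (2 `^ ga - 2) = 0 by move: (2 `^ ga) h => t h; lra.
have l2 : 0 < ln 2 :> R by rewrite ln_gt0// ltr1n.
have lnE : ln (2 `^ ga) = ga * ln 2 by exact: ln_powR.
have gaE : - xi^-1 = ga * beta by rewrite divfK// gt_eqF.
rewrite mulf_eq0 !subr_eq0 => /orP[] /eqP t.
  move: lnE; rewrite t ln1 => /esym/eqP; rewrite mulf_eq0 (gt_eqF l2) orbF.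
  by rewrite mulf_eq0 oppr_eq0 !invr_eq0 (negbTE xi0) gt_eqF.
move: lnE; rewrite t -[LHS]mul1r => /(mulIf (lt0r_neq0 l2)) ga1.
by rewrite gaE -ga1 mul1r.
Qed.

Lemma tail_index_of_hitting_law (alpha D b kappa : R) (pM : plane R) :
  0 < alpha -> hitting_law pM D b kappa ->
  let X := process (observable alpha pM) in
  (exists xi : R, is_tail_index (@nu R) X xi) /\
  (forall xi : R, is_tail_index (@nu R) X xi -> - xi^-1 = shape alpha D b).
Proof.
move=> a0 law X; have sh0 := shape_gt0 a0 law.
have lim := cvg_scaled_max a0 law.
split.
  exists (- (shape alpha D b)^-1), (scaling alpha D b kappa), (fun=> 1 - D `^ alpha).
  exists (- 1), (shape alpha D b)^-1; split.
  - exact: scaling_gt0 a0 law.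
  - by rewrite invr_gt0.
  - by move=> x; rewrite gev_weibull//; exact: lim.
move=> xi [a' [b' [m [s [a'0 s0 Hg]]]]].
pose F n (u : R) : R :=
  if n == 0%N then 0 else fine (nu [set t | partial_max X n t <= u]).
have Fcvg (a c : R^nat) (x l : R) : (forall n, 0 < a n) ->
    nu [set t | a n * (partial_max X n t - c n) <= x] @[n --> \oo] --> l%:E ->
    F n (c n + x / a n) @[n --> \oo] --> l.
  move=> ap /fine_cvg H; apply: (cvg_near_eq _ H).
  near=> n; have n0 : (0 < n)%N by near: n; exact: nbhs_infty_gt.
  rewrite /F (gtn_eqF n0) /=; congr (fine (nu _)).
  have eqv (y : R) : (a n * (y - c n) <= x) = (y <= c n + x / a n).
    by rewrite mulrC -ler_pdivlMr// lerBlDl.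
  by apply/seteqP; split => t /=; rewrite eqv.
apply: (@tail_index_unique _ m s xi F (scaling alpha D b kappa)
  (fun=> 1 - D `^ alpha) a' b') => //.
- move=> n u v uv; rewrite /F; have [//|n0] := posnP n.
  have mu w := measurable_partial_max_le w pM a0 n0.
  apply: fine_le; [exact: nu_fin|exact: nu_fin|].
  apply: (@le_measure _ _ _ (@nu R)); [exact/mem_set|exact/mem_set|].
  by move=> t /= /le_trans; apply.
- exact: scaling_gt0 a0 law.
- by move=> y; apply: Fcvg; [exact: scaling_gt0 a0 law|exact: lim].
- by move=> y; apply: Fcvg => //; exact: Hg.
Unshelve. all: by end_near. Qed.

End convergence_of_types.

(** * Areas *)

Section areas.
Variable R : realType.
Notation leb := (@lebesgue_measure R).
Notation RR := (measurableTypeR R).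
Implicit Types E F : set (plane R).

Lemma lebesgue_affine (a c : R) (A : set RR) : a != 0 -> measurable A ->
  (leb A = `|a|%:E * leb ((fun x => (a * x + c)%R) @^-1` A))%E.
Proof.
move=> a0 mA; have [ap|an|] := ltgtP a 0.
- have na : 0 < - a by rewrite oppr_gt0.
  rewrite ltr0_norm//.
  have mA' := measurable_preim_affine (- a) c mA.
  rewrite (lebesgue_affine_gt0 c na mA); congr (_ * _)%E.
  rewrite -(lebesgue_measureN mA'); congr (leb _).
  by apply/seteqP; split => x /=; rewrite mulrNN.
- by rewrite gtr0_norm//; exact: lebesgue_affine_gt0.
- by move=> az; rewrite az eqxx in a0.
Qed.

Lemma measurable_affine2 (a1 c1 a2 c2 : R) E : measurable E ->
  measurable [set p : plane R | E (a1 * p.1 + c1, a2 * p.2 + c2)].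
Proof.
move=> mE; apply: (@measurable_preim _ (fun p => (a1 * p.1 + c1, a2 * p.2 + c2))) => //.
apply: measurable_mkplane.
  by apply: (@measurable_linE _ _ a1 0 c1) => p; ring.
by apply: (@measurable_linE _ _ 0 a2 c2) => p; ring.
Qed.

Lemma leb2_eq_xslice E F (c : R) : measurable E -> measurable F -> 0 < c ->
  (forall x, leb [set y | E (x, y)] = (c%:E * leb [set y | F (x, y)])%E) ->
  leb2 R E = (c%:E * leb2 R F)%E.
Proof.
move=> mE mF c0 EF; apply/eqP; rewrite eq_le; apply/andP; split.
  by apply: leb2_le_xslice => //; [exact: ltW|move=> x; rewrite EF].
have : (leb2 R F <= (c^-1)%:E * leb2 R E)%E.
  apply: leb2_le_xslice => //; first by rewrite invr_ge0 ltW.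
  by move=> x; rewrite EF muleA -EFinM mulVf ?gt_eqF// mul1e.
move=> h; have := lee_wpmul2l (ltW c0 : (0 <= c%:E)%E) h.
by rewrite muleA -EFinM mulfV ?gt_eqF// mul1e.
Qed.

Lemma leb2_eq_yslice E F (c : R) : measurable E -> measurable F -> 0 < c ->
  (forall y, leb [set x | E (x, y)] = (c%:E * leb [set x | F (x, y)])%E) ->
  leb2 R E = (c%:E * leb2 R F)%E.
Proof.
move=> mE mF c0 EF; apply/eqP; rewrite eq_le; apply/andP; split.
  by apply: leb2_le_yslice => //; [exact: ltW|move=> x; rewrite EF].
have : (leb2 R F <= (c^-1)%:E * leb2 R E)%E.
  apply: leb2_le_yslice => //; first by rewrite invr_ge0 ltW.
  by move=> x; rewrite EF muleA -EFinM mulVf ?gt_eqF// mul1e.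
move=> h; have := lee_wpmul2l (ltW c0 : (0 <= c%:E)%E) h.
by rewrite muleA -EFinM mulfV ?gt_eqF// mul1e.
Qed.

Definition area E : R := fine (leb2 R E).

(** The plane is stretched one coordinate at a time, slice by slice. *)
Lemma leb2_affine (a1 c1 a2 c2 : R) E : a1 != 0 -> a2 != 0 -> measurable E ->
  leb2 R E = ((`|a1| * `|a2|)%:E *
    leb2 R [set p | E ((a1 * p.1 + c1)%R, (a2 * p.2 + c2)%R)])%E.
Proof.
move=> a10 a20 mE.
have m1 := measurable_affine2 a1 c1 1 0 mE.
have m2 := measurable_affine2 a1 c1 a2 c2 mE.
rewrite EFinM -muleA.
transitivity (`|a1|%:E *
    leb2 R [set p : plane R | E ((a1 * p.1 + c1)%R, (1 * p.2 + 0)%R)])%E.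
  apply: (leb2_eq_yslice mE m1); first by rewrite normr_gt0.
  move=> y; rewrite (lebesgue_affine c1 a10 (measurable_yslice y mE)).
  by congr (_ * leb _)%E; apply/seteqP; split => x /=; rewrite mul1r addr0.
congr (_ * _)%E; apply: (leb2_eq_xslice m1 m2); first by rewrite normr_gt0.
move=> x; rewrite (lebesgue_affine c2 a20 (measurable_xslice x m1)).
by congr (_ * leb _)%E; apply/seteqP; split => y /=; rewrite mul1r addr0.
Qed.

Lemma area_affine (a1 c1 a2 c2 : R) E : a1 != 0 -> a2 != 0 -> measurable E ->
  area E = `|a1| * `|a2| * area [set p | E (a1 * p.1 + c1, a2 * p.2 + c2)].
Proof.
move=> a10 a20 mE; rewrite /area (leb2_affine c1 c2 a10 a20 mE).
set e := leb2 R _; have e0 : (0 <= e)%E by exact: measure_ge0.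
have p0 : 0 < `|a1| * `|a2| by rewrite mulr_gt0 ?normr_gt0.
by case: e e0 => [r|_|]//=; rewrite gt0_muley ?lte_fin ?mulr0.
Qed.

Definition rect (x0 x1 y0 y1 : R) : set (plane R) := `]x0, x1[ `*` `]y0, y1[.

Lemma leb2_rect (x0 x1 y0 y1 : R) : x0 < x1 -> y0 < y1 ->
  leb2 R (rect x0 x1 y0 y1) = ((x1 - x0) * (y1 - y0))%:E.
Proof.
move=> x01 y01; apply: etrans; first by apply: product_measure1E; exact: measurable_itv.
rewrite [X in (X * _)%E]lebesgue_measure_itv [X in (_ * X)%E]lebesgue_measure_itv/=.
by rewrite !lte_fin x01 y01 -!EFinB -EFinM.
Qed.

Lemma measurable_rect x0 x1 y0 y1 : measurable (rect x0 x1 y0 y1).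
Proof. by apply: measurableX; exact: measurable_itv. Qed.

Definition bounded_plane E :=
  exists r : R, 0 < r /\ E `<=` rect (- r) r (- r) r.

Lemma leb2_fin E : measurable E -> bounded_plane E -> leb2 R E \is a fin_num.
Proof.
move=> mE [r [r0 Er]]; rewrite ge0_fin_numE//.
apply: (@le_lt_trans _ _ (leb2 R (rect (- r) r (- r) r))).
  by apply: le_measure; rewrite ?inE//; exact: measurable_rect.
by rewrite leb2_rect ?ltry//; lra.
Qed.

Lemma areaK E : measurable E -> bounded_plane E -> (area E)%:E = leb2 R E.
Proof. by move=> mE bE; rewrite /area fineK// leb2_fin. Qed.

Lemma le_area E F : measurable E -> measurable F -> bounded_plane F ->
  E `<=` F -> area E <= area F.
Proof.
move=> mE mF bF EF; rewrite -lee_fin (areaK mF bF) areaK//.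
  by apply: le_measure; rewrite ?inE.
by case: bF => r [r0 Fr]; exists r; split => //; exact: subset_trans Fr.
Qed.

Lemma area_gt0 E x0 x1 y0 y1 : measurable E -> bounded_plane E ->
  x0 < x1 -> y0 < y1 -> rect x0 x1 y0 y1 `<=` E -> 0 < area E.
Proof.
move=> mE bE x01 y01 rE; apply: lt_le_trans (le_area _ mE bE rE).
  by rewrite /area leb2_rect//= mulr_gt0// subr_gt0.
exact: measurable_rect.
Qed.

Lemma measurable_neq0 (f : plane R -> R) : measurable_fun setT f ->
  measurable [set p : plane R | f p != 0].
Proof.
move=> mf; have m0 : measurable ([set x | x != 0] : set RR).
  rewrite (_ : [set x | _] = ~` [set 0]); first exact: measurableC.
  by apply/seteqP; split => x /eqP.
have mf' : measurable_fun setT (f : plane R -> RR) by [].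
by rewrite -[X in measurable X]setTI; exact: (mf' measurableT _ m0).
Qed.

Lemma leb_off_point (A B : set RR) (x : R) : measurable A -> B = A `\` [set x] ->
  leb B = (1%:E * leb A)%E.
Proof.
move=> mA ->; rewrite mul1e.
have mx : measurable ([set x] : set RR) by exact: measurable_set1.
rewrite [RHS](measureDI _ mA mx) [X in (_ + X)%E](_ : _ = 0%E) ?adde0//.
apply/eqP; rewrite eq_le measure_ge0 andbT -(lebesgue_measure_set1 x).
by apply: le_measure; rewrite ?inE; [exact: measurableI|exact: mx|exact: subIsetr].
Qed.

Lemma leb2_off_vline E : measurable E -> leb2 R (E `&` [set p | p.1 != 0]) = leb2 R E.
Proof.
move=> mE; rewrite -[RHS]mul1e; apply: leb2_eq_yslice => //.
  by apply: measurableI => //; apply: measurable_neq0; exact: measurable_coord1.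
move=> y; apply: (@leb_off_point _ _ 0); first exact: measurable_yslice.
by apply/seteqP; split => x /= [? /eqP].
Qed.

Lemma leb2_off_line E (k : R) : measurable E ->
  leb2 R (E `&` [set p | p.2 - k * p.1 != 0]) = leb2 R E.
Proof.
move=> mE; rewrite -[RHS]mul1e; apply: leb2_eq_xslice => //.
  apply: measurableI => //; apply: measurable_neq0.
  by apply: (@measurable_linE _ _ (- k) 1 0) => p; ring.
move=> x; apply: (@leb_off_point _ _ (k * x)); first exact: measurable_xslice.
by apply/seteqP; split => y /=; rewrite subr_eq0 => -[? /eqP].
Qed.

End areas.

(** * Hitting laws from areas *)

Section hitting_laws.
Variable R : realType.
Local Notation M := (@catM R).

(** Convergence along positive sequences, which is the form in which limits at 0
    are used. *)
Definition cvg_at0 (f : R -> R) (l : R) := forall delta : R^nat,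
  (forall n, 0 < delta n) -> delta n @[n --> \oo] --> (0 : R) ->
  f (delta n) @[n --> \oo] --> l.

Lemma cvg_power_sandwich (f : R -> R) (kappa b K d0 : R) : 0 <= kappa -> 0 < d0 ->
  (forall d, 0 < d < d0 -> 0 < 1 - K * d ->
    kappa * (d * (1 - K * d)) `^ b <= f d /\
    f d <= kappa * (d * (1 + K * d)) `^ b) -> 0 <= K ->
  cvg_at0 (fun d => f d / d `^ b) kappa.
Proof.
move=> k0 d00 fb K0 delta dp dc.
have Kd : K * delta n @[n --> \oo] --> (K * 0 : R) by exact: cvgMr.
rewrite mulr0 in Kd.
have lo : kappa * (1 - K * delta n) `^ b @[n --> \oo] --> kappa * (1 - 0) `^ b.
  apply: cvgMr; apply: cvg_powR; first by rewrite subr0.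
  by apply: cvgB; [exact: cvg_cst|exact: Kd].
have up : kappa * (1 + K * delta n) `^ b @[n --> \oo] --> kappa * (1 + 0) `^ b.
  apply: cvgMr; apply: cvg_powR; first by rewrite addr0.
  by apply: cvgD; [exact: cvg_cst|exact: Kd].
rewrite subr0 powR1 mulr1 in lo; rewrite addr0 powR1 mulr1 in up.
apply: (squeeze_cvgr _ lo up); near=> n.
have dn0 : delta n < d0 by near: n; exact: (cvgr_lt _ dc).
have Kn : K * delta n < 1 by near: n; exact: (cvgr_lt _ Kd _ ltr01).
have Kp : 0 < 1 - K * delta n by rewrite subr_gt0.
have dd : 0 < delta n < d0 by rewrite dp.
have [] := fb _ dd Kp.
have p0 : 0 < delta n `^ b by exact: powR_gt0.
have Kpos : 0 <= 1 + K * delta n by rewrite addr_ge0// mulr_ge0// ltW.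
rewrite !powRM ?(ltW (dp n)) ?(ltW Kp)// => h1 h2.
apply/andP; split.
  by rewrite ler_pdivlMr// -mulrA [_ `^ b * _]mulrC.
by rewrite ler_pdivrMr// -mulrA [_ `^ b * _]mulrC.
Unshelve. all: by end_near. Qed.

Lemma cvg_at0B (f g : R -> R) (k l : R) :
  cvg_at0 f k -> cvg_at0 g l -> cvg_at0 (fun d => f d - g d) (k - l).
Proof. by move=> fk gl delta dp dc; apply: cvgB; [exact: fk|exact: gl]. Qed.

(** The set A d is the target itself, or its set of escapes if visits come in
    runs; its measure, of density kappa, rules the law, while that of the target
    only has to vanish. *)
Lemma hitting_law_intro (pM : plane R) (D b kappa kappa' C : R)
    (A : R -> set (plane R)) :
  0 < b -> 0 < kappa -> 0 <= D -> (forall p, ~ hits pM D p) ->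
  (forall d, toral (A d)) -> (forall d, A d `<=` hits pM (D + d)) ->
  (forall d, hits pM (D + d) `\` M @^-1` hits pM (D + d) `<=` A d) ->
  (forall d v, modulus (A d) v <= C * (`|v.1| + `|v.2|)) ->
  cvg_at0 (fun d => pr (A d) / d `^ b) kappa ->
  cvg_at0 (fun d => pr (hits pM (D + d)) / d `^ b) kappa' ->
  (forall (delta : R^nat) (c : R), (forall n, 0 < delta n) ->
    n%:R * delta n `^ b @[n --> \oo] --> c -> no_clusters (A \o delta)) ->
  hitting_law pM D b kappa.
Proof.
move=> b0 k0 D0 HD tA AH HA modA limA limH nc.
split=> // delta c dp c0 dc.
have d0 : delta n @[n --> \oo] --> (0 : R).
  exact: cvg0_of_mulrn_powR b0 (fun n => ltW (dp n)) dc.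
have pne n : delta n `^ b != 0 by rewrite gt_eqF// powR_gt0.
have pA : n%:R * pr (A (delta n)) @[n --> \oo] --> kappa * c.
  have h : pr (A (delta n)) / delta n `^ b * (n%:R * delta n `^ b) @[n --> \oo] -->
    kappa * c by apply: cvgM => //; exact: limA.
  apply: (cvg_near_eq _ h); apply: nearW => n.
  by rewrite mulrCA divfK.
have pH : pr (hits pM (D + delta n)) @[n --> \oo] --> (0 : R).
  have h : pr (hits pM (D + delta n)) / delta n `^ b * delta n `^ b @[n --> \oo] -->
    kappa' * 0 by apply: cvgM; [exact: limH|exact: cvg0_of_mulrn dc].
  rewrite mulr0 in h; apply: (cvg_near_eq _ h); apply: nearW => n.
  by rewrite divfK.
apply: (@cvg_avoid_exit R (A \o delta) _ C _ (kappa * c) _ _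
  (fun n => hits pM (D + delta n))).
- by move=> n; exact: tA.
- by move=> n v; exact: modA.
- exact: pA.
- exact: nc dc.
- by move=> n; exact: toral_hits.
- by move=> n; exact: AH.
- by move=> n; exact: HA.
- exact: pH.
Qed.

End hitting_laws.

(** * Centres in the square *)

Section interior_point.
Variable R : realType.

Lemma modulus_hits (pM : plane R) rho v :
  modulus (hits pM rho) v <= 8 * (`|v.1| + `|v.2|).
Proof.
apply: (@le_trans _ _ (2 * (`|v.1| + `|v.2|))); last by rewrite ler_wpM2r ?addr_ge0// ler_nat.
apply: modulus_lift; [exact: measurable_target|exact: target_Lambda| |].
- exact: target_xitv.
- exact: target_yitv.
Qed.

Lemma pr_hits (pM : plane R) rho : pr (hits pM rho) = area (target pM (rho ^+ 2)).
Proof. exact/pr_lift/target_Lambda. Qed.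

Definition unit_disc : set (plane R) := [set p | p.1 ^+ 2 + p.2 ^+ 2 < 1].

Lemma measurable_unit_disc : measurable unit_disc.
Proof.
rewrite -[X in measurable X]setTI.
by apply: measurable_fun_ltr => //; apply: measurable_funD; apply: measurable_funX;
  [exact: measurable_coord1|exact: measurable_coord2].
Qed.

Lemma abs_lt_of_sqr (x y r : R) : 0 <= r -> x ^+ 2 + y ^+ 2 < r ^+ 2 -> `|x| < r.
Proof.
move=> r0 h; rewrite -(@ltr_pXn2r _ 2)// ?nnegrE// real_normK ?num_real//.
by apply: le_lt_trans h; rewrite lerDl sqr_ge0.
Qed.

Lemma unit_disc_bounded : bounded_plane unit_disc.
Proof.
exists 1; split => // p; rewrite /unit_disc/= => h; split; rewrite /= in_itv/= -ltr_norml.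
  by apply: (@abs_lt_of_sqr _ p.2) => //; rewrite expr1n.
by apply: (@abs_lt_of_sqr _ p.1) => //; rewrite expr1n addrC.
Qed.

Lemma area_unit_disc_gt0 : 0 < area unit_disc.
Proof.
apply: (@area_gt0 _ _ 0 2^-1 0 2^-1); rewrite ?invr_gt0//.
- exact: measurable_unit_disc.
- exact: unit_disc_bounded.
move=> p [/=]; rewrite !in_itv/= => /andP[x0 x1] /andP[y0 y1]; rewrite /unit_disc/=.
have : p.1 ^+ 2 < 2^-1 ^+ 2 by rewrite ltr_pXn2r ?nnegrE// ltW.
have : p.2 ^+ 2 < 2^-1 ^+ 2 by rewrite ltr_pXn2r ?nnegrE// ltW.
by rewrite exprVn; move: (p.1 ^+ 2) (p.2 ^+ 2) => u v; clear; lra.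
Qed.

Lemma area_disc (pM : plane R) (d : R) : 0 < d ->
  d < pM.1 < 1 - d -> d < pM.2 < 1 - d ->
  area (target pM (d ^+ 2)) = area unit_disc * d ^+ 2.
Proof.
move=> d0 /andP[x0 x1] /andP[y0 y1].
have dn0 : d != 0 by rewrite gt_eqF.
rewrite (area_affine pM.1 pM.2 dn0 dn0 (measurable_target _ _)) (gtr0_norm d0).
rewrite -expr2 mulrC; congr (area _ * _); apply/seteqP; split => p /=.
  move=> [_ /=]; rewrite !addrK !exprMn -mulrDr -[X in _ < X]mulr1.
  by rewrite ltr_pM2l// exprn_gt0.
move=> h; have hd : (d * p.1) ^+ 2 + (d * p.2) ^+ 2 < d ^+ 2.
  by rewrite !exprMn -mulrDr -[X in _ < X]mulr1 ltr_pM2l// exprn_gt0.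
split; last by rewrite /= !addrK.
have := abs_lt_of_sqr (ltW d0) hd; rewrite addrC in hd.
have := abs_lt_of_sqr (ltW d0) hd; rewrite !ltr_norml => /andP[? ?] /andP[? ?].
by split; rewrite /= in_itv/=; apply/andP; split; lra.
Qed.

Lemma interior_hitting_law (pM : plane R) : 0 < pM.1 < 1 -> 0 < pM.2 < 1 ->
  no_clusters_in 2 (@box R ^~ pM) -> hitting_law pM 0 2 (area unit_disc).
Proof.
move=> /andP[x0 x1] /andP[y0 y1] nc; have k0 := area_unit_disc_gt0.
pose d0 := Num.min (Num.min pM.1 (1 - pM.1)) (Num.min pM.2 (1 - pM.2)).
have d00 : 0 < d0 by rewrite /d0 !lt_min !subr_gt0 x0 x1 y0 y1.
have lim : cvg_at0 (fun d => pr (hits pM (0 + d)) / d `^ 2) (area unit_disc).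
  apply: (@cvg_power_sandwich _ _ _ _ 0 d0) => //; first exact: ltW.
  move=> d /andP[dp]; rewrite /d0 !lt_min => /andP[/andP[a1 a2] /andP[a3 a4]] _.
  have e : area (target pM (d ^+ 2)) = area unit_disc * d ^+ 2.
    by apply: area_disc => //; apply/andP; split=> //; rewrite ltrBrDr addrC -ltrBrDr.
  rewrite mul0r subr0 addr0 mulr1 add0r pr_hits (powR_mulrn 2 (ltW dp)) e.
  by split.
apply: (@hitting_law_intro _ _ _ _ _ (area unit_disc) 8 (fun d => hits pM (0 + d))) => //.
- by move=> p [_]; rewrite expr0n/= ltNge addr_ge0// sqr_ge0.
- by move=> d; exact: toral_hits.
- by move=> d p [].
- by move=> d v; exact: modulus_hits.
move=> delta c dp dc; apply: (nc delta _ c) => //.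
- by move=> n; exact: toral_hits.
- by move=> n; exact: ltW.
- apply: (cvg_near_eq _ dc); apply: nearW => n.
  by rewrite powR_mulrn// ltW.
apply: nearW => n p [_]; rewrite /= add0r => h; split.
  by have := abs_lt_of_sqr (ltW (dp n)) h => /ltW.
by rewrite addrC in h; have := abs_lt_of_sqr (ltW (dp n)) h => /ltW.
Qed.

End interior_point.

(** * The area of a cap *)

Section beside_the_square.
Variable R : realType.

Lemma area_swap (E : set (plane R)) : measurable E ->
  area [set p | E (p.2, p.1)] = area E.
Proof.
by move=> mE; rewrite /area [in RHS](leb2_ysection mE).
Qed.

Section parabolic_cap.
Variable D : R.
Hypothesis D0 : 0 < D.

(** The disc of radius D + c around (- D, 0) leaves in the half-plane 0 < p.1 a
    cap of depth c. Its equation differs from that of parab D c by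
    c ^+ 2 - p.1 ^+ 2 only, which is of second order in c. *)
Definition parab (c : R) : set (plane R) :=
  [set p | 0 < p.1 /\ 2 * D * p.1 + p.2 ^+ 2 < 2 * D * c].

Lemma measurable_pos1 : measurable [set p : plane R | 0 < p.1].
Proof.
by rewrite -[X in measurable X]setTI; apply: measurable_fun_ltr.
Qed.

Lemma measurable_parab c : measurable (parab c).
Proof.
apply: measurableI; first exact: measurable_pos1.
rewrite -[X in measurable X]setTI; apply: measurable_fun_ltr => //.
apply: measurable_funD; last by apply: measurable_funX; exact: measurable_coord2.
by apply: (@measurable_linE _ _ (2 * D) 0 0) => p; ring.
Qed.

Lemma parab_bound c p : parab c p -> p.1 < c /\ p.2 ^+ 2 < 2 * D * c.
Proof.
move=> [w0 h]; have D2 : 0 < 2 * D by rewrite mulr_gt0.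
split; last by apply: le_lt_trans h; rewrite lerDr mulr_ge0// ltW.
by rewrite -(ltr_pM2l D2); apply: le_lt_trans h; rewrite lerDl sqr_ge0.
Qed.

Lemma parab_bounded c : bounded_plane (parab c).
Proof.
exists (1 + `|c| + `|2 * D * c|); split; first by rewrite -addrA ltr_wpDr ?addr_ge0.
move=> p Tp; have [w0 _] := Tp; have [h1 h2] := parab_bound Tp.
have := ler_norm c; have := ler_norm (2 * D * c).
have := normr_ge0 c; have := normr_ge0 (2 * D * c).
move: h2; move: (2 * D * c) => u; move: `|u| => v h2 v0 c0 uv cc.
have t2 : `|p.2| < 1 + v.
  rewrite -(@ltr_pXn2r _ 2)// ?nnegrE ?addr_ge0// real_normK ?num_real//.
  apply: (lt_trans h2); rewrite sqrrD expr1n mul1r; have := sqr_ge0 v.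
  by move: (v ^+ 2) v0 uv => v2; clear; lra.
move: t2; rewrite ltr_norml => /andP[? ?].
by split; rewrite /= in_itv/=; apply/andP; split; lra.
Qed.

(** The parabolic caps are all images of one of them, with depth multiplied by
    c and width by sqrt c. *)
Lemma area_parab (c : R) : 0 < c -> area (parab c) = area (parab 1) * c `^ (3 / 2).
Proof.
move=> c0; have s0 : 0 < Num.sqrt c by rewrite sqrtr_gt0.
have [cn0 sn0] : c != 0 /\ Num.sqrt c != 0 by rewrite !gt_eqF.
have e : [set p | parab c (c * p.1 + 0, Num.sqrt c * p.2 + 0)] = parab 1.
  apply/seteqP; split => p; rewrite /parab/= !addr0 (pmulr_rgt0 _ c0) exprMn sqr_sqrtr ?(ltW c0)//.
    move=> [-> h]; split=> //; rewrite -(ltr_pM2l c0); move: h.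
    by rewrite mulrDr mulr1 mulrCA [c * (2 * D)]mulrC.
  move=> [-> h]; split=> //; move: h; rewrite -(ltr_pM2l c0).
  by rewrite mulrDr mulr1 mulrCA [c * (2 * D)]mulrC.
rewrite (area_affine 0 0 cn0 sn0 (measurable_parab c)) (gtr0_norm c0) (gtr0_norm s0).
rewrite e [LHS]mulrC; congr (_ * _).
rewrite (_ : 3 / 2 = 1 + 2^-1); last by field.
rewrite powRD; last by apply/implyP.
by rewrite powRr1 ?(ltW c0)// powR12_sqrt// ltW.
Qed.

Lemma area_parab_gt0 : 0 < area (parab 1).
Proof.
have s0 : 0 < Num.sqrt D by rewrite sqrtr_gt0.
apply: (@area_gt0 _ _ 0 4^-1 0 (Num.sqrt D)); rewrite ?invr_gt0//.
- exact: measurable_parab.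
- exact: parab_bounded.
move=> p [/=]; rewrite !in_itv/= => /andP[x0 x1] /andP[y0 y1]; split => //.
have y2 : p.2 ^+ 2 < D by rewrite -[X in _ < X]sqr_sqrtr ?(ltW D0)// ltr_pXn2r ?nnegrE ?ltW.
have x2 : D * p.1 < D * 4^-1 by rewrite ltr_pM2l.
rewrite mulr1 -mulrA; move: (p.2 ^+ 2) y2 (D * p.1) x2 => u hu w hw.
by move: D0 hu hw; clear; lra.
Qed.

(** Write d for the excess of the radius. The circular cap lies between the
    parabolic caps of depths d and d + d ^+ 2 / (2 D), the line 0 = p.1 being
    negligible. *)
Lemma cvg_area_cap (V : R -> set (plane R)) (d0 : R) : 0 < d0 ->
  (forall d, measurable (V d)) ->
  (forall d p, 0 < d < d0 -> 0 < p.1 -> (p.1 + D) ^+ 2 + p.2 ^+ 2 < (D + d) ^+ 2 ->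
    V d p) ->
  (forall d p, 0 < d < d0 -> V d p ->
    0 <= p.1 /\ (p.1 + D) ^+ 2 + p.2 ^+ 2 < (D + d) ^+ 2) ->
  cvg_at0 (fun d => area (V d) / d `^ (3 / 2)) (area (parab 1)).
Proof.
move=> d00 mV inV Vin; have k0 := area_parab_gt0; have D2 : 0 < 2 * D by rewrite mulr_gt0.
have i0 : 0 <= (2 * D)^-1 by rewrite invr_ge0 ltW.
apply: (@cvg_power_sandwich _ _ _ _ (2 * D)^-1 d0) => //; first exact: ltW.
move=> d dd Kd; have /andP[dp _] := dd.
pose c := d * (1 + (2 * D)^-1 * d).
have c0 : 0 < c by rewrite mulr_gt0// ltr_wpDr// mulr_ge0// ltW.
have cE : 2 * D * c = 2 * D * d + d ^+ 2 by rewrite /c; field; rewrite gt_eqF.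
have sub : V d `&` [set p | p.1 != 0] `<=` parab c.
  move=> p [/(Vin _ _ dd)[w0 h] wn0]; split; first by rewrite lt_def wn0.
  have w2 := sqr_ge0 p.1; rewrite cE.
  move: h w2; rewrite !sqrrD -!mulrA !mulr_natl [p.1 * D]mulrC.
  move: (p.1 ^+ 2) (p.2 ^+ 2) (d ^+ 2) (D * d) (D * p.1) (D ^+ 2) => u v w x y z.
  by clear; lra.
have mV' : measurable (V d `&` [set p | p.1 != 0]).
  by apply: measurableI => //; apply: measurable_neq0; exact: measurable_coord1.
have up : area (V d) <= area (parab c).
  rewrite /area -(leb2_off_vline (mV d)).
  by apply: le_area => //; [exact: measurable_parab|exact: parab_bounded].
have bV : bounded_plane (V d).
  have r0 : 0 < D + d by rewrite addr_gt0.
  exists (D + d); split => // p /(Vin _ _ dd)[w0 h].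
  have := abs_lt_of_sqr (ltW r0) h; rewrite addrC in h.
  have := abs_lt_of_sqr (ltW r0) h; rewrite !ltr_norml => h2 /andP[_ h1].
  split; rewrite /= in_itv/=; last exact: h2.
  apply/andP; split; first by apply: lt_le_trans w0; rewrite oppr_lt0.
  by apply: le_lt_trans h1; rewrite lerDl ltW.
have lo : area (parab d) <= area (V d).
  apply: le_area => //; first exact: measurable_parab.
  move=> p Tp; have [w0 h] := Tp; have [wd _] := parab_bound Tp.
  apply: inV => //; have : p.1 ^+ 2 < d ^+ 2 by rewrite ltr_pXn2r ?nnegrE ?ltW.
  rewrite !sqrrD; move: h; rewrite -!mulrA !mulr_natl [p.1 * D]mulrC.
  move: (p.1 ^+ 2) (p.2 ^+ 2) (d ^+ 2) (D * d) (D * p.1) (D ^+ 2) => u v w x y z.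
  by clear; lra.
split; last by rewrite -(area_parab c0).
apply: le_trans lo; rewrite (area_parab dp); apply: (ler_wpM2l (ltW k0)).
apply: ge0_ler_powR; rewrite ?nnegrE ?divr_ge0 ?(ltW dp)//.
  by rewrite mulr_ge0 ?ltW.
by rewrite ler_piMr ?(ltW dp)// gerBl mulr_ge0// ltW.
Qed.

End parabolic_cap.

End beside_the_square.

(** * Centres in front of a side *)

Section side_point.
Variable R : realType.

(** The coordinate i is the one in which the centre is outside the square, so
    that both orientations of the side are treated at once. *)
Definition coord (i : bool) (p : plane R) : R := if i then p.1 else p.2.

Definition of_coords (i : bool) (x y : R) : plane R := if i then (x, y) else (y, x).

Lemma LambdaE i (p : plane R) :
  Lambda p <-> (0 <= coord i p < 1) /\ (0 <= coord (~~ i) p < 1).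
Proof.
by case: i; split=> [[/=]|[/= h1 h2]]; rewrite ?in_itv/=; [move=> ? ?; split|split..];
  rewrite /= ?in_itv.
Qed.

Lemma target_coord i (pM p : plane R) r : target pM r p <->
  [/\ 0 <= coord i p < 1, 0 <= coord (~~ i) p < 1 &
     (coord i p - coord i pM) ^+ 2 + (coord (~~ i) p - coord (~~ i) pM) ^+ 2 < r].
Proof.
rewrite /target/= (LambdaE i); case: i => /=.
  by split=> [[[]]|[]].
by rewrite [(p.2 - _) ^+ 2 + _]addrC; split=> [[[]]|[]].
Qed.

Lemma coord_of_coords i (x y : R) :
  coord i (of_coords i x y) = x /\ coord (~~ i) (of_coords i x y) = y.
Proof. by case: i. Qed.

Lemma coord_tor i (p : plane R) : coord i (tor p) = frac (coord i p).
Proof. by case: i. Qed.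

Lemma area_of_coords i (s c y : R) (E : set (plane R)) : `|s| = 1 -> measurable E ->
  let V := [set p : plane R | E (of_coords i (s * p.1 + c) (1 * p.2 + y))] in
  measurable V /\ area V = area E.
Proof.
move=> s1 mE V; have sn0 : s != 0 by rewrite -normr_eq0 s1 oner_eq0.
pose E' := if i then E else [set p : plane R | E (p.2, p.1)].
have mE' : measurable E'.
  rewrite /E'; case: (i) => //.
  apply: (@measurable_preim _ (fun p : plane R => (p.2, p.1) : plane R)) => //.
  by apply: measurable_mkplane; [exact: measurable_coord2|exact: measurable_coord1].
have aE' : area E' = area E by rewrite /E'; case: (i); [|exact: area_swap].
have VE : V = [set p : plane R | E' (s * p.1 + c, 1 * p.2 + y)].
  by rewrite /V /E'; case: (i).
rewrite VE; split; first exact: measurable_affine2.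
by rewrite -aE' (area_affine c y sn0 (oner_neq0 R) mE') s1 normr1 !mul1r.
Qed.

Lemma cap_bound (D d w t : R) : 0 < D -> 0 <= w -> 0 < d <= 1 ->
  (w + D) ^+ 2 + t ^+ 2 < (D + d) ^+ 2 -> w < d /\ t ^+ 2 < (2 * D + 1) * d.
Proof.
move=> D0 w0 /andP[d0 d1] h; split.
  have : w + D < D + d.
    have [? ?] : 0 <= w + D /\ 0 <= D + d by split; rewrite addr_ge0// ltW.
    rewrite -(@ltr_pXn2r _ 2)//.
    by apply: le_lt_trans h; rewrite lerDl sqr_ge0.
  by rewrite addrC ltrD2l.
have hw : D ^+ 2 <= (w + D) ^+ 2.
  by rewrite ler_pXn2r ?nnegrE ?addr_ge0 ?lerDr// ltW.
have hd : d ^+ 2 <= d by rewrite expr2 ler_piMr// ltW.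
have e : (D + d) ^+ 2 = D ^+ 2 + 2 * D * d + d ^+ 2 by ring.
have e' : (2 * D + 1) * d = 2 * D * d + d by ring.
rewrite e in h; rewrite e'; move: h hw hd.
move: (D ^+ 2) (2 * D * d) (d ^+ 2) ((w + D) ^+ 2) (t ^+ 2) => a1 a2 a3 a4 a5.
by clear; lra.
Qed.

(** The side has equation coord i p = c, the square is on the side of the sign s,
    and the centre is at distance D. *)
Section facing_a_side.
Variables (i : bool) (s c D : R) (pM : plane R).
Hypothesis side : (s = 1 /\ c = 0) \/ (s = -1 /\ c = 1).
Hypothesis D0 : 0 < D.
Hypothesis pMi : coord i pM = c - s * D.
Hypothesis pMj : 0 < coord (~~ i) pM < 1.
Let y := coord (~~ i) pM.

Let s1 : `|s| = 1.
Proof. by case: side => [[-> _]|[-> _]]; rewrite ?normrN normr1. Qed.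

Let depth (x : R) : (x - coord i pM) ^+ 2 = (s * (x - c) + D) ^+ 2.
Proof. by rewrite pMi; case: side => [[-> ->]|[-> ->]]; ring. Qed.

Let depth_ge0 (x : R) : 0 <= x < 1 -> 0 <= s * (x - c).
Proof. by move=> /andP[x0 x1]; case: side => [[-> ->]|[-> ->]]; lra. Qed.

Let depth_inside (w : R) : 0 < w < 1 -> 0 <= s * w + c < 1.
Proof. by move=> /andP[w0 w1]; case: side => [[-> ->]|[-> ->]]; apply/andP; split; lra. Qed.

Let depthK (w : R) : s * (s * w + c - c) = w.
Proof. by case: side => [[-> ->]|[-> ->]]; ring. Qed.

(** At depth w and height t in the cap, w < d and t ^+ 2 < (2 D + 1) d. *)
Lemma hits_side_box (d : R) : 0 < d <= 1 ->
  hits pM (D + d) `<=` side_box (coord i) (coord (~~ i)) (Num.sqrt ((2 * D + 1) * d)) y.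
Proof.
move=> d01 p /(target_coord i) [x01 y01]; rewrite depth => h.
have w0 := depth_ge0 x01; have [wd t2] := cap_bound D0 w0 d01 h.
have /andP[d0 _] := d01.
have k0 : 0 <= (2 * D + 1) * d by rewrite mulr_ge0 ?addr_ge0 ?mulr_ge0// ltW.
split; last first.
  rewrite -coord_tor -(@ler_pXn2r _ 2)// ?nnegrE ?sqrtr_ge0//.
  by rewrite sqr_sqrtr// real_normK ?num_real// ltW.
rewrite sqr_sqrtr// /near0/= -coord_tor.
have dk : d <= (2 * D + 1) * d by rewrite ler_peMl ?ltW// ltrDr mulr_gt0.
move: dk wd; move: ((2 * D + 1) * d) (coord i _) => k x dk.
by case: side => [[-> ->]|[-> ->]] wd; [left|right]; lra.
Qed.

(** For small d the cap stays away from the ends of the side. *)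
Lemma side_hitting_law :
  no_clusters_in 3 (side_box (coord i) (coord (~~ i)) ^~ y) ->
  hitting_law pM D (3 / 2) (area (parab D 1)).
Proof.
move=> nc; have k0 := area_parab_gt0 D0.
pose V d := [set p : plane R | target pM ((D + d) ^+ 2)
  (of_coords i (s * p.1 + c) (1 * p.2 + y))].
have VE d p : V d p <-> [/\ 0 <= s * p.1 + c < 1, 0 <= p.2 + y < 1 &
    (p.1 + D) ^+ 2 + p.2 ^+ 2 < (D + d) ^+ 2].
  rewrite /V/= (target_coord i) !(coord_of_coords _ _ _).1 !(coord_of_coords _ _ _).2.
  by rewrite depth depthK mul1r -/y addrK.
have K1 : 0 < 2 * D + 1 by rewrite addr_gt0// mulr_gt0.
pose m := Num.min y (1 - y); have m0 : 0 < m by rewrite lt_min subr_gt0.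
pose d0 := Num.min 1 (m ^+ 2 / (2 * D + 1)).
have d00 : 0 < d0 by rewrite lt_min ltr01 divr_gt0// exprn_gt0.
have lim : cvg_at0 (fun d => pr (hits pM (D + d)) / d `^ (3 / 2)) (area (parab D 1)).
  have aV d : measurable (V d) /\ area (V d) = area (target pM ((D + d) ^+ 2)).
    by apply: area_of_coords => //; exact: measurable_target.
  have -> : (fun d => pr (hits pM (D + d)) / d `^ (3 / 2)) =
      (fun d => area (V d) / d `^ (3 / 2)).
    by apply/funext => d; rewrite pr_hits (aV d).2.
  apply: (cvg_area_cap D0 d00) => [d|d p|d p].
  - exact: (aV d).1.
  - rewrite lt_min => /and3P[dp d1 dm] w0 h; apply/VE.
    have d01 : 0 < d <= 1 by rewrite dp ltW.
    have [wd t2] := cap_bound D0 (ltW w0) d01 h.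
    have tm : `|p.2| < m.
      rewrite -(@ltr_pXn2r _ 2)// ?nnegrE ?(ltW m0)// real_normK ?num_real//.
      by apply: (lt_trans t2); rewrite mulrC -ltr_pdivlMr.
    split => //; first by apply: depth_inside; rewrite w0 (lt_trans wd).
    move: tm; rewrite lt_min !ltr_norml => /andP[/andP[h1 _] /andP[_ h2]].
    apply/andP; split; first by move: h1; lra.
    by move: h2; lra.
  - move=> _ /VE[x01 _ h]; split => //.
    by rewrite -(depthK p.1); exact: depth_ge0.
apply: (@hitting_law_intro _ _ _ _ _ (area (parab D 1)) 8 (fun d => hits pM (D + d))) => //.
- exact: ltW.
- move=> p /(target_coord i) [x01 _]; rewrite depth; apply/negP; rewrite -leNgt.
  apply: (@le_trans _ _ ((s * (coord i (tor p) - c) + D) ^+ 2)).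
    by rewrite ler_pXn2r ?nnegrE ?addr_ge0 ?depth_ge0 ?(ltW D0)// lerDr depth_ge0.
  by rewrite lerDl sqr_ge0.
- by move=> d; exact: toral_hits.
- by move=> d p [].
- by move=> d v; exact: modulus_hits.
move=> delta k dp dk.
apply: (nc (fun n => Num.sqrt ((2 * D + 1) * delta n)) _ ((2 * D + 1) `^ (3 / 2) * k)).
- by move=> n; exact: toral_hits.
- by move=> n; exact: sqrtr_ge0.
- have h : (2 * D + 1) `^ (3 / 2) * (n%:R * delta n `^ (3 / 2)) @[n --> \oo] -->
    (2 * D + 1) `^ (3 / 2) * k by exact: cvgMr.
  apply: (cvg_near_eq _ h); apply: nearW => n.
  have p0 : 0 <= (2 * D + 1) * delta n by rewrite mulr_ge0// ltW.
  rewrite -powR12_sqrt// -powR_mulrn ?powR_ge0// -powRrM.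
  by rewrite [2^-1 * _]mulrC powRM ?(ltW K1) ?(ltW (dp n))// mulrCA.
have d0c : delta n @[n --> \oo] --> (0 : R).
  by apply: (cvg0_of_mulrn_powR _ (fun n => ltW (dp n)) dk).
near=> n; apply: hits_side_box; rewrite dp /= ltW//.
by near: n; exact: (cvgr_lt _ d0c _ ltr01).
Unshelve. all: by end_near. Qed.

End facing_a_side.

End side_point.

(** * Orbits near the fixed point *)

Section corner_returns.
Variable R : realType.
Local Notation M := (@catM R).
Local Notation Mi := (@catMi R).

Definition lattice (v : plane R) := exists i j : int, v = (i%:~R, j%:~R).

Lemma lattice_catM v : lattice v -> lattice (M v).
Proof.
move=> [i [j ->]]; exists (2 * i + j), (i + j).
by rewrite /catM/= !intrD intrM.
Qed.

Lemma lattice_catMi v : lattice v -> lattice (Mi v).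
Proof.
move=> [i [j ->]]; exists (i - j), (2 * j - i).
by rewrite /catMi/= !intrB intrM.
Qed.

Lemma lattice_iter (f : plane R -> plane R) n v :
  (forall w, lattice w -> lattice (f w)) -> lattice v -> lattice (iter n f v).
Proof. by move=> fl lv; elim: n => // n IH; rewrite iterS; exact: fl. Qed.

Lemma int_small (i : int) : `|i%:~R : R| < 1 -> i = 0.
Proof. by rewrite -intr_norm -[1 in X in X -> _]/(1%:~R) ltr_int; lia. Qed.

Lemma lattice_small v : lattice v -> `|v.1| < 1 -> `|v.2| < 1 -> v = (0, 0).
Proof. by move=> [i [j ->]] /= /int_small -> /int_small ->. Qed.

Lemma coord_le_eigen (v : plane R) :
  `|v.1| <= `|unst v| + `|stab v| /\ `|v.2| <= `|unst v| + `|stab v|.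
Proof.
have p1 := phi_gt1 R; have p2 := phi_lt2 R.
have N0 : 0 < phi R ^+ 2 + 1 by rewrite ltr_wpDl ?sqr_ge0.
have e1 : (phi R ^+ 2 + 1) * v.1 = phi R * unst v + stab v.
  by rewrite /unst /stab; ring.
have e2 : (phi R ^+ 2 + 1) * v.2 = unst v - phi R * stab v.
  by rewrite /unst /stab; ring.
have N2 : phi R ^+ 2 + 1 = phi R + 2 by rewrite phi2; ring.
split; rewrite -(ler_pM2l N0) -{1}(gtr0_norm N0) -normrM ?e1 ?e2.
  apply: (le_trans (ler_normD _ _)); rewrite normrM (gtr0_norm (lt_trans ltr01 p1)) N2.
  move: (normr_ge0 (unst v)) (normr_ge0 (stab v)) p1 p2.
  by move: `|_| `|_| (phi R) => s u f; nra.
apply: (le_trans (ler_normB _ _)); rewrite normrM (gtr0_norm (lt_trans ltr01 p1)) N2.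
move: (normr_ge0 (unst v)) (normr_ge0 (stab v)) p1 p2.
by move: `|_| `|_| (phi R) => s u f; nra.
Qed.

Lemma eigen_le_coord (v : plane R) :
  `|unst v| <= 2 * (`|v.1| + `|v.2|) /\ `|stab v| <= 2 * (`|v.1| + `|v.2|).
Proof.
have p1 := phi_gt1 R; have p2 := phi_lt2 R.
split; [apply: (le_trans (ler_normD _ _))|apply: (le_trans (ler_normB _ _))];
  rewrite normrM (gtr0_norm (lt_trans ltr01 p1));
  move: (normr_ge0 v.1) (normr_ge0 v.2) p1 p2;
  move: `|v.1| `|v.2| (phi R) => s t f; nra.
Qed.

(** Two small points are related by an iterate modulo the lattice only if they
    are related by it exactly: half of the iterate is undone on the end point,
    so that no eigendirection is stretched by more than lam ^+ j1 or lam ^+ j2. *)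
Lemma small_return_exact (x x' z : plane R) (j1 j2 : nat) (e : R) :
  lattice z -> x' = trans z (iter (j1 + j2) M x) ->
  `|x.1| <= e -> `|x.2| <= e -> `|x'.1| <= e -> `|x'.2| <= e ->
  lam R ^+ j1 * e < 17^-1 -> lam R ^+ j2 * e < 17^-1 ->
  x' = iter (j1 + j2) M x.
Proof.
move=> lz x'E h1 h2 h1' h2' s1 s2.
pose y := iter j2 Mi x'.
have yE : y = trans (iter j2 Mi z) (iter j1 M x).
  rewrite /y x'E iter_trans; last exact: catMi_trans.
  by congr trans; rewrite addnC iterD iter_catMK.
have x'y : x' = iter j2 M y by rewrite /y iter_catMiK.
have l1 : 1 < lam R by apply: lt_trans (lam_gt2 R); rewrite ltr1n.
have lge n : 1 <= lam R ^+ n by rewrite exprn_ege1// ltW.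
have lp n : 0 < lam R ^+ n by exact: lt_le_trans (lge n).
have e0 : 0 <= e by exact: le_trans h1.
have [u1 v1] := eigen_le_coord x; have [u2 v2] := eigen_le_coord x'.
have c1 : `|unst x| <= 4 * e by lra.
have c2 : `|stab x| <= 4 * e by lra.
have c3 : `|unst x'| <= 4 * e by lra.
have c4 : `|stab x'| <= 4 * e by lra.
pose z0 := iter j2 Mi z.
have uz : unst z0 = unst y - lam R ^+ j1 * unst x.
  by rewrite -unst_iter yE /unst/trans/=; ring.
have sz : stab z0 = stab y - lam R ^- j1 * stab x.
  by rewrite -stab_iter yE /stab/trans/=; ring.
have uy : `|unst y| <= 4 * e.
  apply: le_trans c3; rewrite x'y unst_iter normrM ger0_norm ?(ltW (lp _))//.
  by rewrite ler_peMl.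
have sy : `|stab y| <= lam R ^+ j2 * (4 * e).
  rewrite (_ : stab y = lam R ^+ j2 * stab x').
    by rewrite normrM ger0_norm ?(ltW (lp _))// ler_wpM2l// ltW.
  by rewrite x'y stab_iter mulrA mulfV ?mul1r// gt_eqF.
have ux : `|lam R ^+ j1 * unst x| <= lam R ^+ j1 * (4 * e).
  by rewrite normrM ger0_norm ?(ltW (lp _))// ler_wpM2l// ltW.
have sx : `|lam R ^- j1 * stab x| <= 4 * e.
  apply: le_trans c2; rewrite normrM ger0_norm ?invr_ge0 ?(ltW (lp _))//.
  by rewrite ler_piMl// invf_le1.
have es : e < 17^-1 by apply: le_lt_trans s1; rewrite ler_peMl.
(* Each term is at most 4 e + 4 / 17, and e < 1 / 17: the sum is below 16 / 17. *)
have nz : `|unst z0| + `|stab z0| < 1.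
  have n1 : `|unst z0| <= 4 * e + lam R ^+ j1 * (4 * e).
    by rewrite uz; apply: (le_trans (ler_normB _ _)); apply: lerD.
  have n2 : `|stab z0| <= lam R ^+ j2 * (4 * e) + 4 * e.
    by rewrite sz; apply: (le_trans (ler_normB _ _)); apply: lerD.
  move: n1 n2; rewrite ![_ * (4 * e)]mulrCA; move: s1 s2 es.
  move: (_ * e) (_ * e) `|_| `|_| => b a v u; clear; lra.
have [w1 w2] := coord_le_eigen z0.
have lz0 : lattice z0 by apply: lattice_iter => //; exact: lattice_catMi.
have zE := lattice_small lz0 (le_lt_trans w1 nz) (le_lt_trans w2 nz).
rewrite addnC iterD x'y; congr iter; rewrite yE -/z0 zE /trans/= !addr0.
by case: (iter _ _ _).
Qed.

Lemma near0_shift (h k z e : R) : near0 h z -> `|e| <= k -> near0 (h + k) (z + e).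
Proof.
move=> nz; rewrite ler_norml => /andP[e1 e2].
have [big|small] := leP 2^-1 (h + k).
  by rewrite /near0/=; have [?|?] := leP (frac (z + e)) 2^-1; [left|right]; lra.
have k0 : 0 <= k by lra.
have /andP[f0 f1] := frac_itv z.
have zE : z = frac z + (Num.floor z)%:~R by rewrite /frac subrK.
have fE (i : int) : 0 <= frac z + e + i%:~R < 1 -> frac (z + e) = frac z + e + i%:~R.
  move=> hi; rewrite -[RHS]frac_id// frac_periodic -[RHS](frac_periodic _ (Num.floor z)).
  by congr frac; rewrite {1}zE; ring.
have [s0|s0] := ltP (frac z + e) 0.
  right; rewrite (fE 1); first by case: nz => /= ?; lra.
  by case: nz => /= ?; apply/andP; split; lra.
have [s1|s1] := ltP (frac z + e) 1.
  have e0 : frac (z + e) = frac z + e by rewrite (fE 0) ?addr0// s0 s1.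
  by rewrite /near0/= e0; case: nz => /= ?; [left|right]; lra.
left; rewrite (fE (-1)); first by case: nz => /= ?; lra.
by case: nz => /= ?; apply/andP; split; lra.
Qed.

Definition near_origin (h : R) : set (plane R) := [set p | near0 h p.1 /\ near0 h p.2].

Lemma toral_near_origin h : toral (near_origin h).
Proof.
split; last by move=> p i j; rewrite /near_origin/near0/= !frac_periodic.
apply: measurableI; apply: measurable_near0_fun.
  exact: measurable_coord1.
exact: measurable_coord2.
Qed.

Lemma pr_near_origin h : 0 <= h -> pr (near_origin h) <= 4 * h ^+ 2.
Proof.
move=> h0; apply: (@pr_vertical_strip _ _ [set p | near0 h p.2] h0).
  by apply: measurable_near0_fun; exact: measurable_coord2.
by move=> x; exact: leb_near0.
Qed.

Lemma contracted n (t eta : R) : `|t| <= 1 -> lam R ^- n <= eta ->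
  `|phi R * (lam R ^- n * t)| <= 2 * eta /\ `|lam R ^- n * t| <= 2 * eta.
Proof.
move=> t1 ln; have l0 : 0 <= lam R ^- n by rewrite invr_ge0 exprn_ge0// ltW ?lam_gt0.
have lt : `|lam R ^- n * t| <= eta.
  by rewrite normrM (ger0_norm l0) (le_trans _ ln)// ler_piMr.
have eta0 := le_trans l0 ln.
have p0 : 0 <= phi R by apply: ltW; apply: lt_trans (phi_gt1 R).
split; last by apply: (le_trans lt); rewrite ler_peMl// ler1n.
by rewrite normrM (ger0_norm p0) ler_pM// ltW// phi_lt2.
Qed.

(** Moving by v splits into an unstable displacement, which the j1 backward
    steps contract, and a stable one, which the j2 forward steps contract; all
    translates of the returning set thus stay in slightly larger boxes, which
    makes the return at least as rare as two independent visits. *)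
Lemma late_return (H : set (plane R)) (h eta : R) (j1 j2 : nat) : toral H ->
  H `<=` near_origin h -> 0 <= h -> lam R ^- j1 <= eta -> lam R ^- j2 <= eta ->
  pr (H `&` iter (j1 + j2) M @^-1` H) <= (4 * (h + 2 * eta) ^+ 2) ^+ 2.
Proof.
move=> tH Hh h0 e1 e2.
pose P := near_origin (h + 2 * eta); have tP : toral P by exact: toral_near_origin.
have eta0 : 0 <= eta by apply: le_trans e1; rewrite ltW// invr_gt0 exprn_gt0 ?lam_gt0.
have h'0 : 0 <= h + 2 * eta by rewrite addr_ge0// mulr_ge0.
pose E := iter j1 Mi @^-1` P; pose F := iter j2 M @^-1` P.
have tE : toral E by exact: (toral_iter j1 (@toral_catMi R) tP).
have tF : toral F by exact: (toral_iter j2 (@toral_catM R) tP).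
apply: (@le_trans _ _ (pr E * pr F)); last first.
  rewrite (pr_iter j1 (@toral_catMi R) (@pr_catMi R) tP).
  rewrite (pr_iter j2 (@toral_catM R) (@pr_catM R) tP) [X in _ <= X]expr2.
  by apply: ler_pM; [exact: pr_ge0|exact: pr_ge0|exact: pr_near_origin..].
pose S := iter j1 Mi @^-1` H `&` iter j2 M @^-1` H.
have tS : toral S.
  apply: toralI; first exact: (toral_iter j1 (@toral_catMi R) tH).
  exact: (toral_iter j2 (@toral_catM R) tH).
have -> : pr (H `&` iter (j1 + j2) M @^-1` H) = pr S.
  rewrite -(pr_iter j1 (@toral_catM R) (@pr_catM R) tS); congr pr.
  apply/seteqP; split => p; rewrite /S/= addnC iterD.
    by move=> [h1 h2]; split; [rewrite iter_catMK|exact: h2].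
  by move=> [h1 h2]; split; [rewrite iter_catMK in h1|exact: h2].
apply: (average_translates tE tF) => v vL.
have [u1 s1] := eigen_coord_le1 vL.
pose al := unst v / (phi R ^+ 2 + 1); pose be := stab v / (phi R ^+ 2 + 1).
have vE : v = trans (eu al) (es be) by exact: eigen_decomposition.
rewrite -(pr_trans (es be) tS).
apply: le_pr.
- exact: (toral_trans _ tS).1.
- by case: (toralI (toral_trans v tE) tF).
move=> x [h1 h2]; split.
  have -> : trans v x = trans (eu al) (trans (es be) x).
    by rewrite transA {1}vE /trans/=.
  rewrite /E/= iter_trans; last exact: catMi_trans.
  rewrite iter_catMi_eu; have [a1 a2] := contracted u1 e1.
  have [n1 n2] := Hh _ h1.
  by split; apply: near0_shift.
have -> : x = trans (es (- be)) (trans (es be) x).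
  by rewrite /trans/es/=; case: (x) => ? ? /=; congr pair; ring.
rewrite /F/= iter_trans; last exact: catM_trans.
have be1 : `|- be| <= 1 by rewrite normrN.
rewrite iter_catM_es; have [a1 a2] := contracted be1 e2.
have [n1 n2] := Hh _ h2.
by split; apply: near0_shift => //=; rewrite normrN.
Qed.

End corner_returns.

(** * Targets seen from a corner *)

Section outside_a_corner.
Variable R : realType.
Local Notation M := (@catM R).
Local Notation Mi := (@catMi R).
Variables (c a : plane R).

(** In one coordinate: the square has its end c on the side of the centre c - a,
    which lies outside. *)
Definition facing (c a : R) := (c = 0 /\ 0 < a) \/ (c = 1 /\ a < 0).
Hypotheses (face1 : facing c.1 a.1) (face2 : facing c.2 a.2).

Let pM : plane R := (c.1 - a.1, c.2 - a.2).
Definition depth := Num.sqrt (a.1 ^+ 2 + a.2 ^+ 2).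
Local Notation D := depth.

Lemma facing_neq0 (c' a' : R) : facing c' a' -> a' != 0.
Proof. by case=> [[_ h]|[_ h]]; [rewrite gt_eqF|rewrite lt_eqF]. Qed.

Let an1 : a.1 != 0 := facing_neq0 face1.
Let an2 : a.2 != 0 := facing_neq0 face2.

Lemma depth_gt0 : 0 < D.
Proof. by rewrite sqrtr_gt0 ltr_pwDl ?sqr_ge0// lt_def sqrf_eq0 an1 sqr_ge0. Qed.

Lemma depth2 : D ^+ 2 = a.1 ^+ 2 + a.2 ^+ 2.
Proof. by rewrite sqr_sqrtr// addr_ge0// sqr_ge0. Qed.

(** The target in coordinates centred at the corner, the fixed point. *)
Definition at_corner (d : R) : set (plane R) :=
  [set x | target pM ((D + d) ^+ 2) (trans c x)].

Lemma at_cornerE d x : at_corner d x <->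
  [/\ 0 <= x.1 + c.1 < 1, 0 <= x.2 + c.2 < 1 &
     (x.1 + a.1) ^+ 2 + (x.2 + a.2) ^+ 2 < (D + d) ^+ 2].
Proof.
rewrite /at_corner/= (target_coord true)/=.
rewrite (_ : x.1 + c.1 - (c.1 - a.1) = x.1 + a.1); last by ring.
by rewrite (_ : x.2 + c.2 - (c.2 - a.2) = x.2 + a.2)//; ring.
Qed.

Lemma facing_ge0 (c' a' x : R) : facing c' a' -> 0 <= x + c' < 1 -> 0 <= a' * x.
Proof.
case=> [[-> a0]|[-> a0]] /andP[x0 x1].
  by rewrite mulr_ge0 ?(ltW a0)//; move: x0; rewrite addr0.
by rewrite nmulr_rge0//; lra.
Qed.

Lemma facing_inside (c' a' x : R) : facing c' a' -> 0 < a' * x -> `|x| < 1 ->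
  0 <= x + c' < 1.
Proof.
case=> [[-> a0]|[-> a0]]; [rewrite pmulr_rgt0//|rewrite nmulr_rgt0//];
  rewrite ltr_norml => x0 /andP[x1 x2]; apply/andP; split; lra.
Qed.

Lemma facing_convex (c' a' x y z : R) : facing c' a' ->
  a' * x <= a' * y -> a' * y <= a' * z ->
  0 <= x + c' < 1 -> 0 <= z + c' < 1 ->
  0 <= y + c' < 1 /\ (y + a') ^+ 2 <= (z + a') ^+ 2.
Proof.
move=> f xy yz hx hz; have x0 := facing_ge0 f hx; have z0 := facing_ge0 f hz.
have yz2 : y ^+ 2 <= z ^+ 2.
  have ap : 0 < a' ^+ 2.
    rewrite exprn_even_gt0//=.
    exact: facing_neq0 f.
  by rewrite -(ler_pM2l ap) -!exprMn ler_pXn2r ?nnegrE ?(le_trans x0 xy).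
split; last first.
  rewrite !sqrrD ![_ * a']mulrC; move: yz yz2.
  by move: (y ^+ 2) (z ^+ 2) (a' ^+ 2) (a' * y) (a' * z) => *; lra.
by case: f hx hz xy yz => [[-> ap]|[-> ap]] /andP[? ?] /andP[? ?];
  [rewrite !(ler_pM2l ap)|rewrite !(ler_nM2l ap)] => *; apply/andP; split; lra.
Qed.

(** On the quadrant of the square the distance to the centre grows along this
    order. *)
Definition below (x y : plane R) := a.1 * x.1 <= a.1 * y.1 /\ a.2 * x.2 <= a.2 * y.2.
Definition quadrant (x : plane R) := 0 <= a.1 * x.1 /\ 0 <= a.2 * x.2.

Lemma at_corner_quadrant d x : at_corner d x -> quadrant x.
Proof. by move=> /at_cornerE[h1 h2 _]; split; apply: facing_ge0; eassumption. Qed.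

Lemma at_corner_convex d x y z : at_corner d x -> at_corner d z ->
  below x y -> below y z -> at_corner d y.
Proof.
move=> /at_cornerE[x1 x2 _] /at_cornerE[z1 z2 h] [xy1 xy2] [yz1 yz2].
have [y1 s1] := facing_convex face1 xy1 yz1 x1 z1.
have [y2 s2] := facing_convex face2 xy2 yz2 x2 z2.
by apply/at_cornerE; split => //; apply: le_lt_trans h; exact: lerD.
Qed.

Lemma below_trans x y z : below x y -> below y z -> below x z.
Proof. by move=> [h1 h2] [h3 h4]; split; [exact: le_trans h3|exact: le_trans h4]. Qed.

(** On the two quadrants where the coordinates have the same sign the map moves
    points away from the origin in both coordinates; on the other two quadrants
    its inverse does. *)
Let expansive := if 0 < a.1 * a.2 then M else Mi.

Let below_expansive x : quadrant x -> below x (expansive x) /\ quadrant (expansive x).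
Proof.
move=> [h1 h2].
suff [m1 m2] : below x (expansive x).
  by split; [split|split; [exact: le_trans m1|exact: le_trans m2]].
have a12 : a.1 * a.2 != 0 by rewrite mulf_neq0.
have cross : (a.1 * a.2) * (a.1 * x.2) = a.1 ^+ 2 * (a.2 * x.2) by ring.
have cross' : (a.1 * a.2) * (a.2 * x.1) = a.2 ^+ 2 * (a.1 * x.1) by ring.
rewrite /below /expansive /catM /catMi; have [ap|an] := ltP 0 (a.1 * a.2).
  have p1 : 0 <= a.1 * x.2 by rewrite -(pmulr_rge0 _ ap) cross mulr_ge0 ?sqr_ge0.
  have p2 : 0 <= a.2 * x.1 by rewrite -(pmulr_rge0 _ ap) cross' mulr_ge0 ?sqr_ge0.
  by rewrite /= !mulrDr mulrCA; split; lra.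
have an' : a.1 * a.2 < 0 by rewrite lt_def eq_sym a12.
have p1 : a.1 * x.2 <= 0 by rewrite -(nmulr_rge0 _ an') cross mulr_ge0 ?sqr_ge0.
have p2 : a.2 * x.1 <= 0 by rewrite -(nmulr_rge0 _ an') cross' mulr_ge0 ?sqr_ge0.
by rewrite /= !mulrBr [a.2 * (2 * _)]mulrCA; split; lra.
Qed.

Let below_iter n x : quadrant x -> below x (iter n expansive x) /\ quadrant (iter n expansive x).
Proof.
move=> qx; elim: n => [|n [b q]]; first by split => //; split.
have [b' q'] := below_expansive q.
by rewrite iterS; split => //; exact: below_trans b'.
Qed.

(** An orbit that starts and ends in the quadrant is monotone for below, whence
    M x lies between the two ends; and the target is convex for this order. *)
Lemma return_through_corner d x j : (0 < j)%N ->
  at_corner d x -> at_corner d (iter j M x) -> at_corner d (M x).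
Proof.
case: j => // j _ Vx Vx'; have qx := at_corner_quadrant Vx.
have qx' := at_corner_quadrant Vx'.
move: below_expansive below_iter; rewrite /expansive; case: ifP => _ be bi.
  have [b q] := be _ qx; apply: (at_corner_convex Vx Vx' b).
  by rewrite iterSr; exact: (bi j _ q).1.
have [b q] := bi j _ qx'.
have e : iter j Mi (iter j.+1 M x) = M x by rewrite iterSr iter_catMK.
have [b' _] := be _ q; rewrite e in b b'; rewrite catMK in b'.
exact: (at_corner_convex Vx' Vx b b').
Qed.

End outside_a_corner.

(** * Escapes from a target at a corner *)

Section escapes_from_a_corner.
Variable R : realType.
Local Notation M := (@catM R).
Variables (c a : plane R).
Hypotheses (face1 : facing c.1 a.1) (face2 : facing c.2 a.2).
Local Notation D := (depth a).
Local Notation V := (at_corner c a).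

Definition corner_point : plane R := (c.1 - a.1, c.2 - a.2).
Local Notation pM := corner_point.

Let D0 : 0 < D := depth_gt0 face1.

Lemma corner_lattice : lattice c.
Proof.
have int (c' a' : R) : facing c' a' -> exists i : int, c' = i%:~R.
  by case=> [[-> _]|[-> _]]; [exists 0|exists 1].
have [i ci] := int _ _ face1; have [j cj] := int _ _ face2.
by exists i, j; rewrite -ci -cj; case: c.
Qed.

(** A visit is a translate of the point by a lattice vector that falls in the
    target at the corner. *)
Lemma hits_corner d p :
  hits pM (D + d) p <-> exists v, lattice v /\ V d (trans v p).
Proof.
have [i [j cE]] := corner_lattice.
have tc (k l : int) : tor (trans c (trans (k%:~R, l%:~R) p)) = tor p.
  by rewrite /tor /trans cE/= !frac_periodic.
split=> [h|[_ [[k [l ->]] h]]]; last first.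
  rewrite /hits/= -(tc k l) tor_id; first exact: h.
  exact: target_Lambda h.
exists ((- Num.floor p.1 - i)%:~R, (- Num.floor p.2 - j)%:~R); split; first by do 2!eexists.
rewrite /at_corner/= (_ : trans c _ = tor p)//.
by rewrite /tor /trans /frac cE/= !intrD !intrN; congr pair; ring.
Qed.

(** The target lies between the corner and the tangent of the circle, hence in a
    box of size spread * d. *)
Definition spread : R := (2 * D + 1) * (`|a.1|^-1 + `|a.2|^-1).
Local Notation C := spread.

Lemma spread_gt0 : 0 < C.
Proof.
rewrite mulr_gt0 ?addr_gt0 ?mulr_gt0// invr_gt0 normr_gt0.
  exact: facing_neq0 face1.
exact: facing_neq0 face2.
Qed.

Lemma at_corner_tangent d x : V d x ->
  2 * (a.1 * x.1 + a.2 * x.2) + (x.1 ^+ 2 + x.2 ^+ 2) < 2 * D * d + d ^+ 2.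
Proof.
move=> /at_cornerE[_ _]; rewrite !sqrrD (depth2 a).
rewrite ![_ * a.1]mulrC ![_ * a.2]mulrC -mulrA !mulr_natl.
move: (a.1 * x.1) (a.2 * x.2) (D * d) (x.1 ^+ 2) (x.2 ^+ 2) (d ^+ 2) (a.1 ^+ 2) (a.2 ^+ 2).
by move=> *; lra.
Qed.

Lemma at_corner_small d x : 0 < d <= 1 -> V d x -> `|x.1| <= C * d /\ `|x.2| <= C * d.
Proof.
move=> /andP[d0 d1] Vx; have [q1 q2] := at_corner_quadrant face1 face2 Vx.
have n1 : 0 < `|a.1| by rewrite normr_gt0; exact: facing_neq0 face1.
have n2 : 0 < `|a.2| by rewrite normr_gt0; exact: facing_neq0 face2.
have hd : d ^+ 2 <= d by rewrite expr2 ler_piMr// ltW.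
have t := at_corner_tangent Vx.
have K0 : 0 <= (2 * D + 1) * d by rewrite mulr_ge0 ?ltW// addr_gt0// mulr_gt0.
have [t1 t2] : a.1 * x.1 <= (2 * D + 1) * d /\ a.2 * x.2 <= (2 * D + 1) * d.
  have s1 := sqr_ge0 x.1; have s2 := sqr_ge0 x.2; rewrite mulrDl mul1r.
  move: t q1 q2 hd s1 s2; move: (a.1 * x.1) (a.2 * x.2) (2 * D * d) (x.1 ^+ 2) (x.2 ^+ 2) (d ^+ 2).
  by move=> *; split; lra.
have cut (a' x' : R) : 0 < `|a'| -> 0 <= a' * x' -> a' * x' <= (2 * D + 1) * d ->
    `|x'| <= (2 * D + 1) * d * `|a'|^-1.
  by move=> n h0 h; rewrite ler_pdivlMr// mulrC -normrM ger0_norm.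
have v1 : 0 <= (2 * D + 1) * d * `|a.1|^-1 by rewrite mulr_ge0// invr_ge0.
have v2 : 0 <= (2 * D + 1) * d * `|a.2|^-1 by rewrite mulr_ge0// invr_ge0.
rewrite /spread mulrAC mulrDr; split; first by apply: (le_trans (cut _ _ n1 q1 t1)); rewrite lerDl.
by apply: (le_trans (cut _ _ n2 q2 t2)); rewrite lerDr.
Qed.

Lemma hits_near_origin d : 0 < d <= 1 -> hits pM (D + d) `<=` near_origin (C * d).
Proof.
move=> d01 p /hits_corner[_ [[k [l ->]] /(at_corner_small d01) [h1 h2]]].
have n (x : R) : `|x| <= C * d -> near0 (C * d) x.
  move=> hx; rewrite -[x]add0r -[C * d]add0r; apply: near0_shift => //.
  by left; rewrite frac_id// lexx ltr01.
have [_ pN] := toral_near_origin (C * d).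
by apply/(pN p k l); split; exact: n.
Qed.

(** The points whose run of visits ends at the next step. *)
Definition escapes d := hits pM (D + d) `\` M @^-1` hits pM (D + d).

Lemma toral_escapes d : toral (escapes d).
Proof.
have tH := toral_hits pM (D + d).
by apply: toralD => //; exact: toral_catM.
Qed.

(** At early times a return is exact near the fixed point, without going around
    the torus, so it forces the next point to be in the target too. *)
Lemma early_return_void d j1 j2 : (0 < j1 + j2)%N -> 0 < d <= 1 ->
  lam R ^+ j1 * (C * d) < 17^-1 -> lam R ^+ j2 * (C * d) < 17^-1 ->
  escapes d `&` iter (j1 + j2) M @^-1` escapes d = set0.
Proof.
move=> j0 d01 e1 e2; apply/seteqP; split => // p [[/hits_corner[v [lv Vx]] out]].
move=> [/hits_corner[w [lw Vx']] _]; apply: out.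
have [x1 x2] := at_corner_small d01 Vx; have [x1' x2'] := at_corner_small d01 Vx'.
have [i [j nE]] : lattice (iter (j1 + j2) M v).
  by apply: lattice_iter => //; exact: lattice_catM.
have [i' [j' wE]] := lw.
have lz : lattice (((i' - i)%:~R, (j' - j)%:~R) : plane R) by do 2!eexists.
have xE : trans w (iter (j1 + j2) M p) =
    trans ((i' - i)%:~R, (j' - j)%:~R) (iter (j1 + j2) M (trans v p)).
  rewrite (iter_trans _ _ _ (@catM_trans R)) nE wE /trans/= !intrB.
  by congr pair; ring.
rewrite (small_return_exact lz xE x1 x2 x1' x2' e1 e2) in Vx'.
have := return_through_corner face1 face2 j0 Vx Vx'.
rewrite catM_trans => VM; apply/hits_corner.
by exists (M v); split => //; exact: lattice_catM.
Qed.

(** Either j is early, or lam ^- (j./2) is of order d and the target, of size of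
    order d, returns no more often than if its visits were independent. *)
Lemma pr_escape_return d j : 0 < d <= 1 -> (0 < j)%N ->
  pr (escapes d `&` iter j M @^-1` escapes d) <= (4 * (103 * C) ^+ 2) ^+ 2 * d ^+ 4.
Proof.
move=> d01 j0; have /andP[d0 _] := d01.
have C0 := spread_gt0; have Cd : 0 < C * d by rewrite mulr_gt0.
have jE : j = (j./2 + uphalf j)%N by rewrite -{1}(odd_double_half j) uphalf_half; lia.
have l1 : 1 <= lam R by apply: ltW; apply: lt_trans (lam_gt2 R); rewrite ltr1n.
have lp n : 0 < lam R ^+ n by rewrite exprn_gt0 ?lam_gt0.
have lmono : lam R ^+ j./2 <= lam R ^+ uphalf j.
  by apply: ler_weXn2l => //; rewrite uphalf_half; lia.
have [small|big] := ltP (lam R ^+ uphalf j * (C * d)) 17^-1.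
  rewrite {1}jE early_return_void// ?pr_set0 -?jE//.
    by rewrite mulr_ge0// ?sqr_ge0// exprn_ge0// ltW.
  by apply: le_lt_trans small; rewrite ler_pM2r.
(* 17 suffices for uphalf j and one more factor lam < 3 for j./2; the box of
   late_return then has size (1 + 2 * 51) * C * d. *)
have e2 : lam R ^- uphalf j <= 51 * (C * d).
  rewrite -[X in X <= _]mul1r ler_pdivrMr//; move: big.
  by move: (lam R ^+ _) (C * d) => u v; lra.
have e1 : lam R ^- j./2 <= 51 * (C * d).
  have l3 := lam_lt3 R.
  have st : lam R ^+ uphalf j <= lam R * lam R ^+ j./2.
    by rewrite -exprS; apply: ler_weXn2l => //; rewrite uphalf_half; case: (odd j).
  rewrite -[X in X <= _]mul1r ler_pdivrMr//; move: (lp j./2) big st Cd l3.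
  move: (lam R ^+ j./2) (lam R ^+ uphalf j) => u v.
  move: (C * d) (lam R) => w l u0 h1 h2 w0 l3.
  have : v * w <= 3 * u * w.
    by rewrite ler_pM2r//; apply: (le_trans h2); rewrite ler_pM2r// ltW.
  by lra.
have tH := toral_hits pM (D + d).
have tI E : toral E -> measurable (E `&` iter j M @^-1` E).
  move=> tE; apply: toral_meas; apply: toralI => //.
  exact: (toral_iter j (@toral_catM R) tE).
apply: (@le_trans _ _ (pr (hits pM (D + d) `&` iter j M @^-1` hits pM (D + d)))).
  apply: le_pr; [exact: tI (toral_escapes d)|exact: tI|].
  by move=> p [[? _] [? _]]; split.
rewrite jE.
have := @late_return R _ (C * d) (51 * (C * d)) j./2 (uphalf j) tH (hits_near_origin d01)
  (ltW Cd) e1 e2.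
rewrite (_ : C * d + 2 * (51 * (C * d)) = 103 * C * d); last by ring.
by rewrite (_ : (4 * (103 * C * d) ^+ 2) ^+ 2 = (4 * (103 * C) ^+ 2) ^+ 2 * d ^+ 4)//; ring.
Qed.

(** The sum of the returns within the gap is of order gap n * delta n ^+ 4, and
    delta n ^+ 2 is of order 1 / n. *)
Lemma no_clusters_escapes (delta : R^nat) (l : R) : (forall n, 0 < delta n) ->
  n%:R * delta n `^ 2 @[n --> \oo] --> l -> no_clusters (escapes \o delta).
Proof.
move=> dp dl; set K := (4 * (103 * C) ^+ 2) ^+ 2.
have d0 : delta n @[n --> \oo] --> (0 : R).
  exact: (@cvg0_of_mulrn_powR _ _ _ _ _ (fun n => ltW (dp n)) dl).
have p2 n : delta n `^ 2 = delta n ^+ 2 by rewrite powR_mulrn// ltW.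
have g : (gap n + gap n)%:R * delta n `^ 2 @[n --> \oo] --> (0 : R).
  by apply: (cvg_gap_pr _ dl) => n; exact: powR_ge0.
have h : K * ((n%:R * delta n `^ 2) * ((gap n + gap n)%:R * delta n `^ 2)) @[n --> \oo]
    --> K * (l * 0) by apply: cvgMr; apply: cvgM.
rewrite !mulr0 in h; apply: (squeeze_cvgr _ (cvg_cst 0) h).
near=> n; rewrite mulr_ge0 ?return_sum_ge0//=.
have d1 : 0 < delta n <= 1.
  by rewrite dp ltW//; near: n; exact: (cvgr_lt _ d0 _ ltr01).
have rs : return_sum (escapes (delta n)) (gap n + gap n) <=
    (gap n + gap n)%:R * (K * delta n ^+ 4).
  rewrite /return_sum big_nat_cond.
  apply: (@le_trans _ _ (\sum_(1 <= j < gap n + gap n | (1 <= j < gap n + gap n)%N && true) K * delta n ^+ 4)).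
    by apply: ler_sum => j /andP[/andP[j0 _] _]; exact: pr_escape_return.
  rewrite -big_nat_cond sumr_const_nat -[X in X <= _]mulr_natl ler_wpM2r//.
    by apply: mulr_ge0; [exact: sqr_ge0|apply: exprn_ge0; exact: ltW].
  by rewrite ler_nat leq_subr.
apply: (le_trans (ler_wpM2l (ler0n R n) rs)).
rewrite !p2 le_eqVlt; apply/orP; left; apply/eqP; ring.
Unshelve. all: by end_near. Qed.

End escapes_from_a_corner.

(** * The area of the escapes *)

Section area_of_escapes.
Variable R : realType.
Local Notation M := (@catM R).

Lemma area_setDI (E F : set (plane R)) : measurable E -> measurable F ->
  bounded_plane E -> area E = area (E `\` F) + area (E `&` F).
Proof.
move=> mE mF [r [r0 Er]]; apply: EFin_inj; rewrite EFinD.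
have b G : G `<=` E -> bounded_plane G by move=> GE; exists r; split => //; exact: subset_trans Er.
have [mD mI] : measurable (E `\` F) /\ measurable (E `&` F).
  by split; [exact: measurableD|exact: measurableI].
rewrite (areaK mE (b _ (@subset_refl _ _))) (areaK mD (b _ (@subDsetl _ _ _))).
rewrite (areaK mI (b _ (@subIsetl _ _ _))); exact: measureDI.
Qed.

Lemma scaled_itv (a l r x : R) : a != 0 -> l < r ->
  Num.min (l / a) (r / a) < x < Num.max (l / a) (r / a) -> l < a * x < r.
Proof.
move=> a0 lr; have lrE (t : R) : t = a * (t / a) by rewrite mulrC divfK.
have [ap|an|az] := ltgtP a 0; last by rewrite az eqxx in a0.
  have lr' : r / a < l / a by rewrite ltr_nM2r ?invr_lt0.
  rewrite min_r ?max_l ?(ltW lr')// => /andP[h1 h2].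
  by rewrite {1}(lrE l) {1}(lrE r) !ltr_nM2l// h1 h2.
have lr' : l / a < r / a by rewrite ltr_pM2r ?invr_gt0.
rewrite min_l ?max_r ?(ltW lr')// => /andP[h1 h2].
by rewrite {1}(lrE l) {1}(lrE r) !ltr_pM2l// h1 h2.
Qed.

Lemma min_lt_max (a l r : R) : a != 0 -> l < r ->
  Num.min (l / a) (r / a) < Num.max (l / a) (r / a).
Proof.
move=> a0 lr; have : l / a != r / a.
  by rewrite (inj_eq (mulIf _)) ?invr_eq0// lt_eqF.
rewrite neq_lt => /orP[h|h].
  by rewrite min_l ?max_r ?(ltW h).
by rewrite min_r ?max_l ?(ltW h).
Qed.

Variables (c a : plane R).
Hypotheses (face1 : facing c.1 a.1) (face2 : facing c.2 a.2).
Local Notation D := (depth a).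
Local Notation V := (at_corner c a).
Local Notation pM := (corner_point c a).
Local Notation C := (spread a).

Let an1 : a.1 != 0 := facing_neq0 face1.
Let an2 : a.2 != 0 := facing_neq0 face2.

(** The first-order form of the target: the quadrant cut off by the tangent of
    the circle. *)
Definition triangle (t : R) : set (plane R) :=
  [set x | [/\ 0 < a.1 * x.1, 0 < a.2 * x.2 & a.1 * x.1 + a.2 * x.2 < D * t]].

(** The boolean e counts the further steps at which the point has to be in the
    triangle: the triangle itself for false, and for true its points that stay
    in it under M. *)
Definition stay (e : bool) (t : R) := triangle t `&` iter e M @^-1` triangle t.

Lemma measurable_triangle t : measurable (triangle t).
Proof.
rewrite (_ : triangle t = [set x | 0 < a.1 * x.1] `&` ([set x | 0 < a.2 * x.2] `&`
    [set x | a.1 * x.1 + a.2 * x.2 < D * t])); last first.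
  by apply/seteqP; split => x [] // ? [].
have pos (f g : plane R -> R) : measurable_fun setT f -> measurable_fun setT g ->
    measurable [set x | f x < g x].
  by move=> mf mg; rewrite -[X in measurable X]setTI; exact: measurable_fun_ltr.
apply: measurableI; [|apply: measurableI]; apply: pos => //.
- by apply: (@measurable_linE _ _ a.1 0 0) => x; ring.
- by apply: (@measurable_linE _ _ 0 a.2 0) => x; ring.
- by apply: (@measurable_linE _ _ a.1 a.2 0) => x; ring.
Qed.

Lemma measurable_stay e t : measurable (stay e t).
Proof.
have mT := measurable_triangle t; apply: measurableI => //.
by apply: (measurable_preim _ mT); exact: measurable_iter_catM.
Qed.

Lemma triangle_coord t x : triangle t x ->
  `|x.1| < D * t * `|a.1|^-1 /\ `|x.2| < D * t * `|a.2|^-1.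
Proof.
move=> [h1 h2 h]; have cut (a' x' : R) : a' != 0 -> 0 < a' * x' -> a' * x' < D * t ->
    `|x'| < D * t * `|a'|^-1.
  by move=> n h0 h'; rewrite ltr_pdivlMr ?normr_gt0// mulrC -normrM gtr0_norm.
split; apply: cut => //; apply: lt_trans h; first by rewrite ltrDl.
by rewrite ltrDr.
Qed.

Lemma bounded_box (E : set (plane R)) (r : R) : 
  (forall x, E x -> `|x.1| < r /\ `|x.2| < r) -> bounded_plane E.
Proof.
move=> Er; exists (Num.max r 1); split; first by rewrite lt_max ltr01 orbT.
move=> x /Er[h1 h2]; split; rewrite /= in_itv/= -ltr_norml lt_max.
  by rewrite h1.
by rewrite h2.
Qed.

Lemma bounded_stay e t : bounded_plane (stay e t).
Proof.
apply: (@bounded_box _ (Num.max (D * t * `|a.1|^-1) (D * t * `|a.2|^-1))) => x [/triangle_coord[h1 h2] _].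
by rewrite !lt_max h1 h2 orbT.
Qed.

Lemma iter_scale (e : bool) (t : R) (x : plane R) :
  iter e M (t * x.1 + 0, t * x.2 + 0) = (t * (iter e M x).1 + 0, t * (iter e M x).2 + 0).
Proof. by rewrite !addr0; case: e => //=; rewrite /catM/=; congr pair; ring. Qed.

Lemma area_stay e t : 0 < t -> area (stay e t) = area (stay e 1) * t `^ 2.
Proof.
move=> t0; have tn0 : t != 0 by rewrite gt_eqF.
have tri x : triangle t (t * x.1 + 0, t * x.2 + 0) <-> triangle 1 x.
  rewrite /triangle/= !addr0 mulr1 ![_ * (t * _)]mulrCA -mulrDr [D * t]mulrC.
  by rewrite !(pmulr_rgt0 _ t0) (ltr_pM2l t0).
have e1 : [set x : plane R | stay e t (t * x.1 + 0, t * x.2 + 0)] = stay e 1.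
  apply/seteqP; split => x; rewrite /stay/= iter_scale.
    by move=> [/tri ? /tri].
  by move=> [h1 h2]; split; apply/tri.
rewrite (area_affine 0 0 tn0 tn0 (measurable_stay e t)) e1 (gtr0_norm t0).
by rewrite powR_mulrn ?(ltW t0)// expr2 [LHS]mulrC.
Qed.

(** The counterpart of stay for the true target. *)
Definition two_hits (e : bool) d := [set x | V d x /\ hits pM (D + d) (iter e M (trans c x))].

Let mtc : measurable_fun setT (trans c).
Proof. exact: measurable_trans. Qed.

Lemma measurable_two_hits e d : measurable (two_hits e d).
Proof.
have mT := measurable_target pM ((D + d) ^+ 2).
have [mH _] := toral_iter e (@toral_catM R) (toral_hits pM (D + d)).
by apply: measurableI; [exact: (measurable_preim mtc mT)|exact: (measurable_preim mtc mH)].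
Qed.

Lemma pr_two_hits (e : bool) d :
  pr (hits pM (D + d) `&` iter e M @^-1` hits pM (D + d)) = area (two_hits e d).
Proof.
have mT := measurable_target pM ((D + d) ^+ 2).
have [mH pH] := toral_iter e (@toral_catM R) (toral_hits pM (D + d)).
pose W := target pM ((D + d) ^+ 2) `&` iter e M @^-1` hits pM (D + d).
have mW : measurable W by apply: measurableI.
have -> : hits pM (D + d) `&` iter e M @^-1` hits pM (D + d) = @tor R @^-1` W.
  have per (p : plane R) : (iter e M @^-1` hits pM (D + d)) (tor p) <->
      (iter e M @^-1` hits pM (D + d)) p.
    by rewrite -(pH p (- Num.floor p.1) (- Num.floor p.2)) /tor /frac !intrN.
  by apply/seteqP; split => p [h1 h2]; split => //; apply/per.
rewrite pr_lift; last by move=> p [[]].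
rewrite -/(area W) (area_affine c.1 c.2 (oner_neq0 R) (oner_neq0 R) mW) normr1 !mul1r.
by congr area; apply/seteqP; split => x; rewrite /W/two_hits/at_corner/= !mul1r.
Qed.

Lemma hits_iter_corner (e : bool) d x : V d (iter e M x) -> hits pM (D + d) (iter e M (trans c x)).
Proof.
move=> h; apply/(hits_corner face1 face2).
have lc : lattice (iter e M c).
  apply: lattice_iter; first exact: lattice_catM.
  exact: (corner_lattice face1 face2).
have [i [j cE]] := lc; exists ((- i)%:~R, (- j)%:~R); split; first by do 2!eexists.
rewrite (iter_trans _ _ _ (@catM_trans R)) cE (_ : trans _ _ = iter e M x)//.
by rewrite /trans/= !intrN !addrK; case: (iter e M x).
Qed.

(** Close to the fixed point one step does not go around the torus. *)
Lemma corner_hits_iter (e : bool) d x : 0 < d <= 1 -> 4 * C * d < 1 -> V d x ->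
  hits pM (D + d) (iter e M (trans c x)) -> V d (iter e M x).
Proof.
move=> d01 dC Vx /(hits_corner face1 face2)[v [[k [l vE]]]].
have lc : lattice (iter e M c).
  apply: lattice_iter; first exact: lattice_catM.
  exact: (corner_lattice face1 face2).
have [i [j cE]] := lc.
rewrite (iter_trans _ _ _ (@catM_trans R)) transA.
set w := trans v _ => Vw.
have lw : lattice w.
  by exists (i + k), (j + l); rewrite /w cE vE /trans/= !intrD.
have [x1 x2] := at_corner_small face1 face2 d01 Vx.
have [y1 y2] := at_corner_small face1 face2 d01 Vw.
have Cd0 : 0 <= C * d by exact: le_trans x1.
rewrite -mulrA in dC.
have [m1 m2] : `|(iter e M x).1| <= 3 * (C * d) /\ `|(iter e M x).2| <= 3 * (C * d).
  case: (e) => /=; last by split; lra.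
  rewrite /catM/=; split; apply: (le_trans (ler_normD _ _)); last by lra.
  by rewrite normrM ger0_norm//; lra.
have sm (s t : R) : `|s + t| <= C * d -> `|s| <= 3 * (C * d) -> `|t| < 1.
  move=> h1 h2; rewrite (_ : t = s + t - s); last by ring.
  by apply: (le_lt_trans (ler_normB _ _)); lra.
rewrite (lattice_small lw (sm _ _ y1 m1) (sm _ _ y2 m2)) in Vw.
by move: Vw; rewrite /trans/= !addr0; case: (iter e M x).
Qed.

End area_of_escapes.

(** * Centres in front of a corner *)

Section corner_law.
Variable R : realType.
Local Notation M := (@catM R).
Variables (c a : plane R).
Hypotheses (face1 : facing c.1 a.1) (face2 : facing c.2 a.2).
Local Notation D := (depth a).
Local Notation V := (at_corner c a).
Local Notation pM := (corner_point c a).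
Local Notation C := (spread a).

Let an1 : a.1 != 0 := facing_neq0 face1.
Let an2 : a.2 != 0 := facing_neq0 face2.
Let D0 : 0 < D := depth_gt0 face1.

(** Near the side of the triangle away from the fixed point, every point of a
    small rectangle leaves the triangle under M. *)
Lemma area_stay_lt : area (stay a true 1) < area (stay a false 1).
Proof.
have mT := measurable_triangle a 1.
have mTM : measurable (M @^-1` triangle a 1).
  by apply: (measurable_preim _ mT); exact: measurable_catM.
have st : stay a false 1 = triangle a 1 by rewrite /stay/= setIid.
have bT : bounded_plane (triangle a 1) by rewrite -st; exact: bounded_stay face1 face2 _ _.
rewrite st (area_setDI mT mTM bT) ltrDr.
pose r := a.1 / a.2; have r0 : r != 0 by rewrite mulf_neq0 ?invr_eq0.
pose eta := Num.min (D / 4) (D / (2 * `|r|)).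
have eta0 : 0 < eta by rewrite lt_min !divr_gt0// mulr_gt0// normr_gt0.
have half : D / 2 < 3 * D / 4 by move: D0; lra.
apply: (@area_gt0 _ _ (Num.min (D / 2 / a.1) (3 * D / 4 / a.1)) (Num.max (D / 2 / a.1) (3 * D / 4 / a.1))
    (Num.min (0 / a.2) (eta / a.2)) (Num.max (0 / a.2) (eta / a.2))).
- exact: measurableD.
- by case: bT => s [s0 Ts]; exists s; split => // x [/Ts].
- exact: min_lt_max.
- exact: min_lt_max.
move=> x [/=]; rewrite !in_itv/= => /(scaled_itv an1 half)/andP[x1 x2].
move=> /(scaled_itv an2 eta0)/andP[y1]; rewrite lt_min => /andP[y2 y3].
have e1 : a.1 * (2 * x.1 + x.2) = 2 * (a.1 * x.1) + r * (a.2 * x.2) by rewrite /r; field.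
have e2 : a.2 * (x.1 + x.2) = (a.1 * x.1) / r + a.2 * x.2 by rewrite /r; field; rewrite an1 an2.
split.
  split=> //; first by apply: lt_trans x1; rewrite divr_gt0.
  by rewrite mulr1; move: D0 x2 y2; lra.
rewrite /triangle/= e1 e2 mulr1 => -[_ h2 h3].
move: x1 x2 y1 y3 h2 h3; move: (a.1 * x.1) (a.2 * x.2) => X Y x1 x2 y1 y3 h2 h3.
have X0 : 0 < X by apply: lt_trans x1; rewrite divr_gt0.
have [rp|rn|rz] := ltgtP r 0; last by rewrite rz eqxx in r0.
  rewrite ltr0_norm// in y3.
  have : D / (2 * - r) < X / - r.
    rewrite [X in X < _](_ : _ = D / 2 / - r); last by field; rewrite lt_eqF.
    by rewrite ltr_pM2r// invr_gt0 oppr_gt0.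
  rewrite (_ : X / - r = - (X / r)); last by rewrite invrN mulrN.
  by move: h2 y3; move: (X / r) (D / _) => u v; lra.
have p1 : 0 < r * Y by rewrite mulr_gt0.
have p2 : 0 < X / r by rewrite divr_gt0.
by move: p1 p2 h3 x1 y1; move: (r * Y) (X / r) => u v; lra.
Qed.

(* The two terms bound the error of replacing the disc by the half-plane of its
   tangent, from inside and from outside. *)
Let K := D * ((`|a.1|^-1) ^+ 2 + (`|a.2|^-1) ^+ 2) / 2 + (2 * D)^-1.
Let K0 : 0 <= K.
Proof. by rewrite addr_ge0 ?invr_ge0 ?mulr_ge0 ?addr_ge0 ?sqr_ge0 ?invr_ge0 ?(ltW D0). Qed.

Let d0 := Num.min (Num.min 1 (`|a.1| / D)) (Num.min (`|a.2| / D) (4 * C)^-1).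
Let d00 : 0 < d0.
Proof.
have C0 := spread_gt0 face1 face2.
have C4 : 0 < 4 * C by rewrite mulr_gt0.
by rewrite !lt_min ltr01 invr_gt0 C4 !divr_gt0 ?normr_gt0.
Qed.

Let d0P d : 0 < d < d0 -> [/\ 0 < d <= 1, D * d * `|a.1|^-1 < 1, D * d * `|a.2|^-1 < 1 &
  4 * C * d < 1].
Proof.
have C0 := spread_gt0 face1 face2.
have n1 : 0 < `|a.1| by rewrite normr_gt0.
have n2 : 0 < `|a.2| by rewrite normr_gt0.
rewrite !lt_min => /and3P[dp /andP[d1 h1] /andP[h2 h3]]; split.
- by rewrite dp ltW.
- by rewrite ltr_pdivrMr// mul1r mulrC -ltr_pdivlMr.
- by rewrite ltr_pdivrMr// mul1r mulrC -ltr_pdivlMr.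
- by move: h3; rewrite -[X in d < X]div1r ltr_pdivlMr ?[d * _]mulrC// mulr_gt0.
Qed.

Lemma triangle_at_corner d : 0 < d < d0 -> 0 < 1 - K * d ->
  triangle a (d * (1 - K * d)) `<=` V d.
Proof.
move=> dd Kd x Tx; have [d01 b1 b2 _] := d0P dd; have [t1 t2 t3] := Tx.
have /andP[dp _] := d01.
have [u1 u2] := triangle_coord face1 face2 Tx.
have sd : D * (d * (1 - K * d)) <= D * d.
  by rewrite ler_pM2l// ler_piMr ?(ltW dp)// gerBl mulr_ge0// ltW.
have i1 : 0 <= `|a.1|^-1 by rewrite invr_ge0.
have i2 : 0 <= `|a.2|^-1 by rewrite invr_ge0.
have v1 : `|x.1| <= D * d * `|a.1|^-1 by apply: (le_trans (ltW u1)); rewrite ler_wpM2r.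
have v2 : `|x.2| <= D * d * `|a.2|^-1 by apply: (le_trans (ltW u2)); rewrite ler_wpM2r.
have sq (s t : R) : `|s| <= t -> s ^+ 2 <= t ^+ 2.
  by move=> st; rewrite -real_normK ?num_real// ler_pXn2r ?nnegrE ?(le_trans _ st).
have q1 := sq _ _ v1; have q2 := sq _ _ v2.
apply/at_cornerE; split.
- exact: facing_inside face1 t1 (le_lt_trans v1 b1).
- exact: facing_inside face2 t2 (le_lt_trans v2 b2).
have DK : 2 * (D * (d * (1 - K * d))) =
    2 * (D * d) - (D * d * `|a.1|^-1) ^+ 2 - (D * d * `|a.2|^-1) ^+ 2 - d ^+ 2.
  by rewrite /K; move: `|a.1|^-1 `|a.2|^-1 => s t; field; rewrite gt_eqF.
have dd0 := sqr_ge0 d.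
rewrite !sqrrD (depth2 a) ![_ * a.1]mulrC ![_ * a.2]mulrC.
move: DK t3 q1 q2 dd0; move: (D * (d * (1 - K * d))) (D * d * `|a.1|^-1) (D * d * `|a.2|^-1).
move=> s y1 y2; move: (D * d) (a.1 * x.1) (a.2 * x.2) (y1 ^+ 2) (y2 ^+ 2) (d ^+ 2).
move: (x.1 ^+ 2) (x.2 ^+ 2) (a.1 ^+ 2) (a.2 ^+ 2).
by move=> ? ? ? ? ? ? ? ? ? ?; lra.
Qed.

Lemma at_corner_triangle d x : 0 < d -> V d x -> x.1 != 0 -> x.2 != 0 ->
  triangle a (d * (1 + K * d)) x.
Proof.
move=> dp Vx x1 x2; have [q1 q2] := at_corner_quadrant face1 face2 Vx.
have t := at_corner_tangent Vx; split.
- by rewrite lt_def q1 mulf_neq0.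
- by rewrite lt_def q2 mulf_neq0.
have Kd : 2 * D * d + d ^+ 2 <= 2 * (D * (d * (1 + K * d))).
  rewrite (_ : 2 * (D * (d * (1 + K * d))) = 2 * D * d + d ^+ 2 +
     (D * d * `|a.1|^-1) ^+ 2 + (D * d * `|a.2|^-1) ^+ 2); last first.
    by rewrite /K; move: `|a.1|^-1 `|a.2|^-1 => s r; field; rewrite gt_eqF.
  by rewrite -addrA lerDl addr_ge0 ?sqr_ge0.
have s1 := sqr_ge0 x.1; have s2 := sqr_ge0 x.2.
move: t Kd s1 s2; move: (D * (d * _)) (2 * D * d) (d ^+ 2) (x.1 ^+ 2) (x.2 ^+ 2).
by move: (a.1 * x.1) (a.2 * x.2); move=> ? ? ? ? ? ? ?; lra.
Qed.

(* Off these four lines the coordinates of x and of M x do not vanish, so that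
   the open triangles catch the whole target. *)
Let off (E : set (plane R)) := (((E `&` [set p | p.1 != 0]) `&` [set p | p.2 - 0 * p.1 != 0])
  `&` [set p | p.2 - (- 2) * p.1 != 0]) `&` [set p | p.2 - (- 1) * p.1 != 0].

Let offP E : measurable E -> measurable (off E) /\ leb2 R (off E) = leb2 R E.
Proof.
move=> mE; have ml (k : R) : measurable [set p : plane R | p.2 - k * p.1 != 0].
  by apply: measurable_neq0; apply: (@measurable_linE _ _ (- k) 1 0) => p; ring.
have mv : measurable [set p : plane R | p.1 != 0].
  by apply: measurable_neq0; exact: measurable_coord1.
have m1 := measurableI _ _ mE mv; have m2 := measurableI _ _ m1 (ml 0).
have m3 := measurableI _ _ m2 (ml (- 2)); split; first exact: measurableI.
by rewrite /off !leb2_off_line// leb2_off_vline.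
Qed.

Lemma cvg_two_hits (e : bool) :
  cvg_at0 (fun d => area (two_hits c a e d) / d `^ 2) (area (stay a e 1)).
Proof.
have s0 : 0 <= area (stay a e 1) by rewrite fine_ge0.
apply: (cvg_power_sandwich s0 d00 _ K0) => d dd Kd.
have [d01 _ _ dC] := d0P dd; have /andP[dp _] := d01.
have tm : 0 < d * (1 - K * d) by rewrite mulr_gt0.
have tp : 0 < d * (1 + K * d) by rewrite mulr_gt0// ltr_wpDr// mulr_ge0// ltW.
have m2 := measurable_two_hits c a e d.
rewrite -(area_stay a e tm) -(area_stay a e tp); split.
  apply: le_area => //; first exact: measurable_stay.
    apply: (@bounded_box _ _ (C * d + 1)) => x [/(at_corner_small face1 face2 d01)[h1 h2] _].
    by split; [apply: le_lt_trans h1 _|apply: le_lt_trans h2 _]; rewrite ltrDl.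
  move=> x [T1 T2]; split; first exact: triangle_at_corner T1.
  by apply: hits_iter_corner => //; exact: triangle_at_corner T2.
have [mo oE] := offP m2.
have aE : area (off (two_hits c a e d)) = area (two_hits c a e d) by rewrite /area oE.
rewrite -aE; apply: (le_area mo (measurable_stay a e _) (bounded_stay face1 face2 e _)).
move=> x [[[[[Vx hx] /= n1] n2] n3] n4].
rewrite mul0r subr0 in n2; rewrite mulNr opprK addrC in n3.
rewrite mulN1r opprK addrC in n4.
split; first exact: at_corner_triangle.
have := corner_hits_iter face1 face2 d01 dC Vx hx.
by case: (e) => /= h; apply: at_corner_triangle.
Qed.

(** The escapes are the target minus the points that stay in it, and both parts
    scale as the square of delta. *)
Lemma corner_hitting_law :
  hitting_law pM D 2 (area (stay a false 1) - area (stay a true 1)).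
Proof.
have lim : cvg_at0 (fun d => pr (hits pM (D + d)) / d `^ 2) (area (stay a false 1)).
  rewrite (_ : (fun d => _) = (fun d => area (two_hits c a false d) / d `^ 2)).
    exact: cvg_two_hits.
  by apply/funext => d; rewrite -(pr_two_hits c a false d)/= setIid.
apply: (@hitting_law_intro _ _ _ _ _ (area (stay a false 1)) 8 (escapes c a)) => //.
- by rewrite subr_gt0; exact: area_stay_lt.
- exact: ltW.
- move=> p; rewrite -[X in hits _ X]addr0 => /(hits_corner face1 face2)[v [_ Vx]].
  have [q1 q2] := at_corner_quadrant face1 face2 Vx.
  have := at_corner_tangent Vx.
  rewrite mulr0 expr0n/= addr0 ltNge => /negP; apply.
  by rewrite addr_ge0 ?mulr_ge0 ?addr_ge0 ?sqr_ge0.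
- exact: toral_escapes.
- by move=> d p [].
- by move=> d.
- move=> d v; apply: modulus_escape.
  + exact: measurable_target.
  + exact: target_Lambda.
  + exact: target_xitv.
  + exact: target_yitv.
- rewrite (_ : (fun d => _) = (fun d => pr (hits pM (D + d)) / d `^ 2 -
      area (two_hits c a true d) / d `^ 2)).
    by apply: cvg_at0B; [exact: lim|exact: cvg_two_hits].
  apply/funext => d; rewrite -mulrBl -(pr_two_hits c a true d); congr (_ / _).
  have tH := toral_hits pM (D + d).
  have [mH mM] := (toral_meas tH, toral_meas (toral_catM tH)).
  by rewrite (pr_setDI mH mM) addrK.
- by move=> delta l dp dl; exact: no_clusters_escapes dl.
Qed.

End corner_law.

(** * Almost every centre *)

Section almost_every_centre.
Variable R : realType.
Notation leb := (@lebesgue_measure R).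
Notation RR := (measurableTypeR R).

Lemma ae_leb2_fst (P : R -> Prop) :
  {ae leb, forall x, P x} -> {ae leb2 R, forall p, P p.1}.
Proof.
move=> [N [mN N0 PN]]; exists (N `*` [set: RR]); split.
- exact: measurableX.
- apply: etrans; first exact: product_measure1E.
  transitivity (0 * leb setT)%E; last exact: mul0e.
  by congr (_ * _)%E; exact: N0.
- by move=> p nP; split => //; exact: PN.
Qed.

Lemma ae_leb2_snd (P : R -> Prop) :
  {ae leb, forall x, P x} -> {ae leb2 R, forall p, P p.2}.
Proof.
move=> [N [mN N0 PN]]; exists ([set: RR] `*` N); split.
- exact: measurableX.
- apply: etrans; first exact: product_measure1E.
  transitivity (leb setT * 0)%E; last exact: mule0.
  by congr (_ * _)%E; exact: N0.
- by move=> p nP; split => //; exact: PN.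
Qed.

Lemma ae_leb2_nu (P : plane R -> Prop) :
  {ae @nu R, forall p, P p} -> {ae leb2 R, forall p, Lambda p -> P p}.
Proof.
move=> [N [mN N0 PN]]; exists (N `&` @Lambda R); split.
- by apply: measurableI => //; exact: measurable_Lambda.
- exact: N0.
- by move=> p /not_implyP[Lp nP]; split => //; exact: PN.
Qed.

Lemma ae_and d (T : measurableType d) (mu : {measure set T -> \bar R})
    (P Q : T -> Prop) : {ae mu, forall x, P x} -> {ae mu, forall x, Q x} ->
  {ae mu, forall x, P x /\ Q x}.
Proof. by have [_ I _] := ae_filter_ringOfSetsType mu; exact: I. Qed.

Lemma ae_imp d (T : measurableType d) (mu : {measure set T -> \bar R})
    (P Q : T -> Prop) : {ae mu, forall x, P x} -> (forall x, P x -> Q x) ->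
  {ae mu, forall x, Q x}.
Proof. by have [_ _ S] := ae_filter_ringOfSetsType mu => h PQ; exact: S h. Qed.

Lemma ae_neq (y : R) : {ae leb, forall x, x != y}.
Proof.
exists [set y]; split; [exact: measurable_set1|exact: lebesgue_measure_set1|].
by move=> x /= /negP; rewrite negbK => /eqP.
Qed.

Lemma facing_outside (x : R) : x != 0 -> x != 1 -> ~ (0 < x < 1) ->
  exists c a, facing c a /\ x = c - a.
Proof.
move=> x0 x1 nx; have [xn|xp] := ltP x 0.
  by exists 0, (- x); split; [left; rewrite oppr_gt0|rewrite sub0r opprK].
exists 1, (1 - x); split; last by ring.
right; split => //; rewrite subr_lt0 lt_neqAle eq_sym x1/= leNgt; apply/negP => xl.
by apply: nx; rewrite xl lt0r x0 xp.
Qed.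

Lemma beside (x : R) : x != 0 -> x != 1 -> ~ (0 < x < 1) ->
  exists s c D, [/\ (s = 1 /\ c = 0) \/ (s = -1 /\ c = 1), 0 < D & x = c - s * D].
Proof.
move=> x0 x1 /(facing_outside x0 x1)[c [a [[[-> a0]|[-> a0]] ->]]].
  by exists 1, 0, a; split; [left|exact: a0|ring].
by exists (-1), 1, (- a); split; [right|rewrite oppr_gt0|ring].
Qed.

(** The shape of the limit only depends on the position of the centre: in the
    square, facing one of its sides, or facing one of its corners. *)
Lemma ae_hitting_law : {ae leb2 R, forall pM : plane R, exists D b kappa,
  [/\ hitting_law pM D b kappa,
      Lambda pM -> D = 0 /\ b = 2,
      ~ Lambda pM /\ (0 < pM.2 < 1 \/ 0 < pM.1 < 1) -> 0 < D /\ b = 3 / 2 &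
      ~ Lambda pM /\ ~ (0 <= pM.1 <= 1) /\ ~ (0 <= pM.2 <= 1) -> 0 < D /\ b = 2]}.
Proof.
have nb := ae_leb2_nu (@ae_no_clusters_box R).
have nv := ae_leb2_snd (@ae_no_clusters_vertical R).
have nh := ae_leb2_fst (@ae_no_clusters_horizontal R).
have n01 := ae_leb2_fst (ae_and (ae_neq 0) (ae_neq 1)).
have n02 := ae_leb2_snd (ae_and (ae_neq 0) (ae_neq 1)).
apply: (ae_imp (ae_and nb (ae_and (ae_and nv nh) (ae_and n01 n02)))).
move=> pM [cb [[cv ch] [[x0 x1] [y0 y1]]]].
have LE : Lambda pM <-> 0 < pM.1 < 1 /\ 0 < pM.2 < 1.
  by rewrite (LambdaE true)/= !lt0r x0 y0.
have in01 (x : R) : 0 < x < 1 -> 0 <= x <= 1 by move=> /andP[? ?]; rewrite !ltW.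
have [ix|ox] := pselect (0 < pM.1 < 1); have [iy|oy] := pselect (0 < pM.2 < 1).
- have Lp : Lambda pM by apply/LE.
  exists 0, 2, (area (@unit_disc R)); split => // [|[]//|[]//].
  exact: interior_hitting_law ix iy (cb Lp).
- have [s [c [D [sc D0 yE]]]] := beside y0 y1 oy.
  exists D, (3 / 2), (area (parab D 1)); split.
  + exact: (@side_hitting_law _ false s c D pM sc D0 yE ix ch).
  + by move=> /LE[].
  + by [].
  + by move=> [_ [/(_ (in01 _ ix))]].
- have [s [c [D [sc D0 xE]]]] := beside x0 x1 ox.
  exists D, (3 / 2), (area (parab D 1)); split.
  + exact: (@side_hitting_law _ true s c D pM sc D0 xE iy cv).
  + by move=> /LE[].
  + by [].
  + by move=> [_ [_ /(_ (in01 _ iy))]].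
- have [c1 [a1 [f1 xE]]] := facing_outside x0 x1 ox.
  have [c2 [a2 [f2 yE]]] := facing_outside y0 y1 oy.
  pose c : plane R := (c1, c2); pose a : plane R := (a1, a2).
  exists (depth a), 2, (area (stay a false 1) - area (stay a true 1)); split.
  + rewrite (_ : pM = corner_point c a).
      exact: (@corner_hitting_law _ c a f1 f2).
    by rewrite /corner_point/= -xE -yE; case: (pM).
  + by move=> /LE[].
  + by move=> [_ []].
  + by move=> _; split => //; exact: (@depth_gt0 _ c a f1).
Qed.

End almost_every_centre.

Unset Implicit Arguments.

Theorem mainTheorem1 (R : realType) (alpha : R) (alpha_gt0 : 0 < alpha) :
  {ae leb2 R, forall pM : plane R,
    let X := process (observable alpha pM) in
    (exists xi : R, is_tail_index (@nu R) X xi) /\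
    (forall xi : R, is_tail_index (@nu R) X xi ->
      [/\ Lambda pM -> - xi^-1 = 2 / alpha,
          ~ Lambda pM /\ (0 < pM.2 < 1 \/ 0 < pM.1 < 1) -> - xi^-1 = 3 / 2 &
          ~ Lambda pM /\ ~ (0 <= pM.1 <= 1) /\ ~ (0 <= pM.2 <= 1) ->
            - xi^-1 = 2])}.
Proof.
apply: (ae_imp (@ae_hitting_law R)) => pM [D [b [kappa [law inside side corner]]]].
have [ex tail] := tail_index_of_hitting_law alpha_gt0 law.
split=> // xi /tail ->; rewrite /shape; split.
- by move=> /inside[-> ->]; rewrite eqxx.
- by move=> /side[D0 ->]; rewrite gt_eqF.
- by move=> /corner[D0 ->]; rewrite gt_eqF.
Qed.
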